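(* Let $\mathrm{Var}(P)$ be the stationary variance of $P(t)$ attained by Exact Scheduling, i.e. by $r_k(t)=u(x_k(t),y_k(t))$ with $u(x,y)=x/y$ if $y>0$ and $u(x,y)=0$ otherwise. Let $\mathrm{Var}(P^\dagger)$ be the optimal (smallest) stationary variance of the service capacity among the centralized policies of the form $r_k(t)=c(k,t,A_t)$ for which every job $k$ satisfies $r_k(t)\in[0,1]$ for all $t$, $\int_{a_k}^\infty r_k(t)\,dt=\sigma_k$, and $r_k(t)\le\mathbf 1\{a_k\le t<a_k+\tau_k\}$ for all $t$. Then $$\mathrm{Var}(P)\ \le\ \frac{4\,\mathbb E[\sigma^2/\tau]\,\big(\mathbb E[\tau\sigma^2]+\Lambda\,\mathbb E[\tau\sigma]^2\big)}{\mathbb E[\sigma^2]^2}\ \mathrm{Var}(P^\dagger).$$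
   Context: Jobs $k\in\mathcal V=\{1,2,\dots\}$ have arrival time $a_k$, service demand $\sigma_k$ and sojourn time $\tau_k$ (deadline $a_k+\tau_k$). $\{(a_k;\sigma_k,\tau_k)\}$ is an independently marked stationary Poisson point process: arrivals are Poisson with constant rate $\Lambda>0$, and the marks $(\sigma_k,\tau_k)$ are i.i.d., independent of the arrival times, with probability density $f$ on a bounded set $S\subset\{(\sigma,\tau):\tau\ge\sigma\ge0\}$; $\mathbb E[\varphi(\sigma,\tau)]$ is expectation with $(\sigma,\tau)\sim f$, and $\mathbb E[\cdot]^2=(\mathbb E[\cdot])^2$. Job $k$ is served at rate $r_k(t)$, zero for $t<a_k$. Its remaining demand is $x_k(t)=\sigma_k-\int_{a_k}^t r_k(s)\,ds$, its remaining time is $y_k(t)=a_k+\tau_k-t$, and the service capacity is $P(t)=\sum_k r_k(t)$. A centralized (online) policy has the form $r_k(t)=c(k,t,A_t)$, where $A_t=\{(a_k,\sigma_k,\tau_k,x_k(t),y_k(t)):a_k\le t\}$ is the information on all jobs that arrived no later than $t$ and $c(k,t,\cdot)$ is a deterministic map from $A_t$ to a service rate. Variances of $P(t)$ are taken in the stationary regime of the system under the policy. *)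

(* Defs.v *)
From HB Require Import structures.
From mathcomp Require Import all_boot all_order all_algebra.
From mathcomp Require Import all_classical all_reals all_analysis.

Set Implicit Arguments.
Unset Strict Implicit.
Unset Printing Implicit Defensive.
Import Order.TTheory GRing.Theory Num.Theory.
Import numFieldNormedType.Exports.

Local Open Scope classical_set_scope.
Local Open Scope ring_scope.

Section Density.
Context {R : realType}.

Definition leb2 := (@lebesgue_measure R \x @lebesgue_measure R)%E.

(* The points of R * R are the pairs (service demand, sojourn time). *)
Record is_density_on (S : set (R * R)) (f : R * R -> R) : Prop := {
  support_bounded : bounded_set (S : set (R^o * R^o)%type);
  support_feasible : forall z, S z -> 0 <= z.1 <= z.2;
  density_measurable : measurable_fun setT f;
  density_ge0 : forall z, 0 <= f z;
  density_support : forall z, ~ S z -> f z = 0;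
  density_total : (\int[leb2]_z (f z)%:E = 1)%E }.

Definition mark_mean (f : R * R -> R) (phi : R -> R -> R) : R :=
  \int[leb2]_z (phi z.1 z.2 * f z).

End Density.

Section Independence.
Context {d : measure_display} {Omega : measurableType d} {R : realType}.
Variable Pr : probability Omega R.

Definition mutually_independent (I : eqType) (F : I -> set (set Omega)) : Prop :=
  forall (s : seq I) (E : I -> set Omega), uniq s ->
    (forall i, i \in s -> F i (E i)) ->
    Pr (\big[setI/setT]_(i <- s) E i) = (\prod_(i <- s) Pr (E i))%E.

End Independence.

Section Model.
Context {d : measure_display} {Omega : measurableType d} {R : realType}.
Variable Pr : probability Omega R.

(* Jobs are numbered 0, 1, 2, ... in the order of their arrivals. *)
Record jobs := Jobs {
  arrival : nat -> {RV Pr >-> R};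
  demand : nat -> {RV Pr >-> R};
  sojourn : nat -> {RV Pr >-> R} }.

Definition mark (J : jobs) (k : nat) (w : Omega) : R * R :=
  (demand J k w, sojourn J k w).

Definition arrivals_in (J : jobs) (s t : R) (w : Omega) : \bar R :=
  (\sum_(0 <= k <oo) (\1_(`]s, t]) (arrival J k w))%:E)%E.

(* Homogeneous Poisson process on the half-line: the numbers of arrivals in
   consecutive intervals are independent Poisson variables.  The sequence t is
   strictly increasing because poisson_pmf is a junk value at rate 0. *)
Record poisson_arrivals (J : jobs) (Lambda : R) : Prop := {
  arrivals_ordered :
    {ae Pr, forall w, forall k, 0 < arrival J k w <= arrival J k.+1 w};
  arrivals_counts : forall (t : nat -> R) (n : nat -> nat) (m : nat),
    0 <= t 0%N -> (forall i, t i < t i.+1) ->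
    Pr (\big[setI/setT]_(i < m)
          [set w | arrivals_in J (t i) (t i.+1) w = (n i)%:R%:E]) =
    (\prod_(i < m) poisson_pmf (Lambda * (t i.+1 - t i)) (n i))%:E }.

(* None stands for the whole sequence of arrival times, Some k for the mark of
   job k: mutual independence of this family says that the marks are mutually
   independent and independent of the arrival process. *)
Definition job_field (J : jobs) (i : option nat) : set (set Omega) :=
  if i is Some k then [set mark J k @^-1` B | B in measurable]
  else <<s [set E | exists k (B : set R),
                measurable B /\ E = arrival J k @^-1` B] >>.

Record marked_poisson (J : jobs) (Lambda : R) (f : R * R -> R) : Prop := {
  marked_arrivals : poisson_arrivals J Lambda;
  marked_law : forall k (B : set (R * R)), measurable B ->
    Pr (mark J k @^-1` B) = (\int[leb2]_(z in B) (f z)%:E)%E;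
  marked_independent : mutually_independent Pr (job_field J) }.

(* Events determined by the jobs that arrived no later than t. *)
Definition history (J : jobs) (t : R) : set (set Omega) :=
  <<s [set E | exists k (B : set (R * (R * R))), measurable B /\
        E = [set w | arrival J k w <= t /\ B (arrival J k w, mark J k w)]] >>.

(* A rate process r gives the service rate r k t w of job k at time t. *)
Definition rate_process := nat -> R -> Omega -> R.

Definition remaining_demand (J : jobs) (r : rate_process) k (t : R) w : R :=
  demand J k w - \int[lebesgue_measure]_(s in `[arrival J k w, t]) r k s w.

Definition remaining_time (J : jobs) k (t : R) w : R :=
  arrival J k w + sojourn J k w - t.

Definition capacity (r : rate_process) (t : R) (w : Omega) : R :=
  fine (\sum_(0 <= k <oo) (r k t w)%:E)%E.

Record service (J : jobs) (r : rate_process) : Prop := {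
  service_measurable : forall k,
    measurable_fun setT (fun z : R * Omega => r k z.1 z.2);
  service_integrable : {ae Pr, forall w, forall k t,
    lebesgue_measure.-integrable `[arrival J k w, t] (EFin \o (r k)^~ w)};
  service_after_arrival : {ae Pr, forall w, forall k t,
    t < arrival J k w -> r k t w = 0} }.

Definition exact_rate (x y : R) : R := if 0 < y then x / y else 0.

Definition exact_scheduling (J : jobs) (r : rate_process) : Prop :=
  service J r /\
  {ae Pr, forall w, forall k t, arrival J k w <= t ->
    r k t w = exact_rate (remaining_demand J r k t w) (remaining_time J k t w)}.

Definition information (J : jobs) (r : rate_process) (t : R) (w : Omega) :
    set (R * R * R * R * R) :=
  [set z | exists k, arrival J k w <= t /\
     z = (arrival J k w, demand J k w, sojourn J k w,
          remaining_demand J r k t w, remaining_time J k t w)].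

(* The law r_k(t) = c(k, t, A_t) is an implicit equation for r, as A_t contains
   the remaining demands; for irregular c it may have several solutions, and
   nonanticipative excludes those whose selection looks at future arrivals or
   at external randomness. *)
Record centralized (J : jobs) (r : rate_process) : Prop := {
  centralized_service : service J r;
  centralized_law : exists c : nat -> R -> set (R * R * R * R * R) -> R,
    {ae Pr, forall w, forall k t, r k t w = c k t (information J r t w)};
  nonanticipative : forall k t, exists rho : Omega -> R,
    (forall B : set R, measurable B -> history J t (rho @^-1` B)) /\
    {ae Pr, forall w, r k t w = rho w} }.

Record feasible (J : jobs) (r : rate_process) : Prop := {
  feasible_rate : {ae Pr, forall w, forall k t, 0 <= r k t w <= 1};
  feasible_demand : {ae Pr, forall w, forall k,
    (\int[lebesgue_measure]_(t in `[arrival J k w, +oo[) (r k t w)%:E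
     = (demand J k w)%:E)%E};
  feasible_deadline : {ae Pr, forall w, forall k t,
    r k t w <= ((arrival J k w <= t < arrival J k w + sojourn J k w)%R)%:R} }.

End Model.

Section StationaryRegime.
Context {R : realType}.

Definition bounded_continuous n (g : 'rV[R]_n -> R) : Prop :=
  continuous g /\ exists M : R, forall x, `|g x| <= M.

Definition stationary_process d (Omega : measurableType d)
    (Pr : probability Omega R) (Q : R -> {RV Pr >-> R}) : Prop :=
  forall n (h : 'I_n -> R) (s : R) (g : 'rV[R]_n -> R),
    (forall i, 0 <= h i) -> 0 <= s -> bounded_continuous g ->
    ('E_Pr[fun w => g (\row_i Q (h i + s)%R w)] =
     'E_Pr[fun w => g (\row_i Q (h i) w)])%E.

(* v is the variance of a process P in its stationary regime: the processes
   P(t + _) converge, as t --> +oo and in the sense of finite-dimensional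
   distributions, to a stationary process on [0, +oo[ of variance v. *)
Definition stationary_variance d (Omega : measurableType d)
    (Pr : probability Omega R) (P : R -> Omega -> R) (v : R) : Prop :=
  exists d' (Omega' : measurableType d') (Pr' : probability Omega' R)
         (Q : R -> {RV Pr' >-> R}),
  [/\ stationary_process Q,
      forall n (h : 'I_n -> R) (g : 'rV[R]_n -> R),
        (forall i, 0 <= h i) -> bounded_continuous g ->
        ('E_Pr[fun w => g (\row_i P (t + h i)%R w)] @[t --> +oo%R] -->
         'E_Pr'[fun w => g (\row_i Q (h i) w)])%E
    & ('V_Pr'[Q 0%R] = v%:E)%E].

Definition optimal_variance d (Omega : measurableType d)
    (Pr : probability Omega R) (J : jobs Pr) : \bar R :=
  ereal_inf [set v%:E | v in [set v | exists r : rate_process,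
    [/\ centralized J r, feasible J r
      & stationary_variance Pr (capacity r) v]]].

End StationaryRegime.

(* Main.v *)
(* Let X be the total remaining demand and P the capacity.  Under Exact
   Scheduling P is the shot noise with marks sigma / tau, so Campbell's formula
   gives the variance V = Lambda E[sigma^2 / tau].  For any feasible policy,
   X(t + h) = X(t) + A - I, where A is the demand that arrives in ]t, t + h] and
   I the integral of P over this interval.  The policy cannot anticipate
   arrivals, so A is uncorrelated with X(t), and
     E[X(t + h)^2] - E[X(t)^2] ~ h (Lambda E[sigma^2] - 2 Cov(X, P))
   for small h, with 2 Cov(X, P) <= theta E[X^2] + Var(P) / theta.  As X is at
   most the sum of the sizes of the jobs in their sojourn windows, E[X^2] <= C,
   where C := Lambda E[tau sigma^2] + (Lambda E[tau sigma])^2.  A bounded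
   sequence cannot keep increasing, hence
   Lambda E[sigma^2] <= theta C + Var(P) / theta for every theta > 0, that is
   (Lambda E[sigma^2])^2 <= 4 C Var(P); the theorem is V divided by this bound. *)

Require Import Defs.
From HB Require Import structures.
From mathcomp Require Import all_boot all_order all_algebra.
From mathcomp Require Import all_classical all_reals all_analysis.
From mathcomp Require Import measurable_realfun zify lra ring.
Set Implicit Arguments.
Unset Strict Implicit.
Unset Printing Implicit Defensive.
Import Order.TTheory GRing.Theory Num.Theory.
Import numFieldNormedType.Exports.
Import HBNNSimple.
Local Open Scope classical_set_scope.
Local Open Scope ring_scope.
(** * Uncorrelated variables *)

(** The drift argument runs at finite times, and three obstacles shape it. Policies are merely
    measurable in time, so nothing is differentiated: over a step of length [h],
    [(A - I)^2 >= (1 - eps) A^2 - I^2 / eps] separates [E[A^2]], of order [h], from [E[I^2]], of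
    order [h^2]. The stationary regime is a limit of the laws of [P] alone, not jointly with [X], so
    its variance is carried back to large finite [t], which takes a fourth moment bound uniform in
    [t]. The centring constant of [P] is then the limit mean [m], that of the inflow rate is [Lambda
    E[sigma]], and the mean terms have the right sign because [m <= Lambda E[sigma]]. The model
    gives independence for counts on consecutive intervals and for marks indexed by job number,
    whereas the past is a sigma-algebra generated by arrival times and marks. Thresholds on arrival
    times are therefore rewritten as conditions on counts over a finite grid, and a pi-system
    argument reaches all past events. For the shot noise, grid sums yield a lower bound on the mean
    and an upper bound on the second moment, which together bound the variance. *)

Section DensityMeasure.
Context d (T : measurableType d) (R : realType) (mu : {measure set T -> \bar R}).
Variables (Y : T -> \bar R) (mY : measurable_fun setT Y)
  (Y0 : forall x, (0 <= Y x)%E).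

(** The two proofs are arguments so that the measure structure declared below can be found from the
    term [weighted_measure mu mY Y0]. *)
Definition weighted_measure of measurable_fun setT Y & (forall x, 0 <= Y x)%E :
  set T -> \bar R := fun A => (\int[mu]_(x in A) Y x)%E.

Local Notation nu := (weighted_measure mY Y0).

Let nu0 : nu set0 = 0%E.
Proof. exact: integral_set0. Qed.

Let nu_ge0 A : (0 <= nu A)%E.
Proof. exact: integral_ge0. Qed.

Let nu_sigma : semi_sigma_additive nu.
Proof.
move=> F mF tF mUF; rewrite /weighted_measure ge0_integral_bigcup//.
  apply: is_cvg_nneseries => n _ _; exact: integral_ge0.
exact: measurable_funTS.
Qed.

HB.instance Definition _ := isMeasure.Build _ _ _ nu nu0 nu_ge0 nu_sigma.

(** True by definition for indicators, hence for simple functions by linearity; monotone convergence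
    along the simple approximations [h n] does the rest. *)
Lemma ge0_integral_weighted (g : T -> \bar R) :
  measurable_fun setT g -> (forall x, 0 <= g x)%E ->
  (\int[nu]_x g x = \int[mu]_x (g x * Y x))%E.
Proof.
move=> mg g0.
pose h (n : nat) (x : T) : R := nnsfun_approx measurableT mg n x.
have hg x : (EFin \o h^~ x) @ \oo --> g x by exact: cvg_nnsfun_approx.
have nd_h x : {homo h^~ x : n m / (n <= m)%N >-> n <= m}.
  by move=> n m nm; exact/lefP/nd_nnsfun_approx.
have hE (s : {nnsfun T >-> R}) :
    (\int[nu]_x (s x)%:E = \int[mu]_x ((s x)%:E * Y x))%E.
  transitivity (\int[nu]_x \sum_(y \in range s) (y * \1_(s @^-1` [set y]) x)%:E)%E.
    by apply: eq_integral => x _; rewrite (fimfunE _ x) -fsumEFin.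
  transitivity (\int[mu]_x \sum_(y \in range s)
      ((y * \1_(s @^-1` [set y]) x)%:E * Y x))%E; last first.
    apply: eq_integral => x _; rewrite -ge0_mule_fsuml => [|y]; last first.
      exact: nnfun_muleindic_ge0.
    by rewrite (fimfunE _ x) -fsumEFin.
  rewrite ge0_integral_fsum//; last 2 first.
  - by move=> r; exact/measurable_EFinP/measurableT_comp.
  - by move=> r x _; exact: nnfun_muleindic_ge0.
  rewrite ge0_integral_fsum//; last 2 first.
  - by move=> r; apply: emeasurable_funM => //; exact/measurable_EFinP/measurableT_comp.
  - by move=> r x _; apply: mule_ge0 => //; exact: nnfun_muleindic_ge0.
  apply: eq_fsbigr => r /set_mem [x _ <-{r}].
  under eq_integral do rewrite EFinM.
  rewrite ge0_integralZl//; last 2 first.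
  - exact/measurable_EFinP.
  - by rewrite lee_fin.
  under [RHS]eq_integral do rewrite EFinM -muleA.
  rewrite ge0_integralZl//; last 3 first.
  - by apply: emeasurable_funM => //; exact/measurable_EFinP.
  - by move=> y _; rewrite mule_ge0 ?lee_fin ?h0.
  - by rewrite lee_fin.
  rewrite integral_indic// setIT; congr (_ * _)%E.
  rewrite [LHS](integral_mkcond _ Y); apply: eq_integral => y _.
  by rewrite epatch_indic muleC.
have mh n : measurable_fun setT (EFin \o h n) by exact/measurable_EFinP.
have h0 n x : 0 <= h n x by rewrite /h.
transitivity (limn (fun n => \int[nu]_x (h n x)%:E)%E).
  transitivity (\int[nu]_x limn (fun n => (h n x)%:E))%E.
    by apply: eq_integral => x _; apply/esym/cvg_lim => //; exact: hg.
  rewrite monotone_convergence//.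
  - by move=> n x _ /=; rewrite lee_fin h0.
  - by move=> x _ n m nm; rewrite lee_fin; exact: nd_h.
under eq_fun do rewrite hE.
transitivity (\int[mu]_x limn (fun n => (h n x)%:E * Y x))%E.
  rewrite monotone_convergence//.
  - by move=> n; apply: emeasurable_funM; [exact: mh|exact: mY].
  - by move=> n x _; rewrite mule_ge0 ?lee_fin ?h0.
  - by move=> x _ n m nm; rewrite lee_wpmul2r// lee_fin; exact: nd_h.
apply: eq_integral => x _; apply/cvg_lim => //.
(* Multiplication by [+oo] is not continuous at 0, so this case is separate: if [g x = 0] every
   [h n x] is 0, otherwise [h n x] is eventually positive; either way the products are eventually
   constant. *)
have [Yoo|Yfin] := eqVneq (Y x) +oo%E; last first.
  by apply: cvgeZr (hg x); rewrite ge0_fin_numE ?ltey.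
rewrite Yoo; have [gx0|gx0] := eqVneq (g x) 0%E.
  rewrite gx0 mul0e; apply: cvg_near_cst; near=> n.
  suff -> : h n x = 0 by rewrite mul0e.
  apply/eqP; rewrite eq_le h0 andbT -lee_fin.
  have : ((h n x)%:E <= g x)%E by rewrite /h nnsfun_approxE le_approx.
  by rewrite gx0.
apply: cvg_near_cst; near=> n.
rewrite [in RHS]gt0_muley ?lt0e ?gx0 ?g0// gt0_muley//.
near: n.
have /open_ereal_gt' gt0 : (0 < g x)%E by rewrite lt0e gx0 g0.
exact: (hg x _ gt0).
Unshelve. all: by end_near. Qed.
End DensityMeasure.

Section Uncorrelated.
Context d (T : measurableType d) (R : realType).
Local Open Scope ereal_scope.

(** The hypothesis on [nu] makes it the image under [X] of the measure with density [Y]. Two uses: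
    factorising expectations, with [nu] a multiple of the law of [X], and passing from the law of a
    mark to its Lebesgue density, with [X] the identity. *)
Lemma ge0_integral_density d' (T' : measurableType d')
    (mu : {measure set T -> \bar R}) (nu : {measure set T' -> \bar R})
    (X : T -> T') (Y : T -> \bar R) (g : T' -> \bar R) :
  measurable_fun setT X -> measurable_fun setT Y -> (forall x, 0 <= Y x) ->
  (forall B, measurable B -> nu B = \int[mu]_(x in X @^-1` B) Y x) ->
  measurable_fun setT g -> (forall x, 0 <= g x) ->
  \int[nu]_x g x = \int[mu]_x (g (X x) * Y x).
Proof.
move=> mX mY Y0 nuE mg g0.
rewrite (eq_measure_integral (pushforward (weighted_measure mu mY Y0) X)); last first.
  by move=> B mB _; rewrite nuE.
rewrite ge0_integral_pushforward// preimage_setT ge0_integral_weighted//.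
- exact: measurableT_comp.
- by move=> x; exact: g0.
Qed.

Variable P : probability T R.

Let nneg_integral_fin (Y : T -> \bar R) : (forall x, 0 <= Y x) ->
  \int[P]_x Y x < +oo ->
  exists c : {nonneg R}, \int[P]_x Y x = c%:num%:E.
Proof.
move=> Y0 Yoo; have I0 : 0 <= \int[P]_x Y x by exact: integral_ge0.
have c0 : (0 <= fine (\int[P]_x Y x))%R by rewrite fine_ge0.
by exists (NngNum c0); rewrite /= fineK// ge0_fin_numE.
Qed.

(** [H |-> E[Y; H]] and [c P] with [c = E[Y]] are finite measures of equal mass that agree on a
    pi-system, hence on the sigma-algebra it generates. *)
Lemma sigma_uncorrelated (G : set (set T)) (Y : T -> \bar R) :
  G `<=` measurable -> setI_closed G -> G setT ->
  measurable_fun setT Y -> (forall x, 0 <= Y x) -> \int[P]_x Y x < +oo ->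
  (forall H, G H -> \int[P]_(x in H) Y x = P H * \int[P]_x Y x) ->
  forall H, <<s G >> H -> \int[P]_(x in H) Y x = P H * \int[P]_x Y x.
Proof.
move=> Gm GI GT mY Y0 Yoo GY H GH.
have [c cE] := nneg_integral_fin Y0 Yoo.
rewrite muleC cE.
apply: (@g_sigma_algebra_measure_unique _ R T G Gm (fun=> setT) _ _
  (weighted_measure P mY Y0) (mscale c P) GI _ _ H GH) => //.
- by rewrite bigcup_const.
- by move=> A GA; rewrite [LHS]GY// muleC cE.
Qed.

(** The image under [X] of the measure with density [Y] is the law of [X] scaled by [E[Y]]. The
    product formula is asked on the events of [X], which is the form that sigma-algebra arguments
    deliver. *)
Lemma uncorrelatedM d' (T' : measurableType d') (X : T -> T') (Y : T -> \bar R)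
    (g : T' -> \bar R) :
  measurable_fun setT X -> measurable_fun setT Y -> (forall x, 0 <= Y x) ->
  \int[P]_x Y x < +oo ->
  (forall B, measurable B ->
     \int[P]_(x in X @^-1` B) Y x = P (X @^-1` B) * \int[P]_x Y x) ->
  measurable_fun setT g -> (forall x, 0 <= g x) ->
  \int[P]_x (g (X x) * Y x) = \int[P]_x g (X x) * \int[P]_x Y x.
Proof.
move=> mX mY Y0 Yoo XY mg g0.
have [c cE] := nneg_integral_fin Y0 Yoo.
rewrite -(@ge0_integral_density _ _ P (mscale c (pushforward P X)))//.
  rewrite ge0_integral_mscale// cE muleC ge0_integral_pushforward//.
by move=> B mB; rewrite XY// muleC cE.
Qed.

End Uncorrelated.

(** * Factorial moments of the Poisson law *)

Section PoissonMoments.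
Context (R : realType) (l : R) (l0 : 0 < l).
Local Open Scope ereal_scope.

Lemma poisson_total : \sum_(n <oo) (poisson_pmf l n)%:E = 1.
Proof.
have := @probability_setT _ _ _ (poisson_prob l 0).
rewrite /= /poisson_prob l0 -nneseries_esumT// => n.
by rewrite lee_fin poisson_pmf_ge0.
Qed.

(** The first [j] terms vanish and [n ^_ j / n! = 1 / (n - j)!], so an index shift leaves [l ^+ j]
    times the total mass. First, second and fourth moments of counts are read off from these. *)
Lemma poisson_factorial_moment j :
  \sum_(n <oo) ((n ^_ j)%:R * poisson_pmf l n)%:E = (l ^+ j)%:E.
Proof.
rewrite (@nneseries_split _ _ 0 j)/=; last first.
  by move=> n _; rewrite lee_fin mulr_ge0// poisson_pmf_ge0.
rewrite add0n big_nat_cond big1 ?add0e; last first.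
  by move=> i /andP[/andP[_ ij] _]; rewrite ffact_small// mul0r.
rewrite -(@nneseries_addn _ _ j); last first.
  by move=> n; rewrite lee_fin mulr_ge0// poisson_pmf_ge0.
transitivity (\sum_(n <oo) (l ^+ j)%:E * (poisson_pmf l n)%:E).
  apply: eq_eseriesr => n _; rewrite -EFinM; congr EFin.
  rewrite /poisson_pmf l0 exprD.
  have -> : ((n + j)`! = (n + j) ^_ j * n`!)%N.
    by rewrite -[X in (_ * X`!)%N](addnK j) ffact_fact// leq_addl.
  rewrite natrM invfM.
  have : ((n + j) ^_ j)%:R != 0%R :> R by rewrite pnatr_eq0 -lt0n ffact_gt0 leq_addl.
  move: (n`!%:R^-1)%R (expR _) => a b; move: (((n + j) ^_ j)%:R)%R => c cn0.
  rewrite [LHS](_ : _ = (l ^+ j * (l ^+ n * a * b)) * (c * c^-1))%R; last by ring.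
  by rewrite mulfV// mulr1.
rewrite nneseriesZl// ?poisson_total ?mule1// => n _.
by rewrite lee_fin poisson_pmf_ge0.
Qed.

End PoissonMoments.

(** * Compound Poisson sums *)

Section Arrivals.
Context d (Omega : measurableType d) (R : realType) (Pr : probability Omega R).
Context (J : jobs Pr).
Local Open Scope ereal_scope.

Lemma measurable_mark k : measurable_fun setT (mark J k).
Proof. exact/measurable_fun_pair. Qed.

HB.instance Definition _ k :=
  isMeasurableFun.Build _ _ _ _ (mark J k) (measurable_mark k).

(** A compound Poisson sum over the jobs arriving in []s, t]]. Its values are extended reals: for
    nonnegative [phi] the series has a sum on every path, null sets included. *)
Definition compound (phi : R * R -> R) (s t : R) (w : Omega) : \bar R :=
  \sum_(0 <= k <oo) (phi (mark J k w) * \1_(`]s, t]) (arrival J k w))%:E.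

Lemma arrivals_in_compound s t : arrivals_in J s t = compound (cst 1%R) s t.
Proof. by apply/funext => w; apply: eq_eseriesr => k _; rewrite mul1r. Qed.

Section Compound.
Variables (phi : R * R -> R).

Lemma measurable_compound_term k s t : measurable_fun setT phi ->
  measurable_fun setT
    (fun w => (phi (mark J k w) * \1_(`]s, t]) (arrival J k w))%:E).
Proof.
move=> mphi; apply/measurable_EFinP/measurable_funM.
  by apply: measurableT_comp => //; exact: measurable_mark.
by apply: measurableT_comp => //; exact: measurable_indic.
Qed.

Hypothesis phi0 : forall z, (0 <= phi z)%R.

Lemma compound_term_ge0 k s t w :
  0 <= (phi (mark J k w) * \1_(`]s, t]) (arrival J k w))%:E.
Proof. by rewrite lee_fin mulr_ge0. Qed.

Lemma compound_ge0 s t w : 0 <= compound phi s t w.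
Proof. by apply: nneseries_ge0 => k _ _; exact: compound_term_ge0. Qed.

Lemma measurable_compound s t : measurable_fun setT phi ->
  measurable_fun setT (compound phi s t).
Proof.
move=> mphi; apply: ge0_emeasurable_sum => [k w _ _|k _].
  exact: compound_term_ge0.
exact: measurable_compound_term.
Qed.

Lemma compound_cat s t u w : (s <= t)%R -> (t <= u)%R ->
  compound phi s u w = compound phi s t w + compound phi t u w.
Proof.
move=> st tu; rewrite /compound -nneseriesD; last 2 first.
- by move=> k _ _; exact: compound_term_ge0.
- by move=> k _ _; exact: compound_term_ge0.
apply: eq_eseriesr => k _; rewrite -EFinD -mulrDr; congr (_ * _)%:E.
rewrite !indicE !mem_setE !in_itv/=.
case: (leP (arrival J k w) t) => [kt|tk] /=.
  by rewrite andbT addr0 (le_trans kt tu) andbT.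
by rewrite andbF add0r (le_lt_trans st tk).
Qed.

Lemma compound_chain (v : nat -> R) n w : (forall i, (v i <= v i.+1)%R) ->
  compound phi (v 0%N) (v n) w = \sum_(i < n) compound phi (v i) (v i.+1) w.
Proof.
move=> v_nd; elim: n => [|n IHn].
  rewrite big_ord0; apply: eseries0 => k _ _.
  by rewrite indicE mem_setE in_itv/= ltNge andNb mulr0.
rewrite big_ord_recr/= -IHn -compound_cat//.
elim: n {IHn} => // n; move/le_trans; exact.
Qed.

End Compound.

Variables (Lambda : R) (L0 : (0 < Lambda)%R).
Hypothesis pJ : poisson_arrivals J Lambda.

Lemma measurable_arrivals_in s t : measurable_fun setT (arrivals_in J s t).
Proof. by rewrite arrivals_in_compound; exact: measurable_compound. Qed.

Lemma arrivals_in_ge0 s t w : 0 <= arrivals_in J s t w.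
Proof. by rewrite arrivals_in_compound compound_ge0. Qed.

Lemma measurable_arrivals_in_eq s t (n : nat) :
  measurable [set w | arrivals_in J s t w = n%:R%:E].
Proof.
rewrite (_ : [set _ | _] = arrivals_in J s t @^-1` [set n%:R%:E])//.
by rewrite -[X in measurable X]setTI; exact: measurable_arrivals_in.
Qed.

Lemma arrivals_in_law s t n : (0 <= s)%R -> (s < t)%R ->
  Pr [set w | arrivals_in J s t w = n%:R%:E] =
  (poisson_pmf (Lambda * (t - s)) n)%:E.
Proof.
move=> s0 st; have ts0 : (0 < t - s)%R by rewrite subr_gt0.
have := arrivals_counts pJ (t := fun i => (s + i%:R * (t - s))%R) (fun=> n) 1.
rewrite !big_ord1/= mul0r addr0 mul1r subrKC; apply => // i.
by rewrite ltrD2l ltr_pM2r// ltr_nat.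
Qed.

(** On each event [N = n] the variable [Y] is the constant [psi n], and these events exhaust [G] up
    to a null set because [p] sums to 1. A set [G] that factorises from [N] covers plain
    expectations and expectations over a past event alike. *)
Lemma integral_count (G : set Omega) (N Y : Omega -> \bar R) (p psi : nat -> R) :
  measurable G -> (forall n, measurable [set w | N w = n%:R%:E]) ->
  (forall n, (0 <= p n)%R) -> \sum_(n <oo) (p n)%:E = 1 ->
  (forall n, Pr (G `&` [set w | N w = n%:R%:E]) = Pr G * (p n)%:E) ->
  measurable_fun setT Y -> (forall w, 0 <= Y w) -> (forall n, (0 <= psi n)%R) ->
  (forall w n, N w = n%:R%:E -> Y w = (psi n)%:E) ->
  \int[Pr]_(w in G) Y w = Pr G * \sum_(n <oo) (psi n * p n)%:E.
Proof.
move=> mG mN p0 p1 GN mY Y0 psi0 YN.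
pose F n := G `&` [set w | N w = n%:R%:E].
have mF n : measurable (F n) by exact: measurableI.
have tF : trivIset setT F.
  apply/trivIsetP => i j _ _ ij; rewrite /F setIACA setIid -subset0 => w [_] /= [->].
  by move=> /eqP; rewrite eqe eqr_nat (negPf ij).
have FG : \bigcup_n F n `<=` G by move=> w [n _ []].
have PF : Pr (\bigcup_n F n) = Pr G.
  rewrite measure_semi_bigcup//; last exact: bigcupT_measurable.
  rewrite (eq_eseriesr (fun n _ => GN n)).
  rewrite -(fineK (fin_num_measure Pr _ mG)) nneseriesZl ?p1 ?mule1// => n _.
  by rewrite lee_fin.
have mU : measurable (\bigcup_n F n) by exact: bigcupT_measurable.
have PD : Pr (G `\` \bigcup_n F n) = 0.
  rewrite measureD//; last by rewrite ltey_eq fin_num_measure.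
  by rewrite (setIidr FG) [X in _ - X]PF subee// fin_num_measure.
rewrite -[in LHS](setDUK FG) ge0_integral_setU//; last 3 first.
- exact: measurableD.
- exact: measurable_funTS.
- by apply/disj_setPS; rewrite setDIK.
rewrite [X in _ + X]null_set_integral//; last 2 first.
- exact: measurableD.
- exact: measurable_funTS.
rewrite adde0 ge0_integral_bigcup//; last exact: measurable_funTS.
transitivity (\sum_(n <oo) Pr G * (psi n * p n)%:E); last first.
  rewrite -(fineK (fin_num_measure Pr _ mG)) nneseriesZl// => n _.
  by rewrite lee_fin mulr_ge0.
apply: eq_eseriesr => n _.
rewrite (eq_integral (cst (psi n)%:E)); last by move=> w /set_mem[_ /=]; exact: YN.
by rewrite integral_cst// [X in _ * X]GN EFinM muleCA.
Qed.

End Arrivals.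

Section AlmostEverywhereSets.
Context d (T : measurableType d) (R : realType) (mu : {measure set T -> \bar R}).
Local Open Scope ereal_scope.

Lemma ge0_ae_eq_set_integral (E F : set T) (Y : T -> \bar R) :
  measurable E -> measurable F -> measurable_fun setT Y -> (forall x, 0 <= Y x) ->
  {ae mu, forall x, E x <-> F x} -> \int[mu]_(x in E) Y x = \int[mu]_(x in F) Y x.
Proof.
move=> mE mF mY Y0 EF; rewrite integral_mkcond [RHS]integral_mkcond.
apply: ge0_ae_eq_integral => //.
- by apply/(measurable_restrictT _ mE); exact: measurable_funTS.
- by apply/(measurable_restrictT _ mF); exact: measurable_funTS.
- by move=> x _; apply: erestrict_ge0.
- by move=> x _; apply: erestrict_ge0.
apply: filterS EF => x EFx _; rewrite !patchE.
by congr (if _ then _ else _); apply/idP/idP => /set_mem/EFx; exact: mem_set.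
Qed.

Lemma ae_eq_set_measure (E F : set T) : measurable E -> measurable F ->
  {ae mu, forall x, E x <-> F x} -> mu E = mu F.
Proof.
move=> mE mF EF; have := @ge0_ae_eq_set_integral E F (cst 1) mE mF.
by rewrite !integral_cst// !mul1e; apply.
Qed.

End AlmostEverywhereSets.

(** * Moments of counts and independence of past counts *)

Section PoissonCounts.
Context d (Omega : measurableType d) (R : realType) (Pr : probability Omega R).
Context (J : jobs Pr) (Lambda : R) (L0 : 0 < Lambda).
Hypothesis pJ : poisson_arrivals J Lambda.
Local Open Scope ereal_scope.

Lemma integral_arrivals_in_fun (s t : R) (psi : nat -> R) (Y : Omega -> \bar R) :
  (0 <= s)%R -> (s < t)%R ->
  measurable_fun setT Y -> (forall w, 0 <= Y w) -> (forall n, (0 <= psi n)%R) ->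
  (forall w n, arrivals_in J s t w = n%:R%:E -> Y w = (psi n)%:E) ->
  \int[Pr]_w Y w =
  \sum_(n <oo) (psi n * poisson_pmf (Lambda * (t - s)) n)%:E.
Proof.
move=> s0 st mY Y0 psi0 YN.
rewrite (@integral_count _ _ _ Pr setT (arrivals_in J s t) Y
  (poisson_pmf (Lambda * (t - s))) psi)//.
- by rewrite [Pr _]probability_setT mul1e.
- by move=> n; exact: measurable_arrivals_in_eq.
- by move=> n; exact: poisson_pmf_ge0.
- by apply: poisson_total; rewrite mulr_gt0// subr_gt0.
- by move=> n; rewrite [Pr setT]probability_setT mul1e setTI (arrivals_in_law pJ).
Qed.

Lemma arrivals_in_mean (s t : R) : (0 <= s)%R -> (s < t)%R ->
  \int[Pr]_w arrivals_in J s t w = (Lambda * (t - s))%:E.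
Proof.
move=> s0 st; rewrite (@integral_arrivals_in_fun s t (fun n => n%:R))//.
- rewrite -[X in _ = X%:E]expr1 -poisson_factorial_moment.
    by apply: eq_eseriesr => n _; rewrite ffactn1.
  by rewrite mulr_gt0// subr_gt0.
- exact: measurable_arrivals_in.
- by move=> w; exact: arrivals_in_ge0.
Qed.

Lemma arrivals_in_sqr (s t : R) : (0 <= s)%R -> (s < t)%R ->
  \int[Pr]_w (arrivals_in J s t w * arrivals_in J s t w) =
  (Lambda * (t - s) + (Lambda * (t - s)) ^+ 2)%:E.
Proof.
move=> s0 st; have l0 : (0 < Lambda * (t - s))%R by rewrite mulr_gt0// subr_gt0.
rewrite (@integral_arrivals_in_fun s t (fun n => (n%:R * n%:R)%R))//.
(* [n ^ 2 = n + n (n - 1)]: the first two factorial moments. *)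
- rewrite EFinD -[X in X%:E + _]expr1 -!poisson_factorial_moment// -nneseriesD.
  + apply: eq_eseriesr => n _; rewrite -EFinD -mulrDl -natrM -natrD; congr (_%:R * _)%R%:E.
    rewrite ffactn1 ffactnS ffactn1; case: n => //= n.
    by rewrite mulnS.
  + by move=> n _ _; rewrite lee_fin mulr_ge0// poisson_pmf_ge0.
  + by move=> n _ _; rewrite lee_fin mulr_ge0// poisson_pmf_ge0.
- by apply: emeasurable_funM; exact: measurable_arrivals_in.
- by move=> w; apply: mule_ge0; exact: arrivals_in_ge0.
- by move=> w n ->; rewrite -EFinM.
Qed.

(** A count is a priori an extended real; the Poisson weights add up to 1, so the natural values
    take all the probability. *)
Lemma ae_arrivals_in_nat (s t : R) : (0 <= s)%R -> (s < t)%R ->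
  {ae Pr, forall w, exists n : nat, arrivals_in J s t w = n%:R%:E}.
Proof.
move=> s0 st; have l0 : (0 < Lambda * (t - s))%R by rewrite mulr_gt0// subr_gt0.
pose F n := [set w | arrivals_in J s t w = n%:R%:E].
have mF n : measurable (F n) by exact: measurable_arrivals_in_eq.
have mU : measurable (\bigcup_n F n) by exact: bigcupT_measurable.
have PU : Pr (\bigcup_n F n) = 1.
  rewrite measure_semi_bigcup// -?(poisson_total l0).
    by apply: eq_eseriesr => n _; rewrite [LHS](arrivals_in_law pJ).
  apply/trivIsetP => i j _ _ ij; rewrite /F -subset0 => w [/= ->].
  by move=> /eqP; rewrite eqe eqr_nat (negPf ij).
exists (~` \bigcup_n F n); split; first exact: measurableC.
  by rewrite [LHS]probability_setC// PU subee.
by move=> w /= nF [n _ Fnw]; apply: nF; exists n.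
Qed.

(** [C] is an arbitrary condition on the first [m] counts. Since counts are almost surely natural
    numbers, [E] is up to a null set a countable union of events prescribing [m] values, and for
    these the claim is the product formula for counts on [m.+1] consecutive cells. *)
Lemma poisson_past_uncorrelated (v : nat -> R) (m : nat)
    (C : (nat -> \bar R) -> Prop) (E : set Omega) :
  (0 <= v 0%N)%R -> (forall i, (v i < v i.+1)%R) ->
  (forall x y, (forall i, (i < m)%N -> x i = y i) -> C x -> C y) ->
  measurable E ->
  {ae Pr, forall w, E w <-> C (fun i => arrivals_in J (v i) (v i.+1) w)} ->
  \int[Pr]_(w in E) arrivals_in J (v m) (v m.+1) w =
  Pr E * \int[Pr]_w arrivals_in J (v m) (v m.+1) w.
Proof.
move=> v0 v_inc Cext mE EC.
have v_ge0 i : (0 <= v i)%R.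
  by elim: i => // i /le_trans; apply; exact: ltW.
pose V i w := arrivals_in J (v i) (v i.+1) w.
have mV i : measurable_fun setT (V i) by exact: measurable_arrivals_in.
have V0 i w : 0 <= V i w by exact: arrivals_in_ge0.
have l0 i : (0 < Lambda * (v i.+1 - v i))%R by rewrite mulr_gt0// subr_gt0.
pose A (n : nat -> nat) := [set w | forall i, (i < m)%N -> V i w = (n i)%:R%:E].
have AE n : A n = \big[setI/setT]_(i < m) [set w | V i w = (n i)%:R%:E].
  rewrite -(bigcap_mkord _ (fun i => [set w | V i w = (n i)%:R%:E])); apply/seteqP; split => w /=; first by move=> An i; exact: An.
  by move=> An i im; exact: An.
have mA n : measurable (A n).
  rewrite AE; apply: bigsetI_measurable => i _; exact: measurable_arrivals_in_eq.
(* The empty set is included to close [G] under intersection: events prescribing different values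
   are disjoint. *)
pose G := [set H | H = setT \/ H = set0 \/ exists n, H = A n].
have GY H : G H -> \int[Pr]_(w in H) V m w = Pr H * \int[Pr]_w V m w.
  move=> [->|[->|[n ->]]].
  - by rewrite [Pr _]probability_setT mul1e.
  - by rewrite integral_set0 measure0 mul0e.
  rewrite arrivals_in_mean// (@integral_count _ _ _ Pr _ (V m) _
    (poisson_pmf (Lambda * (v m.+1 - v m))) (fun n => n%:R))//.
  - rewrite -[X in _ = _ * X%:E]expr1 -poisson_factorial_moment//.
    by congr (_ * _); apply: eq_eseriesr => k _; rewrite ffactn1.
  - by move=> k; exact: measurable_arrivals_in_eq.
  - by move=> k; exact: poisson_pmf_ge0.
  - exact: poisson_total.
  move=> k; pose n' i := if i == m then k else n i.
  transitivity (Pr (\big[setI/setT]_(i < m.+1) [set w | V i w = (n' i)%:R%:E])).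
    rewrite big_ord_recr/= /n' eqxx AE; congr (Pr (_ `&` _)).
    by apply: eq_bigr => i _; rewrite (ltn_eqF (ltn_ord i)).
  rewrite [LHS](arrivals_counts pJ)// AE [in RHS](arrivals_counts pJ)//.
  rewrite big_ord_recr/= /n' eqxx EFinM; congr (_%:E * _).
  by apply: eq_bigr => i _; rewrite (ltn_eqF (ltn_ord i)).
have GI : setI_closed G.
  move=> H1 H2 [->|[->|[n1 ->]]] [->|[->|[n2 ->]]]; rewrite ?setTI ?setIT ?set0I ?setI0.
  all: try by [left|right; left|right; right; exists n1|right; right; exists n2].
  have [[w [w1 w2]]|nw] := pselect (A n1 `&` A n2 !=set0).
    right; right; exists n1; apply/seteqP; split => w' //=; first by case.
    move=> An1; split => // i im; rewrite An1//.
    by have := w2 _ im; rewrite (w1 _ im).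
  by right; left; rewrite -subset0 => w Aw; apply: nw; exists w.
(* Finite sequences of naturals are countable, so the union runs over their codes; a number that
   decodes to nothing contributes the empty set. *)
pose B (s : seq nat) :=
  if `[< C (fun i => (nth 0%N s i)%:R%:E) >] then A (nth 0%N s) else set0.
pose U := \bigcup_c oapp B set0 (unpickle c).
have GU : <<s G >> U.
  have subG : G `<=` <<s G >> by exact: sub_sigma_algebra.
  have [_ _ GUc] := smallest_sigma_algebra setT G.
  have G0 : G set0 by right; left.
  have GA n : G (A n) by right; right; exists n.
  apply: GUc => c; apply: subG; move: (unpickle c) => [s|//] /=.
  by rewrite /B; case: ifPn.
have Gm : G `<=` measurable by move=> H [->|[->|[n ->]]].
have mU : measurable U by exact: (smallest_sub (@sigma_algebra_measurable _ Omega) Gm).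
have EU : {ae Pr, forall w, E w <-> U w}.
  have Vnat : {ae Pr, forall w, forall i, exists n : nat, V i w = n%:R%:E}.
    by apply: ae_foralln => i; exact: ae_arrivals_in_nat.
  apply: filterS2 EC Vnat => w -> /choice[n Vn]; split.
    have nE i : (i < m)%N -> nth 0%N (mkseq n m) i = n i by exact: nth_mkseq.
    move=> Cw; exists (pickle (mkseq n m)) => //; rewrite pickleK /= /B asboolT.
      by move=> i im; rewrite Vn nE.
    by apply: Cext Cw => i im; rewrite [LHS]Vn nE.
  move=> [c _]; move: (unpickle c) => [s|//] /=; rewrite /B.
  case: asboolP => // Cs Aw.
  by apply: Cext Cs => i im; rewrite [RHS]Aw.
have -> : Pr E = Pr U by exact: ae_eq_set_measure.
rewrite (ge0_ae_eq_set_integral mE mU (mV m) (V0 m) EU).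
have Voo : \int[Pr]_w V m w < +oo by rewrite arrivals_in_mean// ltry.
by apply: (sigma_uncorrelated Gm GI _ (mV m) (V0 m)) => //; left.
Qed.

End PoissonCounts.

(** The independence of counts concerns consecutive intervals, so all the thresholds [us] of a past
    event are made points of one grid, in which []t, t']] is the cell that follows them. *)
Lemma increasing_grid (R : realType) (us : seq R) (t t' : R) :
  0 < t -> t < t' -> {in us, forall u, 0 <= u <= t} ->
  exists (v : nat -> R) (m : nat),
    [/\ v 0%N = 0, forall i, v i < v i.+1, v m = t, v m.+1 = t' &
      {in us, forall u, exists2 j, (j <= m)%N & v j = u}].
Proof.
move=> t0 tt' us_t.
pose s := sort <=%O (undup [:: 0, t & us]).
have s_mem u : (u \in s) = (u \in [:: 0, t & us]) by rewrite mem_sort mem_undup.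
have s_lt : sorted <%O s.
  by rewrite /s sort_lt_sorted undup_uniq.
have s_size : (1 < size s)%N.
  rewrite size_sort.
  have : {subset [:: 0; t] <= undup [:: 0, t & us]}.
    by move=> u; rewrite mem_undup !inE => /orP[->//|/eqP->]; rewrite eqxx orbT.
  by move=> /uniq_leq_size; apply; rewrite /= inE andbT eq_sym gt_eqF.
have s_bound u : u \in s -> 0 <= u <= t.
  rewrite s_mem !inE => /or3P[/eqP->|/eqP->|/us_t//].
    by rewrite lexx ltW.
  by rewrite lexx ltW.
have s_le i j : (i <= j)%N -> (j < size s)%N -> nth 0 s i <= nth 0 s j.
  move=> ij js; apply: (sorted_leq_nth le_trans) => //.
  - by move: s_lt; rewrite lt_sorted_uniq_le => /andP[].
  - by rewrite inE (leq_ltn_trans ij).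
pose m := (size s).-1.
have mS : m.+1 = size s by rewrite prednK// ltnW.
(* From [t'] on the grid continues in unit steps, because [arrivals_counts] requires an infinite
   strictly increasing sequence. *)
pose v i := if (i <= m)%N then nth 0 s i else t' + (i - m.+1)%:R.
have mem_v u : u \in s -> exists2 j, (j <= m)%N & v j = u.
  move=> us'; have im : (index u s <= m)%N by rewrite -ltnS mS index_mem.
  by exists (index u s) => //; rewrite /v im nth_index.
exists v, m; split.
- have /mem_v[j jm vj] : 0 \in s by rewrite s_mem inE eqxx.
  apply/eqP; rewrite eq_le; apply/andP; split.
    by rewrite -vj /v jm leq0n s_le// -mS.
  by have /s_bound/andP[] : v 0%N \in s by rewrite /v leq0n mem_nth// -mS.
- move=> i; rewrite /v; have [im|] := ltnP i m.
    rewrite (ltnW im); apply: (sorted_ltn_nth lt_trans) => //.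
      by rewrite inE -mS ltnW.
    by rewrite inE -mS ltnS.
  rewrite leq_eqVlt => /predU1P[<-|mi].
    rewrite leqnn subnn addr0 (le_lt_trans _ tt')//.
    by have /s_bound/andP[] : nth 0 s m \in s by rewrite mem_nth// -mS.
  by rewrite leqNgt mi/= ltrD2l ltr_nat subSS subnS prednK ?leqnn// subn_gt0.
- have /mem_v[j jm vj] : t \in s by rewrite s_mem !inE eqxx orbT.
  apply/eqP; rewrite eq_le; apply/andP; split.
    by have /s_bound/andP[] : v m \in s by rewrite /v leqnn mem_nth// -mS.
  by rewrite -[X in X <= _]vj /v jm leqnn s_le// -mS.
- by rewrite /v ltnn subnn addr0.
- by move=> u uu; apply: mem_v; rewrite s_mem !inE uu !orbT.
Qed.

(** * Arrival times expressed through counts *)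

Section ArrivalTimes.
Context d (Omega : measurableType d) (R : realType) (Pr : probability Omega R).
Context (J : jobs Pr) (Lambda : R) (L0 : 0 < Lambda).
Hypothesis pJ : poisson_arrivals J Lambda.
Local Open Scope ereal_scope.

Lemma ordered_arrivals_le w i j :
  (forall k, (0 < arrival J k w <= arrival J k.+1 w)%R) -> (i <= j)%N ->
  (arrival J i w <= arrival J j w)%R.
Proof.
move=> ord; elim: j => [|j IHj]; first by rewrite leqn0 => /eqP->.
rewrite leq_eqVlt => /predU1P[->//|/IHj/le_trans]; apply.
by have /andP[] := ord j.
Qed.

(** The ordering of the arrivals makes the jobs present at [u] an initial segment of the numbering,
    which starts at 0, hence [k.+1]. This duality turns events on arrival times into events on
    counts. *)
Lemma ae_arrival_le : {ae Pr, forall w, forall k (u : R), (0 <= u)%R ->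
  (arrival J k w <= u)%R <-> k.+1%:R%:E <= arrivals_in J 0 u w}.
Proof.
apply: filterS (arrivals_ordered pJ) => w ord k u u0.
have term_ge0 i : 0 <= (\1_(`]0%R, u]) (arrival J i w))%:E :> \bar R.
  by rewrite lee_fin.
have pos i : (0 < arrival J i w)%R by have /andP[] := ord i.
rewrite /arrivals_in; split => [ku|]; last first.
  apply: contraPP => /negP; rewrite -ltNge => uk; apply/negP; rewrite -ltNge.
  rewrite (@nneseries_split _ _ 0 k)//= add0n [X in _ + X]eseries0 ?adde0; last first.
    move=> i ki _; rewrite indicE mem_setE in_itv/= pos/=.
    by rewrite leNgt (lt_le_trans uk)// ordered_arrivals_le.
  apply: (@le_lt_trans _ _ (\sum_(0 <= i < k) 1)).
    by apply: lee_sum => i _; rewrite lee_fin indicE lern1 leq_b1.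
  by rewrite sumEFin lte_fin sumr_const_nat subn0 ltr_nat.
apply: (@le_trans _ _ (\sum_(0 <= i < k.+1) (\1_(`]0%R, u]) (arrival J i w))%:E)); last first.
  exact: nneseries_lim_ge.
rewrite sumEFin lee_fin [X in (_ <= X)%R](_ : _ = \sum_(0 <= i < k.+1) 1)%R.
  by rewrite sumr_const_nat subn0.
apply: eq_big_nat => i /andP[_ ik]; rewrite indicE mem_setE in_itv/= pos/=.
by rewrite (le_trans _ ku)// ordered_arrivals_le.
Qed.

(** If []0, m.+1]] holds [n] arrivals, job [n] comes after [m.+1]. Countably many integer horizons
    decide all real [t], so one null set serves every [t]. *)
Lemma ae_arrivals_unbounded : {ae Pr, forall w, forall t : R,
  exists K, forall k, (K <= k)%N -> (t < arrival J k w)%R}.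
Proof.
have N_nat : {ae Pr, forall w, forall m : nat, exists n : nat,
    arrivals_in J 0 m.+1%:R w = n%:R%:E}.
  by apply: ae_foralln => m; exact: (ae_arrivals_in_nat L0 pJ).
apply: filterS3 (arrivals_ordered pJ) ae_arrival_le N_nat => w ord le_N N_nat t.
pose m := Num.bound `|t|%R.
have tm : (t < m.+1%:R)%R.
  rewrite (le_lt_trans (ler_norm t))// (lt_le_trans (archi_boundP _))//.
  by rewrite ler_nat.
have [n Nn] := N_nat m; exists n => k nk.
rewrite (lt_le_trans tm)// leNgt; apply/negP => /ltW /le_N; rewrite ler0n => /(_ isT).
by rewrite Nn lee_fin ler_nat ltnNge nk.
Qed.

(** The value [+oo] of [u k] leaves job [k] free. Each other threshold is, by [ae_arrival_le], a
    condition on the counts up to a grid point, which reduces the claim to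
    [poisson_past_uncorrelated]. *)
Lemma arrivals_past_uncorrelated (u : nat -> \bar R) (n : nat) (t t' : R) :
  (0 < t)%R -> (t < t')%R ->
  (forall k, u k <= t%:E \/ u k = +oo) -> (forall k, (n <= k)%N -> u k = +oo) ->
  let E := [set w | forall k, (arrival J k w)%:E <= u k] in
  \int[Pr]_(w in E) arrivals_in J t t' w = Pr E * \int[Pr]_w arrivals_in J t t' w.
Proof.
move=> t0 tt' ut un E.
(* Clipping at 0 covers negative thresholds and [-oo]: a positive arrival time is below neither of
   them, and not below 0 either. *)
pose c k := Num.max 0%R (fine (u k)).
have c_t k : u k != +oo -> (0 <= c k <= t)%R.
  move=> uk; rewrite /c le_max lexx/= ge_max (ltW t0)/=.
  have [|utk] := ut k; last by rewrite utk eqxx in uk.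
  by case: (u k) uk => [r||]//= _ _; exact: ltW.
have [] := @increasing_grid R [seq c k | k <- iota 0 n & u k != +oo] t t' t0 tt'.
  by move=> x /mapP[k + ->]; rewrite mem_filter => /andP[uk _]; exact: c_t.
move=> v [m [v0 v_inc vm vm1 us_v]].
have /choice[j jP] k : exists j, u k != +oo -> (j <= m)%N /\ v j = c k.
  have [_|uk] := eqVneq (u k) +oo; first by exists 0%N.
  have [|j jm vj] := us_v (c k); last by exists j.
  apply: map_f; rewrite mem_filter uk mem_iota add0n /=.
  by rewrite ltnNge; apply/negP => /un; exact/eqP.
pose C (x : nat -> \bar R) := forall k, u k != +oo -> (k.+1%:R%:E <= \sum_(i < j k) x i)%E.
have mE : measurable E.
  rewrite (_ : E = \bigcap_k (EFin \o arrival J k) @^-1` [set x | x <= u k]).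
    apply: bigcapT_measurable => k; rewrite -[X in measurable X]setTI.
    apply: emeasurable_fun_infty_c => //.
    exact/measurable_EFinP.
  by apply/seteqP; split => w Ew k; [move=> _; exact: Ew|exact: (Ew k I)].
rewrite -vm -vm1; apply: (poisson_past_uncorrelated L0 pJ (C := C)) => //.
- by rewrite v0.
- move=> x y xy Cx k uk; rewrite (le_trans (Cx k uk))//.
  rewrite le_eqVlt; apply/orP; left; apply/eqP; apply: eq_bigr => i _.
  by apply: xy; rewrite (leq_trans (ltn_ord i))//; have [] := jP _ uk.
apply: filterS2 (arrivals_ordered pJ) ae_arrival_le => w ord le_N.
have uE k : u k != +oo -> ((arrival J k w)%:E <= u k) = (arrival J k w <= c k)%R.
  move=> uk; have /andP[a0 _] := ord k.
  rewrite /c le_max [X in _ = X || _]leNgt a0/=.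
  case: (u k) uk => [r||]//= _.
  by rewrite leeNy_eq leNgt a0.
have NE k : arrivals_in J 0 (v k) w = \sum_(i < k) arrivals_in J (v i) (v i.+1) w.
  under eq_bigr do rewrite arrivals_in_compound.
  by rewrite arrivals_in_compound -compound_chain ?v0// => i; exact: ltW.
split=> [Ew k uk|Cw k].
  rewrite -NE; have [_ ->] := jP _ uk; apply/le_N; last by rewrite -uE.
  by have /andP[] := c_t _ uk.
have [->|uk] := eqVneq (u k) +oo; first by rewrite leey.
rewrite uE//; apply/le_N; first by have /andP[] := c_t _ uk.
by have [_ <-] := jP _ uk; rewrite NE; exact: Cw.
Qed.

End ArrivalTimes.

(** * Marks, past events and later compound sums *)

Section MarkedArrivals.
Context d (Omega : measurableType d) (R : realType) (Pr : probability Omega R).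
Context (J : jobs Pr) (Lambda : R) (f : R * R -> R) (L0 : 0 < Lambda).
Hypothesis mJ : marked_poisson J Lambda f.
Let pJ : poisson_arrivals J Lambda := marked_arrivals mJ.
Local Open Scope ereal_scope.

Implicit Types phi psi : R * R -> R.

Definition mark_integral (phi : R * R -> R) : \bar R :=
  \int[Pr]_w (phi (mark J 0 w))%:E.

Lemma mark_same_law k (B : set (R * R)) : measurable B ->
  Pr (mark J k @^-1` B) = Pr (mark J 0 @^-1` B).
Proof. by move=> mB; rewrite !(marked_law mJ). Qed.

Lemma measurable_mark_preimage k (B : set (R * R)) : measurable B ->
  measurable (mark J k @^-1` B).
Proof. by move=> mB; rewrite -[X in measurable X]setTI; exact: measurable_mark. Qed.

Lemma mark_integralE k phi : measurable_fun setT phi -> (forall z, (0 <= phi z)%R) ->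
  \int[Pr]_w (phi (mark J k w))%:E = mark_integral phi.
Proof.
move=> mphi phi0; pose g z := (phi z)%:E.
have mg : measurable_fun setT g by exact/measurable_EFinP.
have g0 z : 0 <= g z by rewrite lee_fin.
rewrite -[LHS](@ge0_integral_distribution _ _ _ _ _ Pr (mark J k) g)//.
rewrite -[RHS](@ge0_integral_distribution _ _ _ _ _ Pr (mark J 0) g)//.
by apply: eq_measure_integral => B mB _; exact: mark_same_law.
Qed.

Lemma mark_integral1 : mark_integral (cst 1%R) = 1.
Proof.
rewrite /mark_integral [LHS](_ : _ = \int[Pr]_w cst 1 w)//.
by rewrite integral_cst// mul1e; exact: probability_setT.
Qed.

Lemma mark_integral_ge0 phi : (forall z, (0 <= phi z)%R) -> 0 <= mark_integral phi.
Proof. by move=> phi0; apply: integral_ge0 => w _; rewrite lee_fin. Qed.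

Lemma integral_mark_indep k phi (E : set Omega) :
  measurable_fun setT phi -> (forall z, (0 <= phi z)%R) -> measurable E ->
  (forall B, measurable B ->
    Pr (E `&` mark J k @^-1` B) = Pr E * Pr (mark J k @^-1` B)) ->
  \int[Pr]_(w in E) (phi (mark J k w))%:E = Pr E * mark_integral phi.
Proof.
move=> mphi phi0 mE EB.
have int_E : \int[Pr]_w (\1_E w)%:E = Pr E by rewrite integral_indic// setIT.
rewrite integral_mkcond.
transitivity (\int[Pr]_w ((EFin \o phi) (mark J k w) * (\1_E w)%:E)).
  by apply: eq_integral => w _; rewrite epatch_indic.
rewrite uncorrelatedM//.
- by rewrite muleC; congr (_ * _); [exact: int_E|exact: mark_integralE].
- by apply/measurable_EFinP; exact: measurable_indic.
- by rewrite [X in X < _]int_E ltey_eq fin_num_measure.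
- move=> B mB; have mkB := measurable_mark_preimage k mB.
  rewrite [X in _ * X]int_E muleC -EB//; exact: integral_indic.
- exact/measurable_EFinP.
Qed.

Definition arrival_type : measurableType _ := g_sigma_algebraType
  [set E | exists k (B : set R), measurable B /\ E = arrival J k @^-1` B].

Definition arrival_event (s t : R) k : set Omega :=
  arrival J k @^-1` `]s, t].

Lemma arrival_event_field s t k : job_field J None (arrival_event s t k).
Proof. by apply: sub_sigma_algebra; exists k, `]s, t]%classic. Qed.

Lemma measurable_arrival_event s t k : measurable (arrival_event s t k).
Proof. by rewrite -[X in measurable X]setTI; exact: measurable_funPT. Qed.

Lemma sub_arrival_field : job_field J None `<=` measurable.
Proof.
apply: smallest_sub; first exact: sigma_algebra_measurable.
by move=> _ [k [B [mB ->]]]; rewrite -[X in measurable X]setTI; exact: measurable_funPT.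
Qed.

Lemma arrivals_marks_indep (A : set Omega) (B : nat -> set (R * R)) n :
  job_field J None A -> (forall k, measurable (B k)) ->
  Pr (A `&` \big[setI/setT]_(i < n) (mark J i @^-1` B i)) =
  Pr A * \prod_(i < n) Pr (mark J i @^-1` B i).
Proof.
move=> fA mB.
have := marked_independent mJ (s := None :: [seq Some k | k <- iota 0 n])
  (E := fun i => if i is Some k then mark J k @^-1` B k else A).
rewrite !big_cons !big_map -[X in iota 0 X](subn0 n) -/(index_iota 0 n).
rewrite !big_mkord; apply.
  rewrite /= map_inj_uniq ?iota_uniq ?andbT; last by move=> i j [].
  by apply/mapP => -[].
move=> [k|]; last by [].
by move=> _ /=; exists (B k).
Qed.

Definition history_rect (u : nat -> \bar R) (B : nat -> set (R * R)) : set Omega :=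
  [set w | forall k, (arrival J k w)%:E <= u k /\ B k (mark J k w)].

(* A bound [u k = +oo] with [B k = setT] leaves job [k] unconstrained. *)
Definition history_rects (t : R) : set (set Omega) :=
  [set H | exists u B n, [/\ forall k, measurable (B k),
    forall k, u k <= t%:E \/ (u k = +oo /\ B k = setT),
    forall k, (n <= k)%N -> u k = +oo /\ B k = setT & H = history_rect u B]].

Lemma past_arrivals_field (u : nat -> \bar R) :
  job_field J None [set w | forall k, (arrival J k w)%:E <= u k].
Proof.
rewrite (_ : [set _ | _] = \bigcap_k (arrival J k @^-1` [set x : R | x%:E <= u k])).
  apply: (@bigcapT_measurable _ arrival_type) => k; apply: sub_sigma_algebra.
  exists k, [set x : R | x%:E <= u k]; split=> //.
  have := @EFin_measurable R setT measurableT _ (emeasurable_itv `]-oo, u k]).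
  by rewrite setTI; congr measurable; apply/seteqP; split => x /=; rewrite in_itv.
by apply/seteqP; split => w Ew k; [move=> _; exact: Ew|exact: (Ew k I)].
Qed.

Lemma history_rectE u B n : (forall k, (n <= k)%N -> B k = setT) ->
  history_rect u B = [set w | forall k, (arrival J k w)%:E <= u k] `&`
    \big[setI/setT]_(i < n) (mark J i @^-1` B i).
Proof.
move=> Bn; rewrite -(bigcap_mkord _ (fun i => mark J i @^-1` B i)).
apply/seteqP; split => w /=.
  by move=> Hw; split => [k|k _]; have [] := Hw k.
move=> [Aw Mw] k; split; first exact: Aw.
by have [kn|/Bn->//] := ltnP k n; exact: Mw.
Qed.

Lemma measurable_history_rect t : history_rects t `<=` measurable.
Proof.
move=> _ [u [B [n [mB ut un ->]]]].
rewrite (@history_rectE _ _ n); last by move=> k /un[].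
apply: measurableI; first by apply: sub_arrival_field; exact: past_arrivals_field.
by apply: bigsetI_measurable => i _; exact: measurable_mark_preimage.
Qed.

Lemma history_rectsT t : history_rects t setT.
Proof.
exists (fun=> +oo), (fun=> setT), 0%N; split=> //.
- by right.
- by apply/seteqP; split => w //= _ k; rewrite leey.
Qed.

Lemma history_rectsI t : setI_closed (history_rects t).
Proof.
move=> _ _ [u1 [B1 [n1 [mB1 ut1 un1 ->]]]] [u2 [B2 [n2 [mB2 ut2 un2 ->]]]].
exists (fun k => Order.min (u1 k) (u2 k)), (fun k => B1 k `&` B2 k), (maxn n1 n2).
split.
- by move=> k; exact: measurableI.
- move=> k; rewrite ge_min.
  have [->|[-> ->]] := ut1 k; first by left.
  have [->|[-> ->]] := ut2 k; first by rewrite orbT; left.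
  by right; rewrite setIT minxx.
- move=> k; rewrite geq_max => /andP[/un1[-> ->] /un2[-> ->]].
  by rewrite minxx setIT.
- apply/seteqP; split => w /=.
    by move=> [H1 H2] k; rewrite le_min; have [-> ?] := H1 k; have [-> ?] := H2 k.
  by move=> H; split=> k; have [] := H k; rewrite le_min => /andP[? ?] [].
Qed.

(** On the event that job [k] has arrived by [t], its arrival time and its mark are measurable for
    the sigma-algebra generated by the rectangles; hence so is the pair, and the generators of
    [history] are preimages under such pairs. *)
Lemma sub_history_rects t : history J t `<=` <<s history_rects t >>.
Proof.
pose GT : measurableType _ := g_sigma_algebraType (history_rects t).
apply: smallest_sub; first exact: smallest_sigma_algebra.
move=> _ [k [B [mB ->]]].
pose D := [set w | (arrival J k w <= t)%R].
have rectk (v : R) (C : set (R * R)) : (v <= t)%R -> measurable C ->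
    <<s history_rects t >> [set w | (arrival J k w <= v)%R /\ C (mark J k w)].
  move=> vt mC; apply: sub_sigma_algebra.
  exists (fun i => if i == k then v%:E else +oo), (fun i => if i == k then C else setT).
  exists k.+1; split.
  - by move=> i; case: ifP.
  - by move=> i; case: ifP; [left; rewrite lee_fin|right].
  - by move=> i ki; rewrite gtn_eqF.
  - apply/seteqP; split=> w /=.
      by move=> [av Cw] i; case: eqP => [->|_]; rewrite ?lee_fin ?leey.
    by move=> /(_ k); rewrite eqxx lee_fin.
have mD : measurable (D : set GT).
  have := rectk t setT (lexx t) measurableT.
  by congr (<<s _ >> _); apply/seteqP; split => w //=; case.
have mark_D : measurable_fun (D : set GT) (mark J k : GT -> R * R).
  by move=> _ C mC; exact: rectk.
have arr_D : measurable_fun (D : set GT) (arrival J k : GT -> R).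
  apply: (measurability _ (RGenOInfty.measurableE R)) => _ [_ [v ->] <-].
  (* For [v] above [t], no arrival in [D] exceeds [v], and cutting at [t] yields the same empty
     set. *)
  have vt : (Num.min v t <= t)%R by rewrite ge_min lexx orbT.
  have := @measurableD _ GT _ _ mD (rectk _ setT vt measurableT).
  congr (<<s _ >> _); apply/seteqP; split => w; rewrite /D /= in_itv/= andbT le_min.
    move=> [aw naw]; split => //; rewrite ltNge; apply/negP => av.
    by apply: naw; rewrite av aw.
  by move=> [aw va]; split => //= -[/andP[av _] _]; rewrite ltNge av in va.
have pair_D : measurable_fun (D : set GT)
    (fun w : GT => (arrival J k w, mark J k w) : R * (R * R)).
  apply: (measurability _ (measurable_prod_measurableType _ _)).
  move=> _ [_ [C1 mC1 [C2 mC2 <-]] <-].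
  have := @measurableI _ GT _ _ (arr_D mD _ mC1) (mark_D mD _ mC2).
  congr (<<s _ >> _); apply/seteqP; split => w /=.
    by move=> [[Dw C1w] [_ C2w]]; split.
  by move=> [Dw [C1w C2w]]; split.
exact: pair_D mD _ mB.
Qed.

(** Three decouplings. A job arriving after [t] is not constrained by [H], so its mark is
    independent of [H] and of its arrival event, and the sum over jobs reduces to the count times
    [mark_integral phi]. The marks in [H] are then split off the arrival times. What remains is an
    event on past arrivals, treated by [arrivals_past_uncorrelated]. *)
Lemma history_rect_uncorrelated phi (H : set Omega) (t t' : R) :
  (0 < t)%R -> (t < t')%R -> measurable_fun setT phi -> (forall z, (0 <= phi z)%R) ->
  mark_integral phi < +oo -> history_rects t H ->
  \int[Pr]_(w in H) compound J phi t t' w =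
  Pr H * ((Lambda * (t' - t))%:E * mark_integral phi).
Proof.
move=> t0 tt' mphi phi0 phioo HH; have mH := measurable_history_rect HH.
have [u [B [n [mB ut un HE]]]] := HH.
pose I := arrival_event t t'.
have mI k : measurable (I k) by exact: measurable_arrival_event.
pose A := [set w | forall k, (arrival J k w)%:E <= u k].
have fA : job_field J None A by exact: past_arrivals_field.
have fAI k : job_field J None (A `&` I k).
  apply: (@measurableI _ arrival_type) => //; exact: arrival_event_field.
have HI_indep k C : measurable C ->
    Pr (H `&` I k `&` mark J k @^-1` C) = Pr (H `&` I k) * Pr (mark J k @^-1` C).
  (* If [H] constrains job [k], that job has arrived by [t] and [H] does not meet [I k]; otherwise
     the slot of mark [k] in the rectangle is free and can be filled with [C]. *)
  move=> mC; have [ukt|[uk Bk]] := ut k.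
    have -> : H `&` I k = set0.
      rewrite HE -subset0 => w [/(_ k)[+ _]]; rewrite /I /arrival_event/= in_itv/=.
      move=> /le_trans/(_ ukt); rewrite lee_fin => akt /andP[+ _].
      by rewrite ltNge akt.
    by rewrite set0I measure0 mul0e.
  pose N := maxn n k.+1.
  have kN : (k < N)%N by rewrite /N leq_max ltnSn orbT.
  have BN i : (N <= i)%N -> B i = setT by rewrite geq_max => /andP[/un[]].
  pose B' i := if i == k then C else B i.
  rewrite HE (history_rectE u BN) -/A (setIAC A).
  transitivity (Pr ((A `&` I k) `&` \big[setI/setT]_(i < N) (mark J i @^-1` B' i))).
    congr (Pr _); rewrite -(setIA (A `&` I k)); congr ((A `&` I k) `&` _).
    rewrite -!(bigcap_mkord _ (fun i => mark J i @^-1` _ i)).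
    apply/seteqP; split => w /=.
      by move=> [Mw Cw] i iN; rewrite /B' /=; case: eqP => [->//|_]; exact: Mw.
    move=> Mw; split => [i iN|]; last by have := Mw _ kN; rewrite /= /B' eqxx.
    by have := Mw _ iN; rewrite /= /B'; case: eqP => [->|//]; rewrite Bk.
  rewrite !arrivals_marks_indep//; last by move=> i; rewrite /B'; case: ifP.
  rewrite -muleA; congr (_ * _).
  rewrite (bigD1 (Ordinal kN))//= [in RHS](bigD1 (Ordinal kN))//= Bk preimage_setT.
  rewrite [Pr setT]probability_setT mul1e muleC; congr (_ * _).
    apply: eq_bigr => i ik; congr (Pr (_ @^-1` _)).
    by rewrite /B'; case: eqP => // iEk; move: ik; rewrite -val_eqE/= iEk eqxx.
  by rewrite /B' eqxx.
have int_term psi k : measurable_fun setT psi -> (forall z, (0 <= psi z)%R) ->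
    \int[Pr]_(w in H) (psi (mark J k w) * \1_(`]t, t']) (arrival J k w))%:E =
    Pr (H `&` I k) * mark_integral psi.
  move=> mpsi psi0; rewrite -(@integral_mark_indep k)//; last 2 first.
  - exact: measurableI.
  - by move=> C mC; exact: HI_indep.
  rewrite integral_mkcondr; apply: eq_integral => w _.
  by rewrite epatch_indic -EFinM.
have int_N : \int[Pr]_(w in H) arrivals_in J t t' w = \sum_(k <oo) Pr (H `&` I k).
  rewrite arrivals_in_compound integral_nneseries//; last first.
  - by move=> k w _; exact: compound_term_ge0.
  - by move=> k; apply: measurable_funTS; exact: measurable_compound_term.
  apply: eq_eseriesr => k _; rewrite int_term//.
  by rewrite mark_integral1 mule1.
transitivity (\int[Pr]_(w in H) arrivals_in J t t' w * mark_integral phi).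
  rewrite int_N integral_nneseries//; last 2 first.
  - by move=> k; apply: measurable_funTS; exact: measurable_compound_term.
  - by move=> k w _; exact: compound_term_ge0.
  have phi_fin : mark_integral phi \is a fin_num.
    by rewrite ge0_fin_numE ?mark_integral_ge0.
  rewrite muleC -(fineK phi_fin) -nneseriesZl//.
  by apply: eq_eseriesr => k _; rewrite int_term// fineK// muleC.
rewrite muleA; congr (_ * _).
rewrite int_N.
have Bn i : (n <= i)%N -> B i = setT by move=> /un[].
(* [q], the probability of the constraints on the marks, is a factor of both sides. *)
pose q := \prod_(i < n) Pr (mark J i @^-1` B i).
have q_fin : q \is a fin_num.
  rewrite /q; elim/big_ind : _ => //; first exact: fin_numM.
  by move=> i _; apply: fin_num_measure; exact: measurable_mark_preimage.
have PH A' : job_field J None A' ->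
    Pr (A' `&` \big[setI/setT]_(i < n) (mark J i @^-1` B i)) = Pr A' * q.
  by move=> fA'; rewrite arrivals_marks_indep.
have -> : Pr H = Pr A * q by rewrite HE (history_rectE u Bn) PH.
transitivity (\int[Pr]_(w in A) arrivals_in J t t' w * q).
  rewrite arrivals_in_compound integral_nneseries//; last 2 first.
  - by move=> k; apply: measurable_funTS; exact: measurable_compound_term.
  - by move=> k w _; exact: compound_term_ge0.
  rewrite muleC -(fineK q_fin) -nneseriesZl; last first.
    by move=> k _; apply: integral_ge0 => w _; exact: compound_term_ge0.
  apply: eq_eseriesr => k _; rewrite fineK//.
  rewrite HE (history_rectE u Bn) -/A (setIAC A) PH// muleC; congr (_ * _).
  rewrite -(setIC (I k)) -integral_indic//; last by apply: sub_arrival_field.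
  by apply: eq_integral => w _; rewrite mul1r.
  by apply: sub_arrival_field.
have -> : \int[Pr]_(w in A) arrivals_in J t t' w =
    Pr A * \int[Pr]_w arrivals_in J t t' w.
  apply: (arrivals_past_uncorrelated L0 pJ (n := n)) => //.
    by move=> k; have [|[]] := ut k; [left|right].
  by move=> k /un[].
by rewrite (arrivals_in_mean L0 pJ) ?ltW// muleAC.
Qed.

Lemma compound_mean phi (t t' : R) : (0 < t)%R -> (t < t')%R ->
  measurable_fun setT phi -> (forall z, (0 <= phi z)%R) -> mark_integral phi < +oo ->
  \int[Pr]_w compound J phi t t' w = (Lambda * (t' - t))%:E * mark_integral phi.
Proof.
move=> t0 tt' mphi phi0 phioo.
rewrite (history_rect_uncorrelated t0 tt' mphi phi0 phioo (history_rectsT t)).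
by rewrite [Pr setT]probability_setT mul1e.
Qed.

(** The product formula passes from the rectangles, a pi-system whose sigma-algebra contains
    [history J t], to every past event. This is the form in which nonanticipation is used. *)
Lemma history_uncorrelated phi (H : set Omega) (t t' : R) :
  (0 < t)%R -> (t < t')%R -> measurable_fun setT phi -> (forall z, (0 <= phi z)%R) ->
  mark_integral phi < +oo -> history J t H ->
  \int[Pr]_(w in H) compound J phi t t' w =
  Pr H * \int[Pr]_w compound J phi t t' w.
Proof.
move=> t0 tt' mphi phi0 phioo /sub_history_rects HH.
apply: (sigma_uncorrelated (@measurable_history_rect t) (@history_rectsI t)
  (history_rectsT t)) => //.
- exact: measurable_compound.
- by move=> w; exact: compound_ge0.
- rewrite compound_mean// lte_mul_pinfty//.
  by rewrite lee_fin mulr_ge0 ?ltW// subr_gt0.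
- move=> G GG; rewrite compound_mean//; exact: history_rect_uncorrelated.
Qed.

(** Each term of the sum is a function [g] of arrival time and mark that vanishes when the job
    arrives after [t]. *)
Lemma history_compound psi (s s' t : R) (B : set \bar R) :
  measurable_fun setT psi -> (forall z, (0 <= psi z)%R) -> (s' <= t)%R ->
  measurable B -> history J t (compound J psi s s' @^-1` B).
Proof.
move=> mpsi psi0 s't mB.
pose HT : measurableType _ := g_sigma_algebraType
  [set E | exists k (B : set (R * (R * R))), measurable B /\
    E = [set w | (arrival J k w <= t)%R /\ B (arrival J k w, mark J k w)]].
suff mc : measurable_fun (setT : set HT) (compound J psi s s' : HT -> \bar R).
  by rewrite -[X in history _ _ X]setTI; exact: mc.
apply: ge0_emeasurable_sum => [k w _ _|k _ _ C mC].
  exact: compound_term_ge0.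
pose g (z : R * (R * R)) := (psi z.2 * \1_(`]s, s']) z.1)%:E.
have mg : measurable_fun setT g.
  apply/measurable_EFinP/measurable_funM; first exact: measurableT_comp.
  by apply: measurableT_comp => //; exact: measurable_indic.
have mgC D : measurable D -> measurable (g @^-1` D).
  by move=> mD; rewrite -[X in measurable X]setTI; exact: mg.
have g0 w : (t < arrival J k w)%R -> g (arrival J k w, mark J k w) = 0.
  move=> tw; rewrite /g/= indicE mem_setE in_itv/= [X in _ && X]leNgt.
  by rewrite (le_lt_trans s't tw) andbF mulr0.
pose E D := [set w | (arrival J k w <= t)%R /\ (g @^-1` D) (arrival J k w, mark J k w)].
have mE D : measurable D -> measurable (E D : set HT).
  by move=> mD; apply: sub_sigma_algebra; exists k, (g @^-1` D); split => //; exact: mgC.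
(* Generators of [history] require arrival by [t]. If [C] contains 0, later jobs all lie in the
   preimage, and the complement of [C] is treated instead. *)
rewrite setTI; have [C0|nC0] := pselect (C 0).
  have := @measurableC _ HT _ (mE _ (measurableC mC)).
  congr (<<s _ >> _); apply/seteqP; split => w; rewrite /E /preimage /=.
    move=> nw; apply: contrapT => Cw; apply: nw.
    split; last exact: Cw.
    by rewrite leNgt; apply/negP => /g0 gw; apply: Cw; rewrite [X in C X]gw.
  by move=> Cw [_]; apply.
have := mE _ mC; congr (<<s _ >> _); apply/seteqP; split => w; rewrite /E /preimage /=.
  by move=> [].
move=> Cw; split; last exact: Cw.
by rewrite leNgt; apply/negP => /g0 gw; apply: nC0; rewrite -gw.
Qed.

Lemma compound_uncorrelated psi phi (s s' t t' : R) :
  (0 < t)%R -> (t < t')%R -> (s' <= t)%R ->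
  measurable_fun setT psi -> (forall z, (0 <= psi z)%R) ->
  measurable_fun setT phi -> (forall z, (0 <= phi z)%R) -> mark_integral phi < +oo ->
  \int[Pr]_w (compound J psi s s' w * compound J phi t t' w) =
  \int[Pr]_w compound J psi s s' w * \int[Pr]_w compound J phi t t' w.
Proof.
move=> t0 tt' s't mpsi psi0 mphi phi0 phioo.
have mX : measurable_fun setT (compound J psi s s') by exact: measurable_compound.
have mY : measurable_fun setT (compound J phi t t') by exact: measurable_compound.
have Yoo : \int[Pr]_w compound J phi t t' w < +oo.
  rewrite compound_mean// lte_mul_pinfty//.
  by rewrite lee_fin mulr_ge0 ?ltW// subr_gt0.
(* [uncorrelatedM] wants a function nonnegative on all of [\bar R]; the absolute value is the
   identity on the values taken. *)
pose g (x : \bar R) := `|x|.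
transitivity (\int[Pr]_w (g (compound J psi s s' w) * compound J phi t t' w)).
  by apply: eq_integral => w _; rewrite /g gee0_abs// compound_ge0.
rewrite (uncorrelatedM mX mY)//.
- congr (_ * _); apply: eq_integral => w _.
  by rewrite /g gee0_abs// compound_ge0.
- by move=> w; exact: compound_ge0.
- move=> B mB; apply: history_uncorrelated => //; exact: history_compound.
- exact: measurableT_comp.
- by move=> x; exact: abse_ge0.
Qed.

End MarkedArrivals.

(** * Second moments of sums over cells *)

Section UncorrelatedSums.
Context d (T : measurableType d) (R : realType) (mu : {measure set T -> \bar R}).
Local Open Scope ereal_scope.

(** The cross terms [2 e_i e_j] are those of the square of the total mean; the diagonal terms
    [e_j ^ 2] of that square are given away. *)
Lemma second_moment_sum_le (Z : nat -> T -> \bar R) (e a : nat -> R) m :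
  (forall j, measurable_fun setT (Z j)) -> (forall j x, 0 <= Z j x) ->
  (forall j, (j < m)%N -> \int[mu]_x Z j x = (e j)%:E) ->
  (forall i j, (i < j < m)%N -> \int[mu]_x (Z i x * Z j x) = (e i * e j)%:E) ->
  (forall j, (j < m)%N -> \int[mu]_x (Z j x * Z j x) <= (a j)%:E) ->
  \int[mu]_x ((\sum_(j < m) Z j x) * (\sum_(j < m) Z j x)) <=
  (\sum_(j < m) a j + (\sum_(j < m) e j) ^+ 2)%:E.
Proof.
move=> mZ Z0; elim: m => [|m IHm] Ze Zc Za.
  rewrite !big_ord0 expr0n addr0 integral0_eq// => x _.
  by rewrite !big_ord0 mul0e.
pose S x := \sum_(j < m) Z j x.
have mS : measurable_fun setT S by exact: emeasurable_sum.
have S0 x : 0 <= S x by exact: sume_ge0.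
have mM (X Y : T -> \bar R) : measurable_fun setT X -> measurable_fun setT Y ->
  measurable_fun setT (fun x => X x * Y x) by exact: emeasurable_funM.
rewrite [X in X <= _](_ : _ =
    \int[mu]_x (S x * S x + S x * Z m x + (S x * Z m x + Z m x * Z m x))); last first.
  apply: eq_integral => x _.
  rewrite big_ord_recr/= -/(S x) ge0_muleDl// !ge0_muleDr//.
  by rewrite [in Z m x * S x]muleC.
have SZ : \int[mu]_x (S x * Z m x) = ((\sum_(j < m) e j) * e m)%:E.
  under eq_integral do rewrite /S ge0_sume_distrl//.
  rewrite ge0_integral_sum//; last 2 first.
  - by move=> j; exact: mM.
  - by move=> j x _; exact: mule_ge0.
  rewrite mulr_suml -sumEFin; apply: eq_bigr => j _.
  by rewrite Zc// ltn_ord ltnSn.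
rewrite ge0_integralD//; last 4 first.
- by move=> x _; rewrite adde_ge0 ?mule_ge0.
- by apply: emeasurable_funD; exact: mM.
- by move=> x _; rewrite adde_ge0 ?mule_ge0.
- by apply: emeasurable_funD; exact: mM.
rewrite !ge0_integralD//; do ?[exact: mM | by move=> x _; exact: mule_ge0].
rewrite SZ !big_ord_recr/=.
have -> : (\sum_(j < m) a j + a m + (\sum_(j < m) e j + e m) ^+ 2)%R =
  (\sum_(j < m) a j + (\sum_(j < m) e j) ^+ 2 + (\sum_(j < m) e j) * e m +
   ((\sum_(j < m) e j) * e m + (a m + e m ^+ 2)))%R by ring.
rewrite 3!EFinD; apply: leeD; first apply: leeD => //.
  apply: IHm => [j jm|i j /andP[ij jm]|j jm].
  - by apply: Ze; exact: ltnW.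
  - by apply: Zc; rewrite ij ltnW.
  - by apply: Za; exact: ltnW.
by rewrite EFinD leeD// (le_trans (Za _ _))// lee_fin lerDl sqr_ge0.
Qed.

End UncorrelatedSums.

Section GridCount.
Context (R : realType) (h : R) (h0 : 0 <= h).

Lemma grid_count_le (tau : R) n : 0 <= tau ->
  h * \sum_(i < n) (i%:R * h < tau)%R%:R <= tau + h.
Proof.
(* The bound by [n h] is carried along: when the point [n h] lies below [tau], it gives
   [n h + h <= tau + h]. *)
move=> tau0; suff /andP[] : (h * \sum_(i < n) (i%:R * h < tau)%R%:R <= n%:R * h) &&
  (h * \sum_(i < n) (i%:R * h < tau)%R%:R <= tau + h) by [].
elim: n => [|n /andP[IH1 IH2]].
  by rewrite big_ord0 mulr0 mul0r lexx addr_ge0.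
rewrite big_ord_recr/= mulrDr -natr1 mulrDl mul1r.
case: (ltP (n%:R * h) tau) => nt; rewrite ?mulr1 ?mulr0 ?addr0.
  by rewrite lerD2r IH1/= lerD2r (le_trans IH1)// ltW.
by rewrite IH2 andbT (le_trans IH1)// lerDl.
Qed.

Lemma grid_count_ge (tau : R) n : tau <= n%:R * h ->
  tau <= h * \sum_(i < n) (i.+1%:R * h < tau)%R%:R + h.
Proof.
move=> taun.
have : tau <= h * \sum_(i < n) (i.+1%:R * h < tau)%R%:R + h \/
  h * \sum_(i < n) (i.+1%:R * h < tau)%R%:R = n%:R * h.
  elim: n {taun} => [|n IH]; first by right; rewrite big_ord0 mulr0 mul0r.
  rewrite big_ord_recr/= mulrDr -!natr1 mulrDl mul1r.
  case: IH => [IH|->].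
    by left; rewrite (le_trans IH)// lerD2r lerDl mulr_ge0.
  case: (ltP (n%:R * h + h) tau) => nt; rewrite ?mulr1 ?mulr0 ?addr0; first by right.
  by left.
by case=> [//|->]; rewrite (le_trans taun)// lerDl.
Qed.

End GridCount.

Lemma sum_indic_chain (R : realType) (v : nat -> R) n x : (forall i, v i <= v i.+1) ->
  \sum_(i < n) \1_(`]v i, v i.+1]) x = \1_(`]v 0%N, v n]) x :> R.
Proof.
move=> v_nd; have v_ge i : v 0%N <= v i by elim: i => // i /le_trans; exact.
elim: n => [|n IHn].
  by rewrite big_ord0 indicE mem_setE in_itv/= ltNge andNb.
rewrite big_ord_recr/= IHn !indicE !mem_setE !in_itv/=.
case: (leP x (v n)) => [xn|nx] /=.
  by rewrite andbT addr0 (le_trans xn)// andbT.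
by rewrite andbF add0r (le_lt_trans (v_ge n)).
Qed.

(** Off the diagonal, [h i * h j <= C ^ 2]. This compares the excess of a squared sum over its
    diagonal part with the same excess for the counts, where [b i ^ 2 = b i]. It is written without
    subtraction so that both sides integrate as nonnegative extended reals. *)
Lemma sqr_weighted_count_le (R : realType) (h b : nat -> R) (C : R) n :
  (forall i, 0 <= h i <= C) -> (forall i, b i = 0 \/ b i = 1) ->
  (\sum_(i < n) h i * b i) ^+ 2 + C ^+ 2 * (\sum_(i < n) b i) <=
  \sum_(i < n) h i ^+ 2 * b i + C ^+ 2 * (\sum_(i < n) b i) ^+ 2.
Proof.
move=> hC b01.
suff : [/\ 0 <= \sum_(i < n) h i * b i, \sum_(i < n) h i * b i <= C * \sum_(i < n) b i &
  (\sum_(i < n) h i * b i) ^+ 2 + C ^+ 2 * (\sum_(i < n) b i) <=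
  \sum_(i < n) h i ^+ 2 * b i + C ^+ 2 * (\sum_(i < n) b i) ^+ 2] by case.
elim: n => [|n [IH1 IH2 IH3]].
  by rewrite !big_ord0 expr0n/= !mulr0 addr0 lexx.
rewrite !big_ord_recr/=; move: IH1 IH2 IH3.
set S := \sum_(i < n) h i * b i; set N := \sum_(i < n) b i.
set Q := \sum_(i < n) h i ^+ 2 * b i => IH1 IH2 IH3.
have /andP[h0 hC'] := hC n.
case: (b01 n) => ->; rewrite ?mulr0 ?addr0 ?mulr1//.
split; [lra|lra|].
have : S * h n <= C * N * C by exact: ler_pM.
move: IH3; rewrite !expr2 => IH3 Sh; lra.
Qed.

Section CompoundSquare.
Context d (Omega : measurableType d) (R : realType) (Pr : probability Omega R).
Context (J : jobs Pr) (Lambda : R) (f : R * R -> R) (L0 : 0 < Lambda).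
Hypothesis mJ : marked_poisson J Lambda f.
Let pJ : poisson_arrivals J Lambda := marked_arrivals mJ.
Local Open Scope ereal_scope.
Implicit Types phi psi : R * R -> R.

Lemma compound_finite phi s t w K : (forall z, (0 <= phi z)%R) ->
  (forall k, (K <= k)%N -> (t < arrival J k w)%R) ->
  compound J phi s t w =
  (\sum_(k < K) phi (mark J k w) * \1_(`]s, t]) (arrival J k w))%:E.
Proof.
move=> phi0 aK; rewrite /compound (@nneseries_split _ _ 0 K)/=; last first.
  by move=> k _; exact: compound_term_ge0.
rewrite add0n [X in _ + X]eseries0 ?adde0; last first.
  move=> k Kk _; rewrite indicE mem_setE in_itv/= [X in _ && X]leNgt aK//.
  by rewrite andbF mulr0.
by rewrite big_mkord sumEFin.
Qed.

Lemma mark_integral_le phi (C : R) : (forall z, (0 <= phi z)%R) ->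
  measurable_fun setT phi ->
  (forall z, (phi z <= C)%R) -> mark_integral J phi <= C%:E.
Proof.
move=> phi0 mphi phiC.
apply: (@le_trans _ _ (\int[Pr]_w cst C%:E w)).
  apply: ge0_le_integral => //.
  - by move=> w _; rewrite lee_fin.
  - by apply/measurable_EFinP; exact: measurableT_comp.
  - by move=> w _; rewrite lee_fin.
by rewrite integral_cst// [X in _ * X]probability_setT mule1.
Qed.

(** Diagonal terms give the first summand by [compound_mean]; pairs of distinct jobs contribute at
    most [C ^ 2 N (N - 1)], with [N] the count. The crude factor [C ^ 2] is harmless: the second
    summand is quadratic in the length of the interval, hence negligible after summation over fine
    cells. *)
Lemma compound_sqr_le phi (C s t : R) : (0 < s)%R -> (s < t)%R ->
  measurable_fun setT phi -> (forall z, (0 <= phi z <= C)%R) ->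
  \int[Pr]_w (compound J phi s t w * compound J phi s t w) <=
  (Lambda * (t - s))%:E * mark_integral J (fun z => (phi z ^+ 2)%R) +
  (C ^+ 2 * (Lambda * (t - s)) ^+ 2)%:E.
Proof.
move=> s0 st mphi phiC.
have phi0 z : (0 <= phi z)%R by have /andP[] := phiC z.
have phi20 z : (0 <= phi z ^+ 2)%R by exact: sqr_ge0.
have mphi2 : measurable_fun setT (fun z => (phi z ^+ 2)%R) by exact: measurable_funX.
have phi2oo : mark_integral J (fun z => (phi z ^+ 2)%R) < +oo.
  rewrite (le_lt_trans (@mark_integral_le _ (C ^+ 2) phi20 mphi2 _)) ?ltry// => z.
  by have /andP[? ?] := phiC z; rewrite ler_sqr ?nnegrE// (le_trans (phi0 z)).
set l := (Lambda * (t - s))%R.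
have l0 : (0 <= l)%R by rewrite mulr_ge0 ?subr_ge0 ?ltW.
set Z := compound J phi s t; set N := arrivals_in J s t.
have mZ : measurable_fun setT Z by exact: measurable_compound.
have Z0 w : 0 <= Z w by exact: compound_ge0.
have mN : measurable_fun setT N by exact: measurable_arrivals_in.
have N0 w : 0 <= N w by exact: arrivals_in_ge0.
have C2 : (0 <= C ^+ 2)%R by exact: sqr_ge0.
have mM (X Y : Omega -> \bar R) : measurable_fun setT X -> measurable_fun setT Y ->
  measurable_fun setT (fun x : Omega => X x * Y x) by exact: emeasurable_funM.
have mD (X Y : Omega -> \bar R) : measurable_fun setT X -> measurable_fun setT Y ->
  measurable_fun setT (fun x : Omega => X x + Y x) by exact: emeasurable_funD.
have mC (X : Omega -> \bar R) : measurable_fun setT X ->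
  measurable_fun setT (fun x : Omega => (C ^+ 2)%:E * X x) by exact: measurable_funeM.
have le1 : \int[Pr]_w (Z w * Z w + (C ^+ 2)%:E * N w) <=
    \int[Pr]_w (compound J (fun z => (phi z ^+ 2)%R) s t w + (C ^+ 2)%:E * (N w * N w)).
  apply: ae_ge0_le_integral => //.
  - by move=> w _; rewrite adde_ge0 ?mule_ge0// lee_fin.
  - by apply: (mD); [exact: mM|exact: mC].
  - by move=> w _; rewrite adde_ge0 ?mule_ge0 ?compound_ge0// lee_fin.
  - by apply: (mD); [exact: measurable_compound|apply: (mC); exact: mM].
  apply: filterS (ae_arrivals_unbounded L0 pJ) => w /(_ t)[K aK] _.
  rewrite /N arrivals_in_compound /Z !(@compound_finite _ _ _ _ K)//.
  rewrite -!EFinM -!EFinD lee_fin -!expr2.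
  under [X in (C ^+ 2 * X)%R]eq_bigr do rewrite mul1r.
  under [X in (C ^+ 2 * X ^+ 2)%R]eq_bigr do rewrite mul1r.
  apply: (@sqr_weighted_count_le _ (fun k => phi (mark J k w))
    (fun k => \1_(`]s, t]) (arrival J k w))) => k; first exact: phiC.
  by rewrite indicE; case: (_ \in _); [right|left].
have C20 : 0 <= (C ^+ 2)%:E by rewrite lee_fin.
have NN0 w : 0 <= N w * N w by exact: mule_ge0.
have ZZ0 w : 0 <= Z w * Z w by exact: mule_ge0.
have mNN : measurable_fun setT (fun w => N w * N w) by exact: mM.
have mQ : measurable_fun setT (compound J (fun z => (phi z ^+ 2)%R) s t).
  exact: measurable_compound.
move: le1; rewrite !ge0_integralD//; do ?[exact: mM|exact: mC
  |by move=> w _; exact: mule_ge0|by move=> w _; exact: compound_ge0].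
rewrite !ge0_integralZl//.
have s0' := ltW s0.
rewrite (arrivals_in_mean L0 pJ)// (arrivals_in_sqr L0 pJ)// -/l.
rewrite (compound_mean L0 mJ)// -/l -!EFinM.
(* [C ^ 2 E[N]] stands on both sides and cancels, as [E[N ^ 2] = l + l ^ 2]. *)
by rewrite mulrDr [(_ * l + _)%R]addrC [X in _ <= _ + X]EFinD addeA leeD2rE.
Qed.

End CompoundSquare.

(** * Shot noise *)

Lemma lee_div_natP (R : realType) (x : \bar R) (L K : R) :
  (forall n : nat, (0 < n)%N -> x <= (L + K / n%:R)%:E)%E -> (x <= L%:E)%E.
Proof.
move=> xn; apply/lee_addgt0Pr => e e0.
pose n := (Num.bound (`|K| / e)).+1.
rewrite (le_trans (xn n _))// -EFinD lee_fin lerD2l.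
rewrite ler_pdivrMr ?ltr0n// -ler_pdivrMl// mulrC.
rewrite (@le_trans _ _ (`|K| / e))// ?ler_pM2r ?invr_gt0 ?ler_norm//.
by rewrite (le_trans (ltW (archi_boundP _)))// ?divr_ge0 ?(ltW e0)// ler_nat.
Qed.

Section MarkIntegral.
Context d (Omega : measurableType d) (R : realType) (Pr : probability Omega R).
Context (J : jobs Pr).
Local Open Scope ereal_scope.
Implicit Types phi psi : R * R -> R.

Let measurable_mark_comp phi : measurable_fun setT phi ->
  measurable_fun setT (fun w => (phi (mark J 0 w))%:E).
Proof. by move=> mphi; apply/measurable_EFinP; exact: measurableT_comp. Qed.

Lemma le_mark_integral phi psi :
  measurable_fun setT phi -> measurable_fun setT psi ->
  (forall z, (0 <= phi z)%R) -> (forall z, (phi z <= psi z)%R) ->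
  mark_integral J phi <= mark_integral J psi.
Proof.
move=> mphi mpsi phi0 phipsi; apply: ge0_le_integral => //.
- by move=> w _; rewrite lee_fin.
- exact: measurable_mark_comp.
- exact: measurable_mark_comp.
- by move=> w _; rewrite lee_fin.
Qed.

Lemma mark_integralD phi psi :
  measurable_fun setT phi -> measurable_fun setT psi ->
  (forall z, (0 <= phi z)%R) -> (forall z, (0 <= psi z)%R) ->
  mark_integral J (fun z => (phi z + psi z)%R) =
  mark_integral J phi + mark_integral J psi.
Proof.
move=> mphi mpsi phi0 psi0; rewrite /mark_integral -ge0_integralD//.
- by move=> w _; rewrite lee_fin.
- exact: measurable_mark_comp.
- by move=> w _; rewrite lee_fin.
- exact: measurable_mark_comp.
Qed.

Lemma mark_integralZ phi (c : R) : measurable_fun setT phi ->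
  (forall z, (0 <= phi z)%R) -> (0 <= c)%R ->
  mark_integral J (fun z => (c * phi z)%R) = c%:E * mark_integral J phi.
Proof.
move=> mphi phi0 c0; rewrite /mark_integral -ge0_integralZl//.
- exact: measurable_mark_comp.
- by move=> w _; rewrite lee_fin.
Qed.

Lemma mark_integral_sum (phi : nat -> R * R -> R) n :
  (forall j, measurable_fun setT (phi j)) -> (forall j z, (0 <= phi j z)%R) ->
  mark_integral J (fun z => (\sum_(j < n) phi j z)%R) =
  \sum_(j < n) mark_integral J (phi j).
Proof.
move=> mphi phi0; rewrite /mark_integral -ge0_integral_sum//.
- by apply: eq_integral => w _; rewrite sumEFin.
- by move=> j; exact: measurable_mark_comp.
- by move=> j w _; rewrite lee_fin.
Qed.

Lemma mark_integral_fin phi (C : R) : measurable_fun setT phi ->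
  (forall z, (0 <= phi z <= C)%R) -> mark_integral J phi \is a fin_num.
Proof.
move=> mphi phiC; rewrite ge0_fin_numE; last first.
  by apply: mark_integral_ge0 => z; have /andP[] := phiC z.
rewrite (le_lt_trans (@mark_integral_le _ _ _ _ J phi C _ _ _)) ?ltry// => z.
  by have /andP[] := phiC z.
by have /andP[] := phiC z.
Qed.

End MarkIntegral.

Section ShotNoise.
Context d (Omega : measurableType d) (R : realType) (Pr : probability Omega R).
Context (J : jobs Pr) (Lambda : R) (f : R * R -> R) (L0 : 0 < Lambda).
Hypothesis mJ : marked_poisson J Lambda f.
Let pJ : poisson_arrivals J Lambda := marked_arrivals mJ.

Definition active k (t : R) w : R :=
  (arrival J k w <= t < arrival J k w + sojourn J k w)%R%:R.

Definition shot_noise (g : R * R -> R) (t : R) (w : Omega) : \bar R :=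
  (\sum_(0 <= k <oo) (g (mark J k w) * active k t w)%:E)%E.

Variables (g : R * R -> R) (C T : R).
Hypotheses (mg : measurable_fun setT g) (gC : forall z, 0 <= g z <= C)
  (T0 : 0 < T) (gT : forall z, g z != 0 -> 0 <= z.2 <= T).

Let g0 z : 0 <= g z. Proof. by have /andP[] := gC z. Qed.

Lemma measurable_active k t : measurable_fun setT (active k t).
Proof.
rewrite (_ : active k t = \1_((fun w => t - arrival J k w) @^-1` `[0%R, +oo[ `&`
   (fun w => arrival J k w + sojourn J k w) @^-1` `]t, +oo[)).
  apply: measurable_indic; apply: measurableI.
    rewrite -[X in measurable X]setTI; apply: measurable_funB => //.
  rewrite -[X in measurable X]setTI; apply: measurable_funD => //.
apply/funext => w; rewrite /active indicE; congr (nat_of_bool _)%:R; apply/idP/idP.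
  by move=> /andP[a b]; apply/mem_set; split; rewrite /= in_itv/= andbT// subr_ge0.
by move=> /set_mem[]; rewrite /= !in_itv/= !andbT subr_ge0 => -> ->.
Qed.

Lemma measurable_shot_noise t : measurable_fun setT (shot_noise g t).
Proof.
apply: ge0_emeasurable_sum => [k w _ _|k _].
  by rewrite lee_fin mulr_ge0.
apply/measurable_EFinP/measurable_funM; last exact: measurable_active.
by apply: measurableT_comp => //; exact: measurable_mark.
Qed.

Lemma shot_noise_ge0 t w : (0 <= shot_noise g t w)%E.
Proof. by apply: nneseries_ge0 => k _ _; rewrite lee_fin mulr_ge0. Qed.

(** * Grid approximation on the window []t - T, t]] *)

Section Grid.
Variables (n : nat) (h t : R).
Hypotheses (h0 : 0 < h) (nh : n%:R * h = T) (Tt : T < t).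

Let v j := t - T + j%:R * h.
Let v0 : v 0%N = t - T. Proof. by rewrite /v mul0r addr0. Qed.
Let vn : v n = t. Proof. by rewrite /v nh subrK. Qed.
Let vS j : v j.+1 = v j + h. Proof. by rewrite /v -natr1 mulrDl mul1r addrA. Qed.
Let v_inc j : v j < v j.+1. Proof. by rewrite vS ltrDl. Qed.
Let v_le i j : (i <= j)%N -> v i <= v j.
Proof. by move=> ij; rewrite lerD2l ler_pM2r// ler_nat. Qed.

Let v_gt0 j : 0 < v j.
Proof. by rewrite (lt_le_trans _ (v_le (leq0n j)))// v0 subr_gt0. Qed.

(** Inside a cell the arrival time is replaced by an end of the cell, so that being active at [t]
    becomes a condition on the mark alone and the cell carries a compound sum. The right end, here,
    enlarges the set of active jobs; the left end, in [cell_under], shrinks it. *)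
Definition cell_over j (z : R * R) : R := g z * (t - v j.+1 < z.2)%R%:R.
Definition cell_under j (z : R * R) : R := g z * (t - v j < z.2)%R%:R.

Let measurable_cut (c : R) :
  measurable_fun setT (fun z : R * R => g z * (c < z.2)%R%:R).
Proof.
apply: measurable_funM => //.
rewrite (_ : (fun _ => _) = \1_(snd @^-1` `]c, +oo[)).
  by apply: measurable_indic; rewrite -[X in measurable X]setTI; exact: measurable_snd.
apply/funext => z; rewrite indicE; congr (nat_of_bool _)%:R; apply/idP/idP.
  by move=> cz; apply/mem_set; rewrite /preimage/= in_itv/= andbT.
by move=> /set_mem; rewrite /preimage/= in_itv/= andbT.
Qed.

Lemma measurable_cell_over j : measurable_fun setT (cell_over j).
Proof. exact: measurable_cut. Qed.

Lemma measurable_cell_under j : measurable_fun setT (cell_under j).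
Proof. exact: measurable_cut. Qed.

Lemma cell_over_bounds j z : 0 <= cell_over j z <= C.
Proof.
have /andP[_ gC'] := gC z; rewrite /cell_over mulr_ge0//=.
by rewrite (le_trans _ gC')// ler_piMr// lern1 leq_b1.
Qed.

Let cell_over_ge0 j z : 0 <= cell_over j z.
Proof. by have /andP[] := cell_over_bounds j z. Qed.

Lemma cell_under_bounds j z : 0 <= cell_under j z <= C.
Proof.
have /andP[_ gC'] := gC z; rewrite /cell_under mulr_ge0//=.
by rewrite (le_trans _ gC')// ler_piMr// lern1 leq_b1.
Qed.

Let cell_under_ge0 j z : 0 <= cell_under j z.
Proof. by have /andP[] := cell_under_bounds j z. Qed.

Let indic_chain x : \sum_(j < n) \1_(`]v j, v j.+1]) x = \1_(`]t - T, t]) x :> R.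
Proof. by rewrite sum_indic_chain ?v0 ?vn// => i; exact/ltW. Qed.

Lemma active_le_cells k w :
  g (mark J k w) * active k t w <=
  \sum_(j < n) cell_over j (mark J k w) * \1_(`]v j, v j.+1]) (arrival J k w).
Proof.
set z := mark J k w; set a := arrival J k w.
have cells0 : 0 <= \sum_(j < n) cell_over j z * \1_(`]v j, v j.+1]) a.
  by apply: sumr_ge0 => j _; rewrite mulr_ge0//; have /andP[] := cell_over_bounds j z.
have [gz|/gT/andP[z20 z2T]] := eqVneq (g z) 0; first by rewrite gz mul0r.
rewrite /active -/a; case: andP => [[a_t ta]|_]; last by rewrite mulr0.
have tz : t < a + z.2 by [].
have a_in : \1_(`]t - T, t]) a = 1 :> R.
  rewrite indicE mem_setE in_itv/= a_t andbT (_ : t - T < a)//.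
  by rewrite ltrBlDr (lt_le_trans tz)// lerD2l.
rewrite -a_in -indic_chain mulr_sumr; apply: ler_sum => j _.
rewrite /cell_over -mulrA ler_wpM2l// indicE mem_setE in_itv/=.
case: andP => [[_ aj]|_]; last by rewrite mulr0.
by rewrite mulr1 (_ : t - v j.+1 < z.2)// ltrBlDr (lt_le_trans tz)// addrC lerD2l.
Qed.

Lemma cells_le_active k w :
  \sum_(j < n) cell_under j (mark J k w) * \1_(`]v j, v j.+1]) (arrival J k w) <=
  g (mark J k w) * active k t w.
Proof.
set z := mark J k w; set a := arrival J k w.
apply: (@le_trans _ _ (\sum_(j < n) g z * active k t w * \1_(`]v j, v j.+1]) a)).
  apply: ler_sum => j _; rewrite indicE mem_setE in_itv/=.
  case: andP => [[ja aj]|_]; last by rewrite !mulr0.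
  rewrite !mulr1 ler_wpM2l//; case: ltP => //= jz.
  have a_t : a <= t by rewrite (le_trans aj)// -[X in _ <= X]vn v_le.
  have ta : t < a + sojourn J k w.
    by move: jz; rewrite ltrBlDr => /lt_trans; apply; rewrite addrC ltrD2r.
  by rewrite /active -/a a_t ta.
rewrite -mulr_sumr indic_chain ler_piMr ?mulr_ge0// indicE lern1 leq_b1//.
Qed.

(** Seen backwards from [t], the cell ends are the points [i h] of [grid_count_le]. The weight [p]
    is meant to be [g z] or its square, and [g z != 0] gives [0 <= z.2 <= T]. *)
Lemma sum_cell_over (z : R * R) (p : R) :
  p = 0 \/ g z != 0 -> 0 <= p ->
  h * \sum_(j < n) (p * (t - v j.+1 < z.2)%R%:R) <= p * (z.2 + h).
Proof.
case=> [->|gz] p0; first by rewrite big1 ?mulr0 ?mul0r// => i _; rewrite mul0r.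
have /andP[z0 zT] := gT gz.
rewrite -mulr_sumr mulrCA ler_wpM2l//.
apply: le_trans (grid_count_le (ltW h0) n z0).
rewrite (reindex_inj rev_ord_inj)/= le_eqVlt; apply/orP; left; apply/eqP.
congr (_ * _); apply: eq_bigr => j _; congr (nat_of_bool (_ < _))%:R.
rewrite subnSK// /v natrB; last exact: ltnW.
by rewrite mulrBl nh; ring.
Qed.

Lemma sum_cell_under (z : R * R) (p : R) :
  p = 0 \/ g z != 0 -> 0 <= p ->
  p * z.2 <= h * \sum_(j < n) (p * (t - v j < z.2)%R%:R) + p * h.
Proof.
case=> [->|gz] p0.
  by rewrite big1 ?mulr0 ?mul0r ?addr0// => i _; rewrite mul0r.
have /andP[z0 zT] := gT gz.
rewrite -mulr_sumr mulrCA -mulrDr ler_wpM2l//.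
apply: (le_trans (@grid_count_ge _ _ (ltW h0) z.2 n _)); first by rewrite nh.
rewrite lerD2r (reindex_inj rev_ord_inj)/= le_eqVlt; apply/orP; left; apply/eqP.
congr (_ * _); apply: eq_bigr => j _; congr (nat_of_bool (_ < _))%:R.
rewrite subnSK// /v natrB; last exact: ltnW.
by rewrite mulrBl nh; ring.
Qed.

Lemma shot_noise_le_cells w :
  (shot_noise g t w <= \sum_(j < n) compound J (cell_over j) (v j) (v j.+1) w)%E.
Proof.
rewrite /compound -nneseries_sum; last first.
  by move=> j k _; rewrite lee_fin mulr_ge0.
apply: lee_nneseries => [k _ _|k _]; first by rewrite lee_fin mulr_ge0.
by rewrite sumEFin lee_fin active_le_cells.
Qed.

Lemma cells_le_shot_noise w :
  (\sum_(j < n) compound J (cell_under j) (v j) (v j.+1) w <= shot_noise g t w)%E.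
Proof.
rewrite /compound -nneseries_sum; last first.
  by move=> j k _; rewrite lee_fin mulr_ge0.
apply: lee_nneseries => [k _ _|k _].
  by apply: sume_ge0 => j _; rewrite lee_fin mulr_ge0.
by rewrite sumEFin lee_fin cells_le_active.
Qed.

Let C0 : 0 <= C.
Proof. by have /andP[] := gC (0, 0); exact: le_trans. Qed.

Lemma shot_noise_grid_mean B :
  mark_integral J (fun z => g z * z.2) = B%:E ->
  ((Lambda * (B - h * C))%:E <= \int[Pr]_w shot_noise g t w)%E.
Proof.
move=> BE.
have mZ j : measurable_fun setT (compound J (cell_under j) (v j) (v j.+1)).
  by apply: measurable_compound => //; exact: measurable_cell_under.
have Z0 j w : (0 <= compound J (cell_under j) (v j) (v j.+1) w)%E.
  exact: compound_ge0.
have fin_e j : mark_integral J (cell_under j) \is a fin_num.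
  exact: mark_integral_fin (measurable_cell_under j) (cell_under_bounds j).
apply: (@le_trans _ _ (\int[Pr]_w
    (\sum_(j < n) compound J (cell_under j) (v j) (v j.+1) w))%E); last first.
  apply: ge0_le_integral => //.
  - by move=> w _; exact: sume_ge0.
  - exact: emeasurable_sum.
  - exact: measurable_shot_noise.
  - by move=> w _; exact: cells_le_shot_noise.
rewrite ge0_integral_sum//.
under eq_bigr => j _.
  rewrite (compound_mean L0 mJ)//; last 2 first.
  - exact: measurable_cell_under.
  - by rewrite ltey_eq fin_e.
  rewrite vS addrAC subrr add0r EFinM -muleA.
  over.
rewrite -ge0_sume_distrr; last first.
  move=> j _; apply: mule_ge0; first by rewrite lee_fin ltW.
  exact: mark_integral_ge0.
rewrite EFinM lee_pmul2l//.
rewrite -ge0_sume_distrr; last by move=> j _; exact: mark_integral_ge0.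
rewrite -(mark_integral_sum J n)//; last exact: measurable_cell_under.
have msum : measurable_fun setT (fun z => \sum_(j < n) cell_under j z).
  by apply: measurable_sum => j; exact: measurable_cell_under.
have sum0 z : 0 <= \sum_(j < n) cell_under j z by exact: sumr_ge0.
rewrite -mark_integralZ//; last exact: ltW.
rewrite EFinB leeBlDr// -BE.
apply: (@le_trans _ _ (mark_integral J (fun z => h * \sum_(j < n) cell_under j z + h * g z))).
  apply: le_mark_integral.
  - by apply: measurable_funM => //; exact: measurable_snd.
  - by apply: measurable_funD; exact: measurable_funM.
  - move=> z; have [->|/gT/andP[z0 _]] := eqVneq (g z) 0; first by rewrite mul0r.
    exact: mulr_ge0.
  - move=> z; rewrite (le_trans (@sum_cell_under z (g z) _ _))//; last first.
      by rewrite [h * g z]mulrC.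
    by case: (eqVneq (g z) 0); [left|right].
rewrite mark_integralD//; last 4 first.
- exact: measurable_funM.
- exact: measurable_funM.
- by move=> z; rewrite mulr_ge0// ltW.
- by move=> z; rewrite mulr_ge0// ltW.
apply: leeD2l; rewrite mark_integralZ//; last exact: ltW.
rewrite (EFinM h); apply: lee_wpmul2l; first by rewrite lee_fin ltW.
by apply: mark_integral_le => // z; have /andP[] := gC z.
Qed.

(** The weight [p] will be [g] for the means of the cells and [g ^ 2] for their second moments. *)
Let cell_mass_le (p : R * R -> R) (q : nat -> R * R -> R) K M :
  measurable_fun setT p -> (forall z, 0 <= p z <= K) ->
  (forall z, p z = 0 \/ g z != 0) ->
  (forall j z, q j z = p z * (t - v j.+1 < z.2)%R%:R) ->
  (forall j, measurable_fun setT (q j)) ->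
  mark_integral J (fun z => p z * z.2) = M%:E ->
  (h%:E * \sum_(j < n) mark_integral J (q j) <= (M + K * h)%:E)%E.
Proof.
move=> mp pK pg qE mq ME.
have p0 z : 0 <= p z by have /andP[] := pK z.
have q0 j z : 0 <= q j z by rewrite qE mulr_ge0.
rewrite -(mark_integral_sum J n)//.
have msum : measurable_fun setT (fun z => \sum_(j < n) q j z) by exact: measurable_sum.
have sum0 z : 0 <= \sum_(j < n) q j z by exact: sumr_ge0.
rewrite -mark_integralZ//; last exact: ltW.
have mp2 : measurable_fun setT (fun z => p z * z.2).
  by apply: measurable_funM => //; exact: measurable_snd.
have mhp : measurable_fun setT (fun z => h * p z) by exact: measurable_funM.
have hp0 z : 0 <= h * p z by rewrite mulr_ge0// ltW.
have p20 z : 0 <= p z * z.2.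
  by have [->|/gT/andP[z0 _]] := pg z; rewrite ?mul0r// mulr_ge0.
apply: (@le_trans _ _ (mark_integral J (fun z => p z * z.2 + h * p z))).
  apply: le_mark_integral => //.
  - exact: measurable_funM.
  - exact: measurable_funD.
  - by move=> z; rewrite mulr_ge0// ltW.
  - move=> z; rewrite [h * p z]mulrC -mulrDr.
    by under eq_bigr do rewrite qE; exact: sum_cell_over.
rewrite mark_integralD// ME EFinD; apply: leeD2l; rewrite mark_integralZ//; last exact: ltW.
rewrite [K * h]mulrC (EFinM h); apply: lee_wpmul2l; first by rewrite lee_fin ltW.
apply: mark_integral_le => // z.
by have /andP[] := pK z.
Qed.

(** Distinct cells are uncorrelated, and [second_moment_sum_le] adds them up. The summands are the
    diagonal part, the pairs of jobs within one cell, of order [n h ^ 2], and the squared mean;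
    every correction vanishes with [h]. *)
Lemma shot_noise_grid_sqr A B :
  mark_integral J (fun z => g z ^+ 2 * z.2) = A%:E ->
  mark_integral J (fun z => g z * z.2) = B%:E ->
  (\int[Pr]_w (shot_noise g t w * shot_noise g t w) <=
   (Lambda * (A + C ^+ 2 * h) + n%:R * (C ^+ 2 * (Lambda * h) ^+ 2) +
    (Lambda * (B + C * h)) ^+ 2)%:E)%E.
Proof.
move=> AE BE.
pose Z j := compound J (cell_over j) (v j) (v j.+1).
have mZ j : measurable_fun setT (Z j).
  by apply: measurable_compound => //; exact: measurable_cell_over.
have Z0 j w : (0 <= Z j w)%E by exact: compound_ge0.
pose e j := fine (mark_integral J (cell_over j)).
pose e2 j := fine (mark_integral J (fun z => cell_over j z ^+ 2)).
have eE j : mark_integral J (cell_over j) = (e j)%:E.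
  by rewrite fineK//; exact: mark_integral_fin (measurable_cell_over j) (cell_over_bounds j).
have mcell2 j : measurable_fun setT (fun z => cell_over j z ^+ 2).
  by apply: measurable_funX; exact: measurable_cell_over.
have e2E j : mark_integral J (fun z => cell_over j z ^+ 2) = (e2 j)%:E.
  rewrite fineK//; apply: (@mark_integral_fin _ _ _ _ _ _ (C ^+ 2)) => // z.
  have /andP[c0 cC] := cell_over_bounds j z.
  by rewrite sqr_ge0 ler_sqr ?nnegrE.
have vSB j : v j.+1 - v j = h by rewrite vS addrAC subrr add0r.
apply: (@le_trans _ _ (\int[Pr]_w ((\sum_(j < n) Z j w) * (\sum_(j < n) Z j w)))%E).
  have mS : measurable_fun setT (fun w => \sum_(j < n) Z j w)%E by exact: emeasurable_sum.
  apply: ge0_le_integral => //.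
  - by move=> w _; rewrite mule_ge0// shot_noise_ge0.
  - by apply: emeasurable_funM; exact: measurable_shot_noise.
  - exact: emeasurable_funM.
  - by move=> w _; apply: lee_pmul; rewrite ?shot_noise_ge0//; exact: shot_noise_le_cells.
pose alpha j := Lambda * h * e2 j + C ^+ 2 * (Lambda * h) ^+ 2.
have meanZ j : (\int[Pr]_w Z j w = (Lambda * h * e j)%:E)%E.
  rewrite (compound_mean L0 mJ)//; last 2 first.
  - exact: measurable_cell_over.
  - by rewrite eE ltry.
  by rewrite vSB eE -EFinM.
apply: (le_trans (@second_moment_sum_le _ _ _ Pr Z (fun j => Lambda * h * e j) alpha n
    mZ Z0 _ _ _)) => //.
- move=> i j /andP[ij jn].
  rewrite (compound_uncorrelated L0 mJ)//.
  + by rewrite !meanZ -EFinM.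
  + exact: v_le.
  + exact: measurable_cell_over.
  + exact: measurable_cell_over.
  + by rewrite eE ltry.
- move=> j jn; apply: le_trans (compound_sqr_le L0 mJ (C := C) _ _ _ _) _ => //.
  + exact: measurable_cell_over.
  + exact: cell_over_bounds.
  + by rewrite vSB e2E -EFinM -EFinD.
rewrite lee_fin /alpha big_split/= sumr_const card_ord -mulr_natl -!mulr_sumr.
have e_ge0 j : 0 <= e j by rewrite fine_ge0// mark_integral_ge0.
have le_B : h * \sum_(j < n) e j <= B + C * h.
  rewrite -lee_fin (EFinM h) -sumEFin.
  under eq_bigr do rewrite -eE.
  apply: (@cell_mass_le g) => //.
  - by move=> z; case: (eqVneq (g z) 0); [left|right].
  - exact: measurable_cell_over.
have le_A : h * \sum_(j < n) e2 j <= A + C ^+ 2 * h.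
  rewrite -lee_fin (EFinM h) -sumEFin.
  under eq_bigr do rewrite -e2E.
  apply: (@cell_mass_le (fun z => g z ^+ 2) (fun j z => cell_over j z ^+ 2)) => //.
  - exact: measurable_funX.
  - by move=> z; have /andP[g0' gC'] := gC z; rewrite sqr_ge0 ler_sqr ?nnegrE.
  - move=> z; have [gz|gz] := eqVneq (g z) 0; last by right.
    by left; rewrite gz expr0n.
  - move=> j z; rewrite /cell_over exprMn; case: (_ < _)%R; last by rewrite expr0n.
    by rewrite expr1n.
rewrite mulr1 mulr_natl -!(mulrA Lambda h); apply: lerD; first apply: lerD => //.
  by rewrite ler_wpM2l// ltW.
rewrite ler_sqr ?nnegrE.
- by rewrite ler_wpM2l// ltW.
- by apply: mulr_ge0; [exact: ltW|apply: mulr_ge0; [exact: ltW|exact: sumr_ge0]].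
- apply: mulr_ge0; first exact: ltW.
  apply: le_trans le_B; apply: mulr_ge0; [exact: ltW|exact: sumr_ge0].
Qed.

End Grid.

(** Half of Campbell's formula; with the upper bound of [shot_noise_sqr_le] it controls the variance
    from above. The condition [T < t] keeps the window []t - T, t]] on the half-line where arrivals
    are Poisson. *)
Lemma shot_noise_mean_ge B t : T < t ->
  mark_integral J (fun z => g z * z.2) = B%:E ->
  ((Lambda * B)%:E <= \int[Pr]_w shot_noise g t w)%E.
Proof.
move=> Tt BE; rewrite -leeN2; apply: (@lee_div_natP _ _ _ (Lambda * T * C)) => n n0.
have n1 : n%:R != 0 :> R by rewrite pnatr_eq0 -lt0n.
have nh : n%:R * (T / n%:R) = T by rewrite mulrC divfK.
have h0 : 0 < T / n%:R by rewrite divr_gt0// ltr0n.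
rewrite leeNl -EFinN; apply: le_trans (shot_noise_grid_mean h0 nh Tt BE).
by rewrite lee_fin le_eqVlt; apply/orP; left; apply/eqP; ring.
Qed.

Lemma shot_noise_sqr_le A B t : T < t ->
  mark_integral J (fun z => g z ^+ 2 * z.2) = A%:E ->
  mark_integral J (fun z => g z * z.2) = B%:E ->
  (\int[Pr]_w (shot_noise g t w * shot_noise g t w) <=
   (Lambda * A + (Lambda * B) ^+ 2)%:E)%E.
Proof.
move=> Tt AE BE.
have C0 : 0 <= C by have /andP[] := gC (0, 0); exact: le_trans.
have B0 : 0 <= B.
  rewrite -lee_fin -BE; apply: mark_integral_ge0 => z.
  by have [->|/gT/andP[z0 _]] := eqVneq (g z) 0; rewrite ?mul0r// mulr_ge0.
apply: (@lee_div_natP _ _ _ (Lambda * C ^+ 2 * T + C ^+ 2 * Lambda ^+ 2 * T ^+ 2 +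
  Lambda ^+ 2 * (2 * B * C * T + C ^+ 2 * T ^+ 2))) => n n0.
have n1 : n%:R != 0 :> R by rewrite pnatr_eq0 -lt0n.
have nh : n%:R * (T / n%:R) = T by rewrite mulrC divfK.
have h0 : 0 < T / n%:R by rewrite divr_gt0// ltr0n.
apply: (le_trans (shot_noise_grid_sqr h0 nh Tt AE BE)); rewrite lee_fin.
set x := n%:R^-1.
have nx : n%:R * x = 1 by rewrite mulfV.
have x0 : 0 <= x by rewrite invr_ge0.
have x1 : x <= 1 by rewrite invf_le1 ?ltr0n// ler1n.
have -> : n%:R * (C ^+ 2 * (Lambda * (T * x)) ^+ 2) = C ^+ 2 * Lambda ^+ 2 * T ^+ 2 * x.
  rewrite [LHS](_ : _ = C ^+ 2 * Lambda ^+ 2 * T ^+ 2 * x * (n%:R * x)); last by ring.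
  by rewrite nx mulr1.
(* [x ^ 2 <= x] turns the quadratic error into a linear one, which [lee_div_natP] removes. *)
have xx : Lambda ^+ 2 * C ^+ 2 * T ^+ 2 * (x * x) <= Lambda ^+ 2 * C ^+ 2 * T ^+ 2 * x.
  apply: ler_wpM2l; last by rewrite ler_piMr.
  by apply: mulr_ge0; [apply: mulr_ge0|]; exact: sqr_ge0.
rewrite -subr_ge0 in xx; rewrite -subr_ge0.
by apply: le_trans xx _; rewrite le_eqVlt; apply/orP; left; apply/eqP; ring.
Qed.

End ShotNoise.

(** * Weak limits *)

Section SquareIntegrable.
Context d (T : measurableType d) (R : realType) (P : probability T R).
Implicit Types X Y : T -> R.

Lemma integrable_sqrM X Y : measurable_fun setT X -> measurable_fun setT Y ->
  P.-integrable setT (EFin \o (fun x => X x ^+ 2)) ->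
  P.-integrable setT (EFin \o (fun x => Y x ^+ 2)) ->
  P.-integrable setT (EFin \o (fun x => X x * Y x)).
Proof.
move=> mX mY iX iY.
apply: (le_integrable measurableT _ _ (integrableD measurableT iX iY)) => //.
  by apply/measurable_EFinP; exact: measurable_funM.
move=> x _ /=; rewrite lee_fin normrM [leRHS]ger0_norm ?addr_ge0 ?sqr_ge0//.
rewrite -(real_normK (num_real (X x))) -(real_normK (num_real (Y x))).
move: (`|X x|) (`|Y x|) (normr_ge0 (X x)) (normr_ge0 (Y x)) => a b a0 b0.
by have := sqr_ge0 (a - b); rewrite !expr2; nra.
Qed.

Lemma integrable_probability_cst (c : R) : P.-integrable setT (EFin \o (fun=> c)).
Proof. exact: finite_measure_integrable_cst. Qed.

Lemma integrable_sqr X : measurable_fun setT X ->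
  P.-integrable setT (EFin \o (fun x => X x ^+ 2)) -> P.-integrable setT (EFin \o X).
Proof.
move=> mX iX; rewrite (_ : X = fun x => X x * (cst 1 : T -> R) x); last first.
  by apply/funext => x; rewrite mulr1.
by apply: integrable_sqrM => //; exact: (integrable_probability_cst (1 ^+ 2)).
Qed.

Lemma Rintegral_probability_cst (c : R) : \int[P]_x c = c.
Proof. by rewrite Rintegral_cst// [X in fine X]probability_setT mulr1. Qed.

Lemma EFin_Rintegral X : P.-integrable setT (EFin \o X) ->
  (\int[P]_x (X x)%:E)%E = (\int[P]_x X x)%:E.
Proof. by move=> iX; rewrite fineK//; exact: integrable_fin_num. Qed.

Lemma integrable_ge0 X (K : R) : measurable_fun setT X -> (forall x, 0 <= X x) ->
  (\int[P]_x (X x)%:E <= K%:E)%E -> P.-integrable setT (EFin \o X).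
Proof.
move=> mX X0 XK; apply/integrableP; split; first exact/measurable_EFinP.
apply: le_lt_trans (ltry K); apply: le_trans XK.
rewrite le_eqVlt; apply/orP; left; apply/eqP; apply: eq_integral => x _ /=.
by rewrite ger0_norm.
Qed.

(** [E[(X - c) ^ 2]] exceeds the variance by the square of [c - E[X]]. A finite deviation from any
    one [c] already yields integrability. *)
Lemma mean_square_deviation X (c : R) : measurable_fun setT X ->
  P.-integrable setT (EFin \o (fun x => (X x - c) ^+ 2)) ->
  [/\ P.-integrable setT (EFin \o X),
      P.-integrable setT (EFin \o (fun x => (X x - \int[P]_y X y) ^+ 2)) &
      \int[P]_x (X x - \int[P]_y X y) ^+ 2 <= \int[P]_x (X x - c) ^+ 2].
Proof.
move=> mX iXc; set m := \int[P]_y X y.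
have mXc : measurable_fun setT (fun x => X x - c) by exact: measurable_funB.
have iXc1 := integrable_sqr mXc iXc.
have icst a := integrable_probability_cst a.
have iX : P.-integrable setT (EFin \o X).
  rewrite (_ : _ \o _ = (EFin \o (fun x => X x - c)) \+ (EFin \o (fun=> c))).
    exact: integrableD.
  by apply/funext => x /=; rewrite -EFinD subrK.
have E : (fun x => (X x - m) ^+ 2) =
    (fun x => (X x - c) ^+ 2 + (2 * (c - m) * (X x - c) + (c - m) ^+ 2)).
  by apply/funext => x; ring.
have i1 : P.-integrable setT (EFin \o (fun x => 2 * (c - m) * (X x - c))).
  exact: (integrableZl measurableT _ iXc1).
have i2 : P.-integrable setT
    (EFin \o (fun x => 2 * (c - m) * (X x - c) + (c - m) ^+ 2)) by exact: (integrableD measurableT i1 (icst _)).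
split => //.
  by rewrite E; exact: (integrableD measurableT iXc i2).
rewrite E RintegralD// RintegralD// RintegralZl// RintegralB// -/m.
rewrite !Rintegral_probability_cst.
by have := sqr_ge0 (c - m); rewrite !expr2; nra.
Qed.

End SquareIntegrable.

Section WeakLimit.
Context d (Omega : measurableType d) (R : realType) (Pr : probability Omega R).
Variables (P : R -> Omega -> R) (v : R).
Hypothesis mP : forall t, measurable_fun setT (P t).
Hypothesis Pv : stationary_variance Pr P v.

Lemma stationary_marginal : exists d' (Omega' : measurableType d')
    (Pr' : probability Omega' R) (Q : {RV Pr' >-> R}),
  ('V_Pr'[Q] = v%:E)%E /\
  forall (phi : R -> R) (M : R), continuous phi -> (forall x, `|phi x| <= M) ->
    (\int[Pr]_w (phi (P t w))%:E)%E @[t --> +oo%R] -->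
    (\int[Pr']_w (phi (Q w))%:E)%E.
Proof.
have [d2 [W2 [Pr2 [Q [_ lim_Q var_Q]]]]] := Pv.
exists d2, W2, Pr2, (Q 0); split => // phi M cphi phiM.
pose g (x : 'rV[R]_1) := phi (x ord0 ord0).
have bg : bounded_continuous g.
  split; last by exists M => x; exact: phiM.
  by move=> x; apply: continuous_comp; [exact: coord_continuous|exact: cphi].
have := lim_Q 1%N (fun=> 0) g (fun=> lexx 0) bg.
rewrite [X in _ --> X -> _](_ : _ = \int[Pr2]_w (phi (Q 0 w))%:E)%E; last first.
  by rewrite unlock; apply: eq_integral => w _; rewrite /g mxE.
apply: cvg_trans; apply: near_eq_cvg; apply: nearW => t.
by rewrite unlock; apply: eq_integral => w _; rewrite /g mxE addr0.
Qed.

Let near_lt d2 (W2 : measurableType d2) (Pr2 : probability W2 R) (Q : {RV Pr2 >-> R})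
    (phi : R -> R) (b : R) :
  (\int[Pr]_w (phi (P t w))%:E)%E @[t --> +oo%R] --> (\int[Pr2]_w (phi (Q w))%:E)%E ->
  (\int[Pr2]_w (phi (Q w))%:E < b%:E)%E ->
  exists t1, forall t, t1 < t -> (\int[Pr]_w (phi (P t w))%:E < b%:E)%E.
Proof.
move=> lim_phi /open_ereal_lt' nb.
have [t1 [_ t1P]] := lim_phi _ nb.
by exists t1 => t; exact: t1P.
Qed.

Let varE d2 (W2 : measurableType d2) (Pr2 : probability W2 R) (Q : W2 -> R) :
  ('V_Pr2[Q] = \int[Pr2]_w ((Q w - \int[Pr2]_x Q x) ^+ 2)%:E)%E.
Proof. by rewrite /variance unlock expectation.unlock. Qed.

Let continuous_sqr_dev (c : R) : continuous (fun x : R => (x - c) ^+ 2).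
Proof.
move=> x; apply: (@continuous_comp _ _ _ (fun x => x - c) (fun x => x ^+ 2)).
  by apply: cvgB; [exact: cvg_id|exact: cvg_cst].
exact: exprn_continuous.
Qed.

Let truncated_sqr (c M x : R) := Num.min ((x - c) ^+ 2) M.

Let truncated_sqr_continuous c M : continuous (truncated_sqr c M).
Proof.
move=> x; apply: (@continuous_min _ _ (fun x => (x - c) ^+ 2) (fun=> M)).
  exact: continuous_sqr_dev.
exact: cvg_cst.
Qed.

Let truncated_sqr_ge0 c M x : 0 <= M -> 0 <= truncated_sqr c M x.
Proof. by move=> M0; rewrite /truncated_sqr le_min sqr_ge0. Qed.

Let truncated_sqr_bound c M x : 0 <= M -> `|truncated_sqr c M x| <= M.
Proof.
by move=> M0; rewrite ger0_norm ?truncated_sqr_ge0// /truncated_sqr ge_min lexx orbT.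
Qed.

(** A Fatou argument: truncations of [(x - c) ^ 2] are bounded and continuous, so their bounds pass
    to the limit law, and monotone convergence lifts the truncation. The mean of the limit law is
    then at least as good a centre as [c]. *)
Lemma stationary_variance_le (c V t0 : R) :
  (forall t, t0 < t -> (\int[Pr]_w ((P t w - c) ^+ 2)%:E <= V%:E)%E) -> v <= V.
Proof.
move=> PV; have [d2 [W2 [Pr2 [Q [varQ limQ]]]]] := stationary_marginal.
have mQ : measurable_fun setT Q by [].
have mdev : measurable_fun setT (fun w => (Q w - c) ^+ 2).
  by apply: measurable_funX; exact: measurable_funB.
have mtrunc d3 (W3 : measurableType d3) (X : W3 -> R) n : measurable_fun setT X ->
    measurable_fun setT (fun w => (truncated_sqr c n%:R (X w))%:E).
  move=> mX; apply/measurable_EFinP; apply: measurableT_comp => //.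
  by apply: continuous_measurable_fun; exact: truncated_sqr_continuous.
have QV : (\int[Pr2]_w ((Q w - c) ^+ 2)%:E <= V%:E)%E.
  pose g n w := (truncated_sqr c n%:R (Q w))%:E.
  have limE : (fun w => limn (g^~ w)) = (fun w => ((Q w - c) ^+ 2)%:E).
    apply/funext => w; apply/cvg_lim => //; apply: cvg_near_cst.
    exists (Num.bound ((Q w - c) ^+ 2)) => // n /= bn; congr EFin.
    apply/min_idPl; rewrite (le_trans (ltW (archi_boundP (sqr_ge0 _))))//.
    by rewrite ler_nat.
  have := @cvg_monotone_convergence _ _ _ Pr2 setT measurableT g.
  rewrite limE => H; apply: (cvge_le _ (H _ _ _)).
  - apply: nearW => n; apply: (cvge_le _ (limQ (truncated_sqr c n%:R) n%:R _ _)).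
    + exists t0; split; first exact: num_real.
      move=> t /PV; apply: le_trans; apply: ge0_le_integral => //.
      * by move=> w _; rewrite lee_fin truncated_sqr_ge0.
      * exact: mtrunc.
      * apply/measurable_EFinP; apply: measurable_funX; exact: measurable_funB.
      * by move=> w _; rewrite lee_fin /truncated_sqr ge_min lexx.
    + exact: truncated_sqr_continuous.
    + by move=> x; exact: truncated_sqr_bound.
  - by move=> n; exact: mtrunc.
  - by move=> n w _; rewrite lee_fin truncated_sqr_ge0.
  - move=> w _ n m nm; rewrite lee_fin /truncated_sqr le_min !ge_min lexx/=.
    by rewrite ler_nat nm orbT.
have iQ := integrable_ge0 mdev (fun w => sqr_ge0 _) QV.
have [_ iQm le_c] := mean_square_deviation mQ iQ.
rewrite -lee_fin -varQ varE EFin_Rintegral// lee_fin.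
by rewrite (le_trans le_c)// -lee_fin -EFin_Rintegral.
Qed.

(** The sign [s] is 1 or -1, so that one argument bounds the mean from both sides. *)
Let clamp (s m M x : R) := s * Num.max (- M) (Num.min (x - m) M).

Let clamp_continuous s m M : continuous (clamp s m M).
Proof.
move=> x; apply: cvgM; first exact: cvg_cst.
apply: (@continuous_max _ _ (fun=> - M) (fun x => Num.min (x - m) M)).
  exact: cvg_cst.
apply: (@continuous_min _ _ (fun x => x - m) (fun=> M)); last exact: cvg_cst.
by apply: cvgB; [exact: cvg_id|exact: cvg_cst].
Qed.

Let clamp_bound s m M x : 0 < M -> s = 1 \/ s = -1 -> `|clamp s m M x| <= M.
Proof.
move=> M0 s1; rewrite /clamp normrM; have -> : `|s| = 1.
  by case: s1 => ->; rewrite ?normrN normr1.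
rewrite mul1r ler_norml le_max lexx/= ge_max ge_min lexx orbT andbT.
by rewrite (le_trans _ (ltW M0))// oppr_le0 ltW.
Qed.

(** The truncation error of [y = x - m] is 0 if [|y| <= M], and otherwise at most
    [|y| <= y ^ 2 / M]. *)
Let clamp_dist s m M x : 0 < M -> s = 1 \/ s = -1 ->
  s * (x - m) <= clamp s m M x + M^-1 * (x - m) ^+ 2 /\
  clamp s m M x <= s * (x - m) + M^-1 * (x - m) ^+ 2.
Proof.
move=> M0 s1; rewrite /clamp; set y := x - m; set q := M^-1 * y ^+ 2.
have q0 : 0 <= q by rewrite mulr_ge0 ?sqr_ge0// invr_ge0 ltW.
have Mq : M * q = y ^+ 2 by rewrite /q mulrA mulfV ?mul1r// gt_eqF.
have := sqr_ge0 (y - M); have := sqr_ge0 (y + M); rewrite !expr2 in Mq * => h1 h2.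
have [yM|My] := leP y M; have [yM'|My'] := leP (- M) _; case: s1 => ->; split; nra.
Qed.

(** Weak convergence alone does not carry the variance of the limit back to finite times. Bounded
    fourth moments make the truncation errors of the square of order [1 / M] uniformly in [t], and
    truncated functions converge. The witness [m] is the mean of the limit law. *)
Lemma stationary_moments (K t0 : R) :
  (forall t, t0 < t -> (\int[Pr]_w ((P t w) ^+ 4)%:E <= K%:E)%E) ->
  exists m, forall eta, 0 < eta -> exists t1, forall t, t1 < t ->
    (\int[Pr]_w ((P t w - m) ^+ 2)%:E <= (v + eta)%:E)%E /\
    `|\int[Pr]_w P t w - m| <= eta.
Proof.
move=> PK; have [d2 [W2 [Pr2 [Q [varQ limQ]]]]] := stationary_marginal.
have mQ : measurable_fun setT Q by [].
pose m := \int[Pr2]_w Q w; exists m => eta eta0.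
have mdev d3 (W3 : measurableType d3) (X : W3 -> R) n : measurable_fun setT X ->
    measurable_fun setT (fun w => (X w - m) ^+ n).
  by move=> mX; apply: measurable_funX; exact: measurable_funB.
have dev4_ge0 (x : R) : 0 <= x ^+ 4 by rewrite (exprM x 2 2) sqr_ge0.
move: varQ; rewrite varE -/m => varQ.
have iQm : Pr2.-integrable setT (EFin \o (fun w => (Q w - m) ^+ 2)).
  apply: (@integrable_ge0 _ _ _ _ _ v); first exact: mdev.
    by move=> w; exact: sqr_ge0.
  by rewrite varQ.
have [iQ _ _] := mean_square_deviation mQ iQm.
have v0 : 0 <= v.
  by rewrite -lee_fin -varQ; apply: integral_ge0 => w _; rewrite lee_fin sqr_ge0.
have QmE : \int[Pr2]_w (Q w - m) ^+ 2 = v.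
  by apply: EFin_inj; rewrite -EFin_Rintegral.
(* From [(x - m) ^ 4 <= 8 x ^ 4 + 8 m ^ 4]. *)
pose K' := 8 * K + 8 * m ^+ 4.
have dev4 t : t0 < t -> (\int[Pr]_w ((P t w - m) ^+ 4)%:E <= K'%:E)%E.
  move=> /PK PtK; have mP4 : measurable_fun setT (fun w => P t w ^+ 4).
    exact: measurable_funX.
  have iP4 := integrable_ge0 mP4 (fun w => dev4_ge0 _) PtK.
  have icst := @integrable_probability_cst _ _ _ Pr (8 * m ^+ 4).
  have iP8 := integrableZl measurableT 8 iP4.
  apply: (@le_trans _ _ (\int[Pr]_w (8 * P t w ^+ 4 + 8 * m ^+ 4)%:E)%E).
    apply: ge0_le_integral => //.
    - by move=> w _; rewrite lee_fin ?dev4_ge0 ?sqr_ge0.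
    - by apply/measurable_EFinP; exact: mdev.
    - by apply/measurable_EFinP; apply: measurable_funD => //; exact: measurable_funM.
    - move=> w _; rewrite lee_fin.
      have h1 : (P t w - m) ^+ 2 <= 2 * P t w ^+ 2 + 2 * m ^+ 2.
        by have := sqr_ge0 (P t w + m); rewrite !expr2; nra.
      have h2 := sqr_ge0 (P t w - m).
      have h3 := sqr_ge0 (P t w ^+ 2 - m ^+ 2).
      rewrite (exprM _ 2 2) (exprM (P t w) 2 2) (exprM m 2 2).
      move: h1 h2 h3; move: ((P t w - m) ^+ 2) (P t w ^+ 2) (m ^+ 2) => a b c.
      by rewrite !expr2 => h1 h2 h3; nra.
  rewrite EFin_Rintegral; last exact: (integrableD measurableT iP8 icst).
  rewrite RintegralD// RintegralZl// Rintegral_probability_cst.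
  rewrite lee_fin lerD2r ler_wpM2l// -lee_fin -EFin_Rintegral//.
have dev2 t : t0 < t -> (\int[Pr]_w ((P t w - m) ^+ 2)%:E <= (1 + K')%:E)%E.
  move=> t0t; have m4 := mdev _ _ _ 4%N (mP t).
  have i4 := integrable_ge0 m4 (fun w => dev4_ge0 _) (dev4 _ t0t).
  have icst := @integrable_probability_cst _ _ _ Pr 1.
  apply: (@le_trans _ _ (\int[Pr]_w (1 + (P t w - m) ^+ 4)%:E)%E).
    apply: ge0_le_integral => //.
    - by move=> w _; rewrite lee_fin ?dev4_ge0 ?sqr_ge0.
    - by apply/measurable_EFinP; exact: mdev.
    - by apply/measurable_EFinP; apply: measurable_funD.
    - move=> w _; rewrite lee_fin (exprM _ 2 2); move: ((P t w - m) ^+ 2) => a.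
      by have := sqr_ge0 (a - 1); rewrite !expr2; nra.
  rewrite EFin_Rintegral; last exact: (integrableD measurableT icst i4).
  rewrite RintegralD// Rintegral_probability_cst lee_fin lerD2l.
  by rewrite -lee_fin -EFin_Rintegral//; exact: dev4.
(* With this [M] the truncation errors fit into [eta / 2]: [K' / M] for the square, and for the mean
   [v / M] in the limit law plus [(1 + K') / M] at time [t]. *)
pose M := 2 * (`|K'| + v + 1) / eta.
have M0 : 0 < M by rewrite divr_gt0// mulr_gt0// ltr_wpDl// addr_ge0.
have ME : M^-1 * (`|K'| + v + 1) = eta / 2.
  rewrite /M invfM invrK mulrC mulrA invfM.
  have n0 : `|K'| + v + 1 != 0 by rewrite gt_eqF// ltr_wpDl// addr_ge0.
  by rewrite [_ * (_ * _)]mulrCA mulfV// mulr1 mulrC.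
have [ta taP] : exists t1, forall t, t1 < t ->
    (\int[Pr]_w (truncated_sqr m M (P t w))%:E < (v + eta / 2)%:E)%E.
  apply: (near_lt (limQ _ M _ _)).
  - exact: truncated_sqr_continuous.
  - by move=> x; apply: truncated_sqr_bound; exact: ltW.
  apply: (@le_lt_trans _ _ v%:E); last by rewrite lte_fin ltrDl divr_gt0.
  rewrite -varQ; apply: ge0_le_integral => //.
  - by move=> w _; rewrite lee_fin truncated_sqr_ge0// ltW.
  - apply/measurable_EFinP; apply: measurableT_comp => //.
    by apply: continuous_measurable_fun; exact: truncated_sqr_continuous.
  - by apply/measurable_EFinP; exact: mdev.
  - by move=> w _; rewrite lee_fin /truncated_sqr ge_min lexx.
have mean_near s : s = 1 \/ s = -1 -> exists t1, forall t, t1 < t ->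
    s * (\int[Pr]_w P t w - m) <= eta.
  move=> s1; have s2 : s * s = 1 by case: s1 => ->; rewrite ?mulrNN mulr1.
  have mcl d3 (W3 : measurableType d3) (X : W3 -> R) : measurable_fun setT X ->
      measurable_fun setT (fun w => clamp s m M (X w)).
    move=> mX; apply: measurableT_comp => //.
    by apply: continuous_measurable_fun; exact: clamp_continuous.
  have icl d3 (W3 : measurableType d3) (Pr3 : probability W3 R) (X : W3 -> R) :
      measurable_fun setT X ->
      Pr3.-integrable setT (EFin \o (fun w => clamp s m M (X w))).
    move=> mX.
    apply: (le_integrable measurableT _ _ (integrable_probability_cst Pr3 M)) => //.
      by apply/measurable_EFinP; exact: mcl.
    by move=> w _; rewrite lee_fin [leRHS]ger0_norm ?(ltW M0)//; exact: clamp_bound.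
  have iZ d3 (W3 : measurableType d3) (Pr3 : probability W3 R) (a : R) (X : W3 -> R) :
      Pr3.-integrable setT (EFin \o X) ->
      Pr3.-integrable setT (EFin \o (fun w => a * X w)).
    by move=> iX; exact: (integrableZl measurableT a iX).
  have iB d3 (W3 : measurableType d3) (Pr3 : probability W3 R) (X : W3 -> R) :
      Pr3.-integrable setT (EFin \o X) ->
      Pr3.-integrable setT (EFin \o (fun w => X w - m)).
    move=> iX; exact: (integrableB measurableT iX (integrable_probability_cst Pr3 m)).
  have RB d3 (W3 : measurableType d3) (Pr3 : probability W3 R) (X : W3 -> R) :
      Pr3.-integrable setT (EFin \o X) ->
      \int[Pr3]_w (s * (X w - m)) = s * (\int[Pr3]_w X w - m).
    move=> iX; rewrite RintegralZl//; last exact: iB.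
    by rewrite RintegralB// ?Rintegral_probability_cst//; exact: integrable_probability_cst.
  have [t1 t1P] : exists t1, forall t, t1 < t ->
      (\int[Pr]_w (clamp s m M (P t w))%:E < (M^-1 * v + eta / 2)%:E)%E.
    apply: (near_lt (limQ _ M _ _)).
    - exact: clamp_continuous.
    - by move=> x; exact: clamp_bound.
    rewrite EFin_Rintegral; last exact: icl.
    rewrite lte_fin (@le_lt_trans _ _ (M^-1 * v))//; last by rewrite ltrDl divr_gt0.
    rewrite -QmE -RintegralZl//.
    rewrite -[leRHS]add0r -[X in X + _](_ : \int[Pr2]_w (s * (Q w - m)) = 0); last first.
      by rewrite RB// subrr mulr0.
    rewrite -RintegralD//; [|exact/iZ/iB|exact: iZ].
    apply: le_Rintegral => //; first exact: icl.
      exact: (integrableD measurableT (iZ _ _ _ s _ (iB _ _ _ _ iQ)) (iZ _ _ _ _ _ iQm)).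
    by move=> w _; have [] := clamp_dist m (Q w) M0 s1.
  exists (Num.max t0 t1) => t; rewrite gt_max => /andP[t0t t1t].
  have m2 := mdev _ _ _ 2%N (mP t).
  have i2 := integrable_ge0 m2 (fun w => sqr_ge0 _) (dev2 _ t0t).
  have [iP _ _] := mean_square_deviation (mP t) i2.
  have R2 : \int[Pr]_w (P t w - m) ^+ 2 <= 1 + K'.
    by rewrite -lee_fin -EFin_Rintegral//; exact: dev2.
  have Rcl : \int[Pr]_w clamp s m M (P t w) <= M^-1 * v + eta / 2.
    have := t1P _ t1t; rewrite EFin_Rintegral; last exact: icl.
    by rewrite lte_fin; exact: ltW.
  rewrite -RB//.
  apply: (@le_trans _ _ (\int[Pr]_w (clamp s m M (P t w) + M^-1 * (P t w - m) ^+ 2))).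
    apply: le_Rintegral => //; first exact/iZ/iB.
      exact: (integrableD measurableT (icl _ _ _ _ (mP t)) (iZ _ _ _ _ _ i2)).
    by move=> w _; have [] := clamp_dist m (P t w) M0 s1.
  rewrite RintegralD//; [|exact: (icl _ _ _ _ (mP t))|exact: iZ].
  rewrite [X in _ + X]RintegralZl//.
  have : M^-1 * (v + (1 + K')) <= eta / 2.
    rewrite -ME ler_wpM2l ?invr_ge0 ?(ltW M0)//.
    by have := ler_norm K'; lra.
  have : M^-1 * \int[Pr]_w (P t w - m) ^+ 2 <= M^-1 * (1 + K').
    by rewrite ler_wpM2l// invr_ge0 ltW.
  move=> h1 h2; rewrite (mulrDr M^-1 v) in h2.
  rewrite (le_trans (lerD Rcl h1))//; lra.
have [tb tbP] := mean_near 1 (or_introl erefl).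
have [tc tcP] := mean_near (-1) (or_intror erefl).
exists (Num.max t0 (Num.max ta (Num.max tb tc))) => t.
rewrite !gt_max => /and4P[t0t tat tbt tct]; split; last first.
  by have := tbP _ tbt; have := tcP _ tct; rewrite ler_norml; lra.
have m4 := mdev _ _ _ 4%N (mP t).
have i4 := integrable_ge0 m4 (fun w => dev4_ge0 _) (dev4 _ t0t).
have mtr : measurable_fun setT (fun w => truncated_sqr m M (P t w)).
  apply: measurableT_comp => //.
  by apply: continuous_measurable_fun; exact: truncated_sqr_continuous.
have itr : Pr.-integrable setT (EFin \o (fun w => truncated_sqr m M (P t w))).
  apply: (le_integrable measurableT _ _ (integrable_probability_cst Pr M)) => //.
    exact/measurable_EFinP.
  move=> w _; rewrite lee_fin [leRHS]ger0_norm ?(ltW M0)//.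
  by apply: truncated_sqr_bound; exact: ltW.
have iM4 : Pr.-integrable setT (EFin \o (fun w => M^-1 * (P t w - m) ^+ 4)).
  exact: (integrableZl measurableT M^-1 i4).
apply: (@le_trans _ _
    (\int[Pr]_w (truncated_sqr m M (P t w) + M^-1 * (P t w - m) ^+ 4)%:E)%E).
  apply: ge0_le_integral => //.
  - by move=> w _; rewrite lee_fin sqr_ge0.
  - by apply/measurable_EFinP; exact: mdev.
  - apply/measurable_EFinP; apply: measurable_funD => //.
    by apply: measurable_funM => //; exact: mdev.
  (* [a <= min (a, M) + a ^ 2 / M] for the squared deviation [a]. *)
  - move=> w _; rewrite lee_fin /truncated_sqr (exprM _ 2 2).
    move: ((P t w - m) ^+ 2) (sqr_ge0 (P t w - m)) => a a0.
    have q0 : 0 <= M^-1 * a ^+ 2 by rewrite mulr_ge0 ?sqr_ge0// invr_ge0 ltW.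
    have [aM|Ma] := leP a M; first by rewrite lerDl.
    rewrite -(ler_pM2l M0) mulrDr (mulrA M M^-1) (@mulfV _ M) ?gt_eqF// mul1r.
    by have := sqr_ge0 (a - M); rewrite !expr2; nra.
rewrite EFin_Rintegral; last exact: (integrableD measurableT itr iM4).
rewrite RintegralD// RintegralZl// lee_fin.
have h1 : \int[Pr]_w truncated_sqr m M (P t w) <= v + eta / 2.
  have := taP _ tat; rewrite EFin_Rintegral// lte_fin; exact: ltW.
have h2 : \int[Pr]_w (P t w - m) ^+ 4 <= K'.
  by rewrite -lee_fin -EFin_Rintegral//; exact: dev4.
have h3 : M^-1 * \int[Pr]_w (P t w - m) ^+ 4 <= eta / 2.
  rewrite -ME ler_wpM2l ?invr_ge0 ?(ltW M0)//.
  by have := ler_norm K'; lra.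
by lra.
Qed.

End WeakLimit.

(** * Exact Scheduling *)

Definition lebesgue2 (R : realType) :
    {measure set (measurableTypeR R * measurableTypeR R)%type -> \bar R} :=
  (@lebesgue_measure R \x @lebesgue_measure R)%E.

(** * The almost sure range of the marks *)

Section MarkDomain.
Context d (Omega : measurableType d) (R : realType) (Pr : probability Omega R).
Context (J : jobs Pr) (Lambda : R) (S : set (R * R)) (f : R * R -> R).
Hypotheses (mJ : marked_poisson J Lambda f) (fS : is_density_on S f).

(** The strict inequality keeps [sigma / tau] away from division by 0; the line [sigma = 0] that it
    removes from the support is Lebesgue null. *)
Definition mark_domain (T : R) : set (R * R) :=
  [set z | 0 < z.1 /\ z.1 <= z.2 /\ z.2 <= T].

Lemma measurable_mark_domain T : measurable (mark_domain T).
Proof.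
have m1 : measurable_fun setT (fst : R * R -> R) by exact: measurable_fst.
have m2 : measurable_fun setT (snd : R * R -> R) by exact: measurable_snd.
rewrite (_ : mark_domain T = [set z | (0 : R) < z.1] `&`
  ([set z | z.1 <= z.2] `&` [set z | z.2 <= T]))//.
have c0 (c : R) : measurable_fun setT (fun _ : R * R => c) by [].
have mlt (g h : R * R -> R) : measurable_fun setT g -> measurable_fun setT h ->
    measurable [set z | g z < h z].
  move=> mg mh; have := measurable_fun_ltr mg mh.
  by move=> /(_ measurableT [set true] Logic.I); rewrite setTI.
have mle (g h : R * R -> R) : measurable_fun setT g -> measurable_fun setT h ->
    measurable [set z | g z <= h z].
  move=> mg mh; have := measurable_fun_ler mg mh.
  by move=> /(_ measurableT [set true] Logic.I); rewrite setTI.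
by apply: measurableI; [exact: mlt|apply: measurableI; exact: mle].
Qed.

Lemma support_mark_domain : exists T, 0 < T /\
  {ae lebesgue2 R, forall z, f z != 0 -> mark_domain T z}.
Proof.
have [M [Mreal MS]] := support_bounded fS.
pose T := Num.max 1 (M + 1); exists T; split; first by rewrite lt_max ltr01.
exists ([set 0] `*` setT); split.
- exact: measurableX.
- by rewrite [LHS]product_measure1E//= lebesgue_measure_set1 mul0e.
move=> [x y] /= nD; split => //=; apply: contrapT => x0; apply: nD => fz.
have Sz : S (x, y).
  by apply: contrapT => nS; move: fz; rewrite (density_support fS nS) eqxx.
have /= /andP[x_ge0 xy] := support_feasible fS Sz.
have : `|(x, y) : (R^o * R^o)%type| <= M + 1 by apply: MS => //; rewrite ltrDl.
rewrite prod_normE/= ge_max => /andP[_ yM].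
split; first by rewrite lt_neqAle x_ge0 andbT eq_sym; apply/eqP.
by split => //=; rewrite le_max (le_trans (ler_norm y) yM) orbT.
Qed.

Variables (T : R).
Hypotheses (T0 : 0 < T) (fD : {ae lebesgue2 R, forall z, f z != 0 -> mark_domain T z}).

Let mf : measurable_fun setT (EFin \o f).
Proof. by apply/measurable_EFinP; exact: density_measurable fS. Qed.

Lemma ae_mark_domain : {ae Pr, forall w, forall k, mark_domain T (mark J k w)}.
Proof.
apply: ae_foralln => k.
have mD := measurableC (measurable_mark_domain T).
exists (mark J k @^-1` (~` mark_domain T)); split => //.
  exact: measurable_mark_preimage.
rewrite [LHS](marked_law mJ)//.
transitivity (\int[lebesgue2 R]_(z in ~` mark_domain T) cst 0 z)%E; last first.
  by rewrite integral0.
apply: ge0_ae_eq_integral => //.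
- exact: measurable_funTS.
- by move=> z _; rewrite lee_fin (density_ge0 fS).
have := @filterS _ (almost_everywhere (lebesgue2 R)) (ae_filter_ringOfSetsType _) _ _ _ fD; apply => z fDz nDz; congr EFin; apply/eqP; apply: contrapT => /negP fz.
exact/nDz/fDz.
Qed.

Lemma mark_integral_density (phi : R * R -> R) :
  measurable_fun setT phi -> (forall z, 0 <= phi z) ->
  mark_integral J phi = (\int[lebesgue2 R]_z (phi z * f z)%:E)%E.
Proof.
move=> mphi phi0; pose g z := (phi z)%:E.
have mg : measurable_fun setT g by exact/measurable_EFinP.
have g0 z : (0 <= g z)%E by rewrite lee_fin.
rewrite -[LHS](@ge0_integral_distribution _ _ _ _ _ Pr (mark J 0) g)//.
have f0 z : (0 <= (EFin \o f) z)%E by rewrite lee_fin (density_ge0 fS).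
transitivity (\int[lebesgue2 R]_z (g z * (EFin \o f) z))%E; last by [].
have := @ge0_integral_density _ (measurableTypeR R * measurableTypeR R)%type R _
  (R * R)%type (lebesgue2 R) (distribution Pr (mark J 0)) id (EFin \o f) g.
apply => //.
by move=> B mB; exact: (marked_law mJ).
Qed.

(** The integrands of the theorem, such as [sigma ^ 2 / tau], are unbounded off the domain. [phi] is
    a bounded nonnegative version, equal to [psi] on the domain, which carries the density. *)
Lemma mark_meanE (psi : R -> R -> R) (phi : R * R -> R) (C : R) :
  measurable_fun setT phi -> (forall z, 0 <= phi z <= C) ->
  measurable_fun setT (fun z : R * R => psi z.1 z.2) ->
  (forall z, mark_domain T z -> phi z = psi z.1 z.2) ->
  mark_integral J phi = (mark_mean f psi)%:E.
Proof.
move=> mphi phiC mpsi phi_psi.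
have phi0 z : 0 <= phi z by have /andP[] := phiC z.
have mff := density_measurable fS.
rewrite -(fineK (mark_integral_fin J mphi phiC)); congr EFin.
rewrite mark_integral_density//; congr fine.
apply: ae_eq_integral => //.
- by apply/measurable_EFinP; exact: measurable_funM.
- by apply/measurable_EFinP; exact: measurable_funM.
have := @filterS _ (almost_everywhere (lebesgue2 R)) (ae_filter_ringOfSetsType _) _ _ _ fD; apply => z fDz _; congr EFin.
have [->|fz] := eqVneq (f z) 0; first by rewrite !mulr0.
by rewrite phi_psi//; exact: fDz.
Qed.

End MarkDomain.

(** Where the sequence diverges, [limn] returns the default [point]; convergence is the measurable
    event that upper and lower limits agree. The use is for the capacity, whose rates are
    nonnegative only almost surely, so that its series may diverge on some paths. *)
Lemma measurable_limn d (T : measurableType d) (R : realType)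
    (f : (T -> \bar R)^nat) : (forall n, measurable_fun setT (f n)) ->
  measurable_fun setT (fun x => limn (f^~ x)).
Proof.
move=> mf.
have mesup : measurable_fun setT (fun x => limn_esup (f^~ x)).
  exact: measurable_fun_limn_esup.
have meinf : measurable_fun setT (fun x => limn_einf (f^~ x)).
  rewrite (_ : (fun x => _) = (fun x => - limn_esup (-%E \o f^~ x))%E).
    apply: measurableT_comp => //; apply: measurable_fun_limn_esup => n.
    exact: measurableT_comp.
  by apply/funext => x; rewrite limn_esupN oppeK.
rewrite (_ : (fun x => _) = (fun x =>
    if limn_esup (f^~ x) == limn_einf (f^~ x) then limn_esup (f^~ x) else point)).
  by apply: measurable_fun_ifT => //; exact: measurable_fun_eqe.
apply/funext => x; have [cf|dvgf] := pselect (cvgn (f^~ x)).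
  by rewrite (is_cvg_limn_esupE cf) (is_cvg_limn_einfE cf) eqxx.
rewrite (dvgP dvgf); case: eqP => // eq_lim; exfalso; apply: dvgf.
apply/cvg_ex; exists (limn_esup (f^~ x)).
apply: (@squeeze_cvge _ _ _ _ (einfs (f^~ x)) _ (esups (f^~ x))).
- apply: nearW => n; apply/andP; split.
    by apply: ereal_inf_lbound; exists n => /=.
  by apply: ereal_sup_ubound; exists n => /=.
- by rewrite eq_lim limn_einf_lim; exact: is_cvg_einfs.
- by rewrite limn_esup_lim; exact: is_cvg_esups.
Qed.

Section Capacity.
Context d (Omega : measurableType d) (R : realType) (Pr : probability Omega R).
Context (J : jobs Pr) (r : @rate_process d Omega R) (rJ : service J r).

Lemma measurable_capacity2 :
  measurable_fun setT (fun z : R * Omega => capacity r z.1 z.2).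
Proof.
apply: (measurableT_comp (f := fine)); first exact: fine_measurable.
apply: (@measurable_limn _ _ _ (fun n (z : R * Omega) =>
  \sum_(0 <= k < n) (r k z.1 z.2)%:E)%E) => n.
apply: emeasurable_sum => k; apply/measurable_EFinP.
exact: service_measurable rJ k.
Qed.

Lemma measurable_capacity t : measurable_fun setT (capacity r t).
Proof. exact: measurable_fun_pair2 measurable_capacity2. Qed.

End Capacity.

(** * The rate of a single job under Exact Scheduling *)

Section ExactRate.
Context (R : realType).
Let mu := @lebesgue_measure R.

(* The remaining demand [x] satisfies [x' = - x / y], so [x / y] is constant
   up to the deadline. *)
Lemma exact_rate_constant (a sigma tau : R) (rho : R -> R) : 0 < tau ->
  (forall t, mu.-integrable `[a, t] (EFin \o rho)) ->
  (forall t, a <= t ->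
    rho t = exact_rate (sigma - \int[mu]_(s in `[a, t]) rho s) (a + tau - t)) ->
  forall t, a <= t -> rho t = sigma / tau * (t < a + tau)%R%:R.
Proof.
move=> tau0 irho rhoE t at_; case: ltP => [t_lt|t_ge]; last first.
  by rewrite rhoE// /exact_rate ifF ?mulr0// subr_gt0; apply/negbTE; rewrite -leNgt.
pose F s := \int[mu]_(u in `[a, s]) rho u.
pose q s := (sigma - F s) * (a + tau - s)^-1.
have y_gt0 s : s <= t -> 0 < a + tau - s by move=> st; rewrite subr_gt0 (le_lt_trans st).
have rho_q s : a <= s -> s <= t -> rho s = q s.
  by move=> as_ st; rewrite rhoE// /exact_rate y_gt0.
have Fa : F a = 0 by rewrite /F set_itv1 Rintegral_set1.
have qa : q a = sigma / tau by rewrite /q Fa subr0 addrAC subrr add0r.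
rewrite mulr1 rho_q// -qa; move: at_; rewrite le_eqVlt => /predU1P[<-//|a_t].
have cF : {within `[a, t], continuous F}.
  by apply: parameterized_integral_continuous => //; exact: ltW.
have cF_in s : s \in `]a, t[ -> {for s, continuous F}.
  by move=> s_at; exact: (within_continuous_continuous a_t cF s_at).
have cy s : s <= t -> {for s, continuous (fun s => (a + tau - s)^-1)}.
  move=> st; apply: cvgV; first by rewrite gt_eqF// y_gt0.
  by apply: cvgB; [exact: cvg_cst|exact: cvg_id].
(* A bootstrap: [rho] is only integrable, but its integral [F] is continuous, hence so is [q], which
   equals [rho] before the deadline; then [F] is differentiable with derivative [rho]. *)
have crho s : s \in `]a, t[ -> {for s, continuous rho}.
  move=> s_at; have /andP[as_ st] : a < s < t by move: s_at; rewrite in_itv.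
  have cq : {for s, continuous q}.
    apply: cvgM; last exact: cy (ltW st).
    by apply: cvgB; [exact: cvg_cst|exact: cF_in].
  rewrite /prop_for /continuous_at rho_q ?ltW//; apply: cvg_trans cq.
  apply: near_eq_cvg; near=> u; rewrite -rho_q//; apply/ltW.
  - by near: u; exact: lt_nbhsr.
  - by near: u; exact: lt_nbhsl.
(* With [y] the remaining time, [q' = (q - rho) / y = 0]. *)
have dq s : s \in `]a, t[ -> is_derive s 1 q (cst 0 s).
  move=> s_at; have /andP[as_ st] : a < s < t by move: s_at; rewrite in_itv.
  have [dF F'] := continuous_FTC1_closed st (irho t) as_ (crho s s_at).
  have dF1 : is_derive s 1 F (rho s) by apply: (DeriveDef dF); rewrite -derive1E; exact: F'.
  have yn0 : a + tau - s != 0 by rewrite gt_eqF// y_gt0// ltW.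
  pose N := cst sigma - F; pose Y := cst (a + tau) - id.
  have dN : is_derive s 1 N (0 - rho s) by exact: is_deriveB.
  have dY : is_derive s 1 Y (0 - 1) by exact: is_deriveB.
  have dY1 : derivable Y s 1 := @ex_derive _ _ _ _ _ _ _ dY.
  have dV : is_derive s 1 (fun u => (Y u)^-1) (- (Y s) ^- 2 *: (0 - 1)).
    have Yn0 : Y s != 0 by exact: yn0.
    have dYV : derivable (fun u => (Y u)^-1) s 1 by exact: (derivableV Yn0 dY1).
    have YE := @derive_val _ _ _ _ _ _ _ dY.
    apply: (DeriveDef dYV).
    by rewrite -YE; exact: (deriveV Yn0 dY1).
  apply: (is_derive_eq (is_deriveM dN dV)).
  rewrite rho_q ?(ltW as_) ?(ltW st)// /q /N /Y !fctE /=.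
  rewrite /GRing.scale/=; field.
  exact: yn0.
have cq : {within `[a, t], continuous q}.
  have /(continuous_within_itvP _ a_t)[cFi cFa cFt] := cF.
  apply/(continuous_within_itvP _ a_t); split.
  - move=> s s_at; have /andP[as_ st] : a < s < t by move: s_at; rewrite in_itv.
    apply: cvgM; last exact: cy (ltW st).
    by apply: cvgB; [exact: cvg_cst|exact: cF_in].
  - apply: cvgM; last by apply: cvg_at_right_filter; exact: cy (ltW a_t).
    by apply: cvgB; [exact: cvg_cst|exact: cFa].
  - apply: cvgM; last by apply: cvg_at_left_filter; exact: cy.
    by apply: cvgB; [exact: cvg_cst|exact: cFt].
have [c _] := MVT a_t dq cq.
by rewrite /= mul0r => /eqP; rewrite subr_eq0 => /eqP.
Unshelve. all: by end_near. Qed.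

End ExactRate.

Section ExactScheduling.
Context d (Omega : measurableType d) (R : realType) (Pr : probability Omega R).
Context (J : jobs Pr) (Lambda : R) (S : set (R * R)) (f : R * R -> R).
Hypotheses (L0 : 0 < Lambda) (mJ : marked_poisson J Lambda f) (fS : is_density_on S f).
Context (T : R).
Hypotheses (T0 : 0 < T)
  (fD : {ae lebesgue2 R, forall z, f z != 0 -> mark_domain T z}).

(* Set to [0] outside [mark_domain T], so that it is bounded. *)
Definition on_domain (phi : R * R -> R) (z : R * R) : R := phi z * \1_(mark_domain T) z.

Lemma measurable_on_domain phi : measurable_fun setT phi ->
  measurable_fun setT (on_domain phi).
Proof.
move=> mphi; apply: measurable_funM => //.
by apply: measurable_indic; exact: measurable_mark_domain.
Qed.

Lemma on_domainE phi z : mark_domain T z -> on_domain phi z = phi z.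
Proof. by move=> zD; rewrite /on_domain indicE mem_set// mulr1. Qed.

Lemma on_domain_out phi z : ~ mark_domain T z -> on_domain phi z = 0.
Proof. by move=> zD; rewrite /on_domain indicE memNset// mulr0. Qed.

Lemma on_domain_bounds phi C : 0 <= C ->
  (forall z, mark_domain T z -> 0 <= phi z <= C) -> forall z, 0 <= on_domain phi z <= C.
Proof.
move=> C0 phiC z; have [zD|zD] := pselect (mark_domain T z).
  by rewrite on_domainE//; exact: phiC.
by rewrite on_domain_out// lexx.
Qed.

Lemma on_domain_support phi z : on_domain phi z != 0 -> 0 <= z.2 <= T.
Proof.
have [[z1 [z12 z2T]]|zD] := pselect (mark_domain T z); last first.
  by rewrite on_domain_out// eqxx.
by move=> _; rewrite (le_trans (ltW z1) z12).
Qed.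

Lemma measurable_inv : measurable_fun setT (@GRing.inv R).
Proof.
rewrite -(setvU [set 0 : R]) measurable_funU//; last exact: measurableC.
split; last exact: measurable_fun_set1.
apply: open_continuous_measurable_fun.
  by apply: closed_openC; exact: closed_eq.
move=> x /set_mem/= x0; apply: inv_continuous; exact/eqP.
Qed.

Definition slope (z : R * R) : R := z.1 / z.2.

Lemma measurable_slope : measurable_fun setT slope.
Proof.
apply: measurable_funM; first exact: measurable_fst.
exact: (measurableT_comp measurable_inv).
Qed.

Lemma slope_bounds z : mark_domain T z -> 0 <= slope z <= 1.
Proof.
move=> [z1 [z12 _]]; have z2 : 0 < z.2 := lt_le_trans z1 z12.
rewrite /slope; apply/andP; split; first by rewrite divr_ge0// ltW.
by rewrite ler_pdivrMr// mul1r.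
Qed.

Variable r : @rate_process d Omega R.
Hypothesis er : exact_scheduling J r.

Lemma exact_rates : {ae Pr, forall w, forall k t,
  r k t w = on_domain slope (mark J k w) * active J k t w}.
Proof.
have [[_ r_int r_before] r_law] := er.
have r_bl : {ae Pr, forall w, (forall k t, t < arrival J k w -> r k t w = 0) /\
    forall k t, arrival J k w <= t -> r k t w =
      exact_rate (remaining_demand J r k t w) (remaining_time J k t w)}.
  by apply: filterS2 r_before r_law => w.
apply: filterS3 (ae_mark_domain mJ fS fD) r_int r_bl => w wD w_int [w_before w_law] k t.
have [s0 [st _]] := wD k.
have tau0 : 0 < sojourn J k w := lt_le_trans s0 st.
rewrite /active; have [at_|ta] := leP (arrival J k w) t; last first.
  by rewrite mulr0; exact: w_before.
rewrite on_domainE//=.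
exact: (@exact_rate_constant _ _ _ _ ((r k)^~ w) tau0 (w_int k) (w_law k) t at_).
Qed.

Lemma exact_capacity t : {ae Pr, forall w,
  capacity r t w = fine (shot_noise J (on_domain slope) t w)}.
Proof.
apply: filterS exact_rates => w wr; congr fine.
by apply: eq_eseriesr => k _; rewrite wr.
Qed.

Let gC : forall z, 0 <= on_domain slope z <= 1.
Proof. exact: on_domain_bounds ler01 slope_bounds. Qed.

Let mg : measurable_fun setT (on_domain slope).
Proof. exact: measurable_on_domain measurable_slope. Qed.

Let meanA : mark_integral J (fun z => on_domain slope z ^+ 2 * z.2) =
  (mark_mean f (fun sigma tau => sigma ^+ 2 / tau))%:E.
Proof.
have m2 : measurable_fun setT (snd : R * R -> R) by exact: measurable_snd.
have m1 : measurable_fun setT (fst : R * R -> R) by exact: measurable_fst.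
apply: (mark_meanE mJ fS fD (C := T)).
- by apply: measurable_funM => //; exact: measurable_funX.
- move=> z; have [gz|gz] := eqVneq (on_domain slope z) 0.
    by rewrite gz expr0n mul0r lexx ltW.
  have /andP[z0 zT] := on_domain_support gz; have /andP[g0 g1] := gC z.
  rewrite mulr_ge0 ?sqr_ge0//= -[leRHS]mul1r ler_pM ?sqr_ge0//.
  by rewrite expr_le1.
- apply: measurable_funM; first exact: measurable_funX.
  exact: (measurableT_comp measurable_inv).
- move=> z zD; rewrite on_domainE// /slope.
  have [z1 [z12 _]] := zD; have z2 : z.2 != 0 by rewrite gt_eqF// (lt_le_trans z1).
  by field.
Qed.

Let meanB : mark_integral J (fun z => on_domain slope z * z.2) =
  (mark_mean f (fun sigma tau => sigma))%:E.
Proof.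
have m2 : measurable_fun setT (snd : R * R -> R) by exact: measurable_snd.
apply: (mark_meanE mJ fS fD (C := T)).
- exact: measurable_funM.
- move=> z; have [gz|gz] := eqVneq (on_domain slope z) 0.
    by rewrite gz mul0r lexx ltW.
  have /andP[z0 zT] := on_domain_support gz; have /andP[g0 g1] := gC z.
  by rewrite mulr_ge0//= -[leRHS]mul1r ler_pM.
- exact: measurable_fst.
- move=> z zD; rewrite on_domainE// /slope.
  have [z1 [z12 _]] := zD; have z2 : z.2 != 0 by rewrite gt_eqF// (lt_le_trans z1).
  by field.
Qed.

(** The second moment is at most [Lambda A + c ^ 2] and the mean at least [c = Lambda B]; as
    [c >= 0], expanding the square around [c] leaves [Lambda A]. *)
Lemma exact_variance_le VarP : stationary_variance Pr (capacity r) VarP ->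
  VarP <= Lambda * mark_mean f (fun sigma tau => sigma ^+ 2 / tau).
Proof.
move=> PV; set A := mark_mean f _.
pose B := mark_mean f (fun sigma tau => sigma).
apply: (@stationary_variance_le _ _ _ _ _ _ (measurable_capacity er.1) PV (Lambda * B) _ T) => t Tt.
pose X := shot_noise J (on_domain slope) t.
have mX : measurable_fun setT X by exact: measurable_shot_noise.
have X0 w : (0 <= X w)%E by apply: shot_noise_ge0; exact: gC.
have XX : (\int[Pr]_w (X w * X w) <= (Lambda * A + (Lambda * B) ^+ 2)%:E)%E.
  exact: (shot_noise_sqr_le L0 mJ mg gC T0 (@on_domain_support _) Tt meanA meanB).
have XB : ((Lambda * B)%:E <= \int[Pr]_w X w)%E.
  exact: (shot_noise_mean_ge L0 mJ mg gC T0 (@on_domain_support _) Tt meanB).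
pose Y w := fine (X w).
have mY : measurable_fun setT Y by exact: measurableT_comp.
have Y0 w : 0 <= Y w by rewrite fine_ge0.
(* Finitely many jobs have arrived by [t], so the sum is almost surely finite and [fine] loses
   nothing. *)
have XY : {ae Pr, forall w, X w = (Y w)%:E}.
  apply: filterS (ae_arrivals_unbounded L0 (marked_arrivals mJ)) => w /(_ t)[K aK].
  rewrite /Y fineK// /X /shot_noise (@nneseries_split _ _ 0 K)/=; last first.
    by move=> k _; rewrite lee_fin mulr_ge0//; have /andP[] := gC (mark J k w).
  rewrite add0n [X in _ + X]eseries0 ?adde0; last first.
    by move=> k Kk _; rewrite /active [X in X && _]leNgt aK// mulr0.
  by rewrite sumEFin.
have YY : (\int[Pr]_w (Y w ^+ 2)%:E <= (Lambda * A + (Lambda * B) ^+ 2)%:E)%E.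
  apply: le_trans XX; apply: ae_ge0_le_integral => //.
  - by move=> w _; rewrite lee_fin sqr_ge0.
  - by apply/measurable_EFinP; exact: measurable_funX.
  - by move=> w _; exact: mule_ge0.
  - exact: emeasurable_funM.
  - by apply: filterS XY => w -> _; rewrite -EFinM expr2.
have iY2 : Pr.-integrable setT (EFin \o (fun w => Y w ^+ 2)).
  by apply: (integrable_ge0 _ _ YY) => [|w]; [exact: measurable_funX|exact: sqr_ge0].
have iY := integrable_sqr mY iY2.
have RB : Lambda * B <= \int[Pr]_w Y w.
  rewrite -lee_fin -EFin_Rintegral//; apply: le_trans XB _.
  apply: ae_ge0_le_integral => //.
  - by move=> w _; rewrite lee_fin.
  - exact/measurable_EFinP.
  - by apply: filterS XY => w -> _.
have RY2 : \int[Pr]_w Y w ^+ 2 <= Lambda * A + (Lambda * B) ^+ 2.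
  by rewrite -lee_fin -EFin_Rintegral.
set c := Lambda * B in RB RY2 *.
have c0 : 0 <= c.
  apply: mulr_ge0; first exact: ltW.
  rewrite -lee_fin -meanB; apply: mark_integral_ge0 => z.
  have [gz|gz] := eqVneq (on_domain slope z) 0; first by rewrite gz mul0r.
  have /andP[z0 zT] := on_domain_support gz; have /andP[g0 g1] := gC z.
  exact: mulr_ge0.
rewrite (ge0_ae_eq_integral (g := fun w => ((Y w - c) ^+ 2)%:E))//; last 5 first.
- apply/measurable_EFinP; apply: measurable_funX; apply: measurable_funB => //.
  exact: measurable_capacity er.1 t.
- by apply/measurable_EFinP; apply: measurable_funX; exact: measurable_funB.
- by move=> w _; rewrite lee_fin sqr_ge0.
- by move=> w _; rewrite lee_fin sqr_ge0.
- by apply: filterS (exact_capacity t) => w -> _.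
have icst := integrable_probability_cst Pr (c ^+ 2).
have iZ : Pr.-integrable setT (EFin \o (fun w => - (2 * c) * Y w)).
  exact: (integrableZl measurableT _ iY).
have iS := integrableD measurableT iZ icst.
have E : (fun w => ((Y w - c) ^+ 2)) = (fun w => Y w ^+ 2 + (- (2 * c) * Y w + c ^+ 2)).
  by apply/funext => w; ring.
rewrite EFin_Rintegral E; last exact: (integrableD measurableT iY2 iS).
rewrite RintegralD// RintegralD// RintegralZl// Rintegral_probability_cst lee_fin.
by move: RB RY2; rewrite !expr2; nra.
Qed.

End ExactScheduling.

(** * Work under a feasible policy *)

Section ServedPath.
Context (R : realType).
Let mu := @lebesgue_measure R.

(** Before the arrival and after the deadline the difference is 0: nothing, respectively everything,
    has been served, since the rate vanishes outside the window and its total is [sigma].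
    Integrating over []0, t]] rather than from [a] gives all jobs the same domain and is right
    because [0 < a]. *)
Lemma rate_served (a sigma tau t : R) (rho : R -> R) : 0 < a ->
  measurable_fun setT rho ->
  (forall u, 0 <= rho u <= (a <= u < a + tau)%R%:R) ->
  (\int[mu]_(u in `[a, +oo[) (rho u)%:E = sigma%:E)%E ->
  let served := (\int[mu]_u (rho u * \1_`]0, t] u)%:E)%E in
  served \is a fin_num /\
  0 <= sigma * \1_`]0, t] a - fine served <= sigma * (a <= t < a + tau)%R%:R.
Proof.
move=> a0 mrho rho01 rho_sigma I.
have rho0 u : 0 <= rho u by have /andP[] := rho01 u.
have rho_out u : ~~ (a <= u < a + tau) -> rho u = 0.
  by move=> /negbTE uN; apply/le_anti; have := rho01 u; rewrite uN andbC.
have mI : measurable_fun setT (fun u => (rho u * \1_`]0, t] u)%:E).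
  by apply/measurable_EFinP; apply: measurable_funM => //; exact: measurable_indic.
have total : (\int[mu]_u (rho u)%:E = sigma%:E)%E.
  rewrite -rho_sigma [RHS]integral_mkcond; apply: eq_integral => u _.
  rewrite patchE; case: ifPn => //; rewrite notin_setE/= in_itv/= andbT => /negP au.
  by rewrite rho_out// (negbTE au).
have I0 : (0 <= I)%E by apply: integral_ge0 => u _; rewrite lee_fin mulr_ge0.
have I_le : (I <= sigma%:E)%E.
  rewrite -total; apply: ge0_le_integral => //.
  - by move=> u _; rewrite lee_fin mulr_ge0.
  - exact/measurable_EFinP.
  - by move=> u _; rewrite lee_fin ler_piMr// indicE lern1 leq_b1.
have If : I \is a fin_num by rewrite ge0_fin_numE// (le_lt_trans I_le) ?ltry.
have fI0 : 0 <= fine I by exact: fine_ge0.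
have fI_le : fine I <= sigma by rewrite -lee_fin fineK.
split=> //; have [at_|ta] := leP a t; last first.
  have -> : \1_`]0, t] a = 0 :> R.
    by rewrite indicE memNset//= in_itv/= a0 leNgt ta.
  rewrite !mulr0 sub0r.
  suff -> : I = 0%E by rewrite /= oppr0 lexx.
  apply: integral0_eq => u _; congr EFin; rewrite indicE.
  have [|] := boolP (u \in _); last by rewrite mulr0.
  rewrite inE/= in_itv/= => /andP[_ ut]; rewrite rho_out ?mul0r//.
  by rewrite leNgt (le_lt_trans ut ta).
rewrite indicE mem_set/= ?in_itv/= ?a0// mulr1 subr_ge0 fI_le/=.
have [tlt|tge] := ltP t (a + tau); first by rewrite mulr1 gerBl.
suff -> : I = sigma%:E by rewrite /= subrr mulr0.
rewrite -total; apply: eq_integral => u _; congr EFin; rewrite indicE.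
have [|] := boolP (u \in _); first by rewrite mulr1.
rewrite notin_setE/= in_itv/= => uN; rewrite mulr0 rho_out//; apply/negP => /andP[au ut].
by apply: uN; rewrite (lt_le_trans a0 au) (le_trans (ltW ut)).
Qed.

End ServedPath.

Section RegularPaths.
Context d (Omega : measurableType d) (R : realType) (Pr : probability Omega R).
Context (J : jobs Pr) (Lambda : R) (S : set (R * R)) (f : R * R -> R).
Hypotheses (L0 : 0 < Lambda) (mJ : marked_poisson J Lambda f) (fS : is_density_on S f).
Context (T : R).
Hypotheses (T0 : 0 < T)
  (fD : {ae lebesgue2 R, forall z, f z != 0 -> mark_domain T z}).
Variable r : @rate_process d Omega R.
Hypotheses (rJ : service J r) (rf : feasible J r).
Let mu := @lebesgue_measure R.

(** The almost sure properties gathered once, so that the bookkeeping of work is done path by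
    path. *)
Definition regular_path (w : Omega) : Prop :=
  [/\ forall t, exists K, forall k, (K <= k)%N -> t < arrival J k w,
      forall k, 0 < arrival J k w,
      forall k, mark_domain T (mark J k w),
      forall k t, 0 <= r k t w <= active J k t w
    & forall k, (\int[mu]_(t in `[arrival J k w, +oo[) (r k t w)%:E
        = (demand J k w)%:E)%E].

Lemma ae_regular_path : {ae Pr, forall w, regular_path w}.
Proof.
have [r1 r_demand r_deadline] := rf.
have rb : {ae Pr, forall w, forall k t, 0 <= r k t w <= active J k t w}.
  by apply: filterS2 r1 r_deadline => w w1 w2 k t; have /andP[-> _] := w1 k t; exact: w2.
have ap : {ae Pr, forall w, (forall t, exists K, forall k, (K <= k)%N -> t < arrival J k w) /\
    forall k, 0 < arrival J k w}.
  apply: filterS2 (ae_arrivals_unbounded L0 (marked_arrivals mJ))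
    (arrivals_ordered (marked_arrivals mJ)) => w w1 w2; split=> // k.
  by have /andP[] := w2 k.
have bd : {ae Pr, forall w, (forall k t, 0 <= r k t w <= active J k t w) /\
    forall k, mark_domain T (mark J k w)}.
  by apply: filterS2 rb (ae_mark_domain mJ fS fD).
by apply: filterS3 ap bd r_demand => w [w1 w2] [w3 w4] w5.
Qed.

Lemma capacity_finite w t K : regular_path w ->
  (forall k, (K <= k)%N -> t < arrival J k w) ->
  forall u, u <= t -> capacity r u w = \sum_(k < K) r k u w.
Proof.
move=> [_ _ _ rb _] aK u ut; rewrite /capacity (@nneseries_split _ _ 0 K)/=; last first.
  by move=> k _; rewrite lee_fin; have /andP[] := rb k u.
rewrite add0n [X in (_ + X)%E]eseries0 ?adde0; last first.
  move=> k Kk _; have := rb k u; rewrite /active [arrival J k w <= u]leNgt (le_lt_trans ut (aK k Kk))/=.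
  by move=> h; congr EFin; apply/le_anti; rewrite andbC.
by rewrite sumEFin big_mkord.
Qed.

Lemma capacity_ge0 w t : regular_path w -> 0 <= capacity r t w.
Proof.
move=> wr; have [w1 _ _ rb _] := wr; have [K aK] := w1 t.
by rewrite (capacity_finite wr aK)// sumr_ge0// => k _; have /andP[] := rb k t.
Qed.

(** Each rate is at most 1, and a job active at [u] has arrived in []u - T, u]]. *)
Lemma capacity_le_arrivals w s t u : regular_path w -> s <= u -> u <= t ->
  ((capacity r u w)%:E <= arrivals_in J (s - T) t w)%E.
Proof.
move=> wr su ut; have [w1 _ wD rb _] := wr; have [K aK] := w1 t.
rewrite arrivals_in_compound (compound_finite _ _ aK)// lee_fin.
rewrite (capacity_finite wr aK)//; apply: ler_sum => k _.
have /andP[_ /le_trans->//] := rb k u; rewrite /active mul1r indicE ler_nat.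
case: (boolP (_ && _)) => //= /andP[au ua]; rewrite lt0b mem_set//= in_itv/=.
have [_ [_ tT]] := wD k; rewrite (le_trans au ut) andbT.
have : arrival J k w + sojourn J k w <= arrival J k w + T by rewrite lerD2l.
by move=> h; have := lt_le_trans ua h; lra.
Qed.

(** The absolute value makes the integrand nonnegative on every path, so that Tonelli applies
    without care for null sets; on regular paths it changes nothing. *)
Definition served (s t : R) (w : Omega) : \bar R :=
  (\int[mu]_u (`|capacity r u w| * \1_`]s, t] u)%:E)%E.

Lemma served_ge0 s t w : (0 <= served s t w)%E.
Proof. by apply: integral_ge0 => u _; rewrite lee_fin mulr_ge0. Qed.

Lemma measurable_served_term s t : measurable_fun setT (fun z : R * Omega =>
  (`|capacity r z.1 z.2| * \1_`]s, t] z.1)%:E).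
Proof.
apply/measurable_EFinP; apply: measurable_funM.
  by apply: measurableT_comp => //; exact: measurable_capacity2 rJ.
have mi : measurable_fun setT (\1_`]s, t] : R -> R) by exact: measurable_indic.
exact: (measurableT_comp mi).
Qed.

Lemma measurable_served s t : measurable_fun setT (served s t).
Proof.
apply: (@measurable_fun_fubini_tonelli_G _ _ _ _ _ mu
  (fun z : R * Omega => (`|capacity r z.1 z.2| * \1_`]s, t] z.1)%:E)).
- exact: measurable_served_term.
- by move=> z; rewrite lee_fin mulr_ge0.
Qed.

Lemma served_cat s t u w : s <= t -> t <= u -> served s u w = (served s t w + served t u w)%E.
Proof.
move=> st tu.
have cat_indic (x : R) : \1_`]s, u] x = \1_`]s, t] x + \1_`]t, u] x :> R.
  rewrite !indicE -natrD; congr _%:R; rewrite !mem_setE !in_itv/=.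
  by have [sx|sx] := ltP s x; have [tx|tx] := leP x t; have [ux|ux] := leP x u => //=;
     exfalso; lra.
rewrite /served -ge0_integralD//.
- by apply: eq_integral => x _; rewrite -EFinD -mulrDr cat_indic.
- exact: measurable_fun_pair1 (measurable_served_term s t).
- exact: measurable_fun_pair1 (measurable_served_term t u).
Qed.

Lemma served_le_arrivals w s t : regular_path w -> s <= t ->
  (served s t w <= (t - s)%:E * arrivals_in J (s - T) t w)%E.
Proof.
move=> wr st; have [w1 _ _ _ _] := wr; have [K aK] := w1 t.
have EN : arrivals_in J (s - T) t w = (fine (arrivals_in J (s - T) t w))%:E.
  by rewrite arrivals_in_compound (compound_finite _ _ aK).
rewrite EN; set n := fine _.
have n0 : 0 <= n by rewrite fine_ge0// arrivals_in_ge0.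
apply: (@le_trans _ _ (\int[mu]_(u in `]s, t]) n%:E)%E).
  rewrite [leRHS]integral_mkcond; apply: ge0_le_integral => //.
  - exact: measurable_fun_pair1 (measurable_served_term s t).
  - by apply/(measurable_restrictT _ _).1 => //; exact: measurable_cst.
  - move=> u _; rewrite patchE indicE; case: ifPn => [|_]; last by rewrite mulr0.
    rewrite inE/= in_itv/= => /andP[su ut]; rewrite mulr1 ger0_norm ?capacity_ge0//.
    by rewrite -EN; apply: capacity_le_arrivals => //; exact: ltW.
rewrite integral_cst//= lebesgue_measure_itv/= lte_fin.
by case: ltgtP st => // [st _|-> _]; rewrite ?subrr ?mule0 ?mul0e// -!EFinB muleC.
Qed.

End RegularPaths.

Section FineIntegral.
Context d (Omega : measurableType d) (R : realType) (Pr : probability Omega R).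

Lemma ae_fine_integrable (U : Omega -> \bar R) (K : R) : measurable_fun setT U ->
  (forall w, (0 <= U w)%E) -> {ae Pr, forall w, U w \is a fin_num} ->
  (\int[Pr]_w U w <= K%:E)%E ->
  Pr.-integrable setT (EFin \o (fun w => fine (U w))) /\
  (\int[Pr]_w U w = (\int[Pr]_w fine (U w))%:E)%E.
Proof.
move=> mU U0 Uf UK.
have mfU : measurable_fun setT (fun w => fine (U w)).
  exact: measurableT_comp.
have E : (\int[Pr]_w U w = \int[Pr]_w (fine (U w))%:E)%E.
  apply: ge0_ae_eq_integral => //.
  - exact/measurable_EFinP.
  - by move=> w _; rewrite lee_fin fine_ge0.
  - by apply: filterS Uf => w wf _; rewrite fineK.
have iU : Pr.-integrable setT (EFin \o (fun w => fine (U w))).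
  by apply: (integrable_ge0 mfU (K := K)) => [w|]; rewrite ?fine_ge0// -E.
by split=> //; rewrite E EFin_Rintegral.
Qed.

Lemma fine_uncorrelated (U V : Omega -> \bar R) (K L : R) :
  measurable_fun setT U -> measurable_fun setT V ->
  (forall w, (0 <= U w)%E) -> (forall w, (0 <= V w)%E) ->
  {ae Pr, forall w, U w \is a fin_num} -> {ae Pr, forall w, V w \is a fin_num} ->
  (\int[Pr]_w U w <= K%:E)%E -> (\int[Pr]_w V w <= L%:E)%E ->
  (\int[Pr]_w (U w * V w) = \int[Pr]_w U w * \int[Pr]_w V w)%E ->
  Pr.-integrable setT (EFin \o (fun w => fine (U w) * fine (V w))) /\
  \int[Pr]_w (fine (U w) * fine (V w)) =
    \int[Pr]_w fine (U w) * \int[Pr]_w fine (V w).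
Proof.
move=> mU mV U0 V0 Uf Vf UK VL UV.
have [_ EU] := ae_fine_integrable mU U0 Uf UK.
have [_ EV] := ae_fine_integrable mV V0 Vf VL.
have UV0 w : (0 <= U w * V w)%E by exact: mule_ge0.
have UVf : {ae Pr, forall w, (U w * V w)%E \is a fin_num}.
  by apply: filterS2 Uf Vf => w Uw Vw; rewrite fin_numM.
rewrite EU EV -EFinM in UV.
have UV_le : (\int[Pr]_w (U w * V w) <=
  (\int[Pr]_w fine (U w) * \int[Pr]_w fine (V w))%:E)%E by rewrite UV.
have [i E] := ae_fine_integrable (emeasurable_funM mU mV) UV0 UVf UV_le.
(* Valid on infinite values too: [fine] sends [+oo] to 0, and 0 times [+oo] is 0. *)
have ME : (fun w => fine (U w) * fine (V w)) = (fun w => fine (U w * V w)).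
  apply/funext => w; case: (U w) (V w) (U0 w) (V0 w) => [x| |] [y| |]//=.
  - rewrite lee_fin le_eqVlt => /predU1P[<-|x0] _; first by rewrite mul0e mulr0.
    by rewrite gt0_muley ?lte_fin// mulr0.
  - move=> _; rewrite lee_fin le_eqVlt => /predU1P[<-|y0]; first by rewrite mule0 mul0r.
    by rewrite gt0_mulye ?lte_fin// mul0r.
  - by move=> _ _; rewrite mul0r.
by rewrite ME; split=> //; apply: EFin_inj; rewrite -E.
Qed.

End FineIntegral.

(** * Capacity and past service against later inflow *)

Section Nonanticipation.
Context d (Omega : measurableType d) (R : realType) (Pr : probability Omega R).
Context (J : jobs Pr) (Lambda : R) (f : R * R -> R).
Hypotheses (L0 : 0 < Lambda) (mJ : marked_poisson J Lambda f).
Variable r : @rate_process d Omega R.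
Hypothesis rc : centralized J r.
Let rJ : service J r := centralized_service rc.
Let mu := @lebesgue_measure R.

Let measurable_before t : measurable [set z : R * (R * R) | z.1 <= t].
Proof.
rewrite -[X in measurable X]setTI.
have -> : [set z : R * (R * R) | z.1 <= t] = fst @^-1` `]-oo, t].
  by apply/seteqP; split=> z /=; rewrite in_itv.
exact: measurable_fst.
Qed.

Lemma history_subset s t : s <= t -> history J s `<=` history J t.
Proof.
move=> st; pose GT : measurableType _ := g_sigma_algebraType
  [set E | exists k (B : set (R * (R * R))), measurable B /\
        E = [set w | arrival J k w <= t /\ B (arrival J k w, mark J k w)]].
apply: smallest_sub; first exact: (smallest_sigma_algebra _ _).
move=> _ [k [B [mB ->]]]; apply: sub_sigma_algebra.
exists k, (B `&` [set z | z.1 <= s]); split.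
  exact: measurableI mB (measurable_before s).
apply/seteqP; split=> w /= [h1 h2]; first by split=> //; exact: le_trans h1 st.
by case: h2.
Qed.

Lemma measurable_history t : history J t `<=` measurable.
Proof.
apply: smallest_sub; first exact: sigma_algebra_measurable.
move=> _ [k [B [mB ->]]].
have -> : [set w | arrival J k w <= t /\ B (arrival J k w, mark J k w)] =
    (fun w => (arrival J k w, mark J k w)) @^-1` (B `&` [set z | z.1 <= t]).
  by apply/seteqP; split=> w /= [].
have mp : measurable_fun setT (fun w => (arrival J k w, mark J k w)).
  by apply: measurable_fun_pair => //; exact: measurable_mark.
rewrite -[X in measurable X]setTI; apply: mp => //.
exact: measurableI mB (measurable_before t).
Qed.

(** Each rate agrees almost surely with a history measurable variable, and countable sums preserve
    this. *)
Lemma adapted_capacity t : exists rho : Omega -> R,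
  (forall B, measurable B -> history J t (rho @^-1` B)) /\
  {ae Pr, forall w, `|capacity r t w| = rho w}.
Proof.
have [rho rhoP] := choice (fun k => nonanticipative rc k t).
exists (fun w => `|fine (\sum_(0 <= k <oo) (rho k w)%:E)%E|); split; last first.
  have : {ae Pr, forall w, forall k, r k t w = rho k w}.
    by apply: ae_foralln => k; have [_] := rhoP k.
  by apply: filterS => w wr; congr `|fine _|; apply: eq_eseriesr => k _; rewrite wr.
pose GT : measurableType _ := g_sigma_algebraType
  [set E | exists k (B : set (R * (R * R))), measurable B /\
        E = [set w | arrival J k w <= t /\ B (arrival J k w, mark J k w)]].
have mrho k : measurable_fun setT (rho k : GT -> R).
  by move=> _ B mB; rewrite setTI; have [h _] := rhoP k; exact: h.
have m : measurable_fun setT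
    ((fun w => `|fine (\sum_(0 <= k <oo) (rho k w)%:E)%E|) : GT -> R).
  apply: measurableT_comp => //.
  apply: (measurableT_comp (f := fine)); first exact: fine_measurable.
  apply: (@measurable_limn _ _ _ (fun n (w : GT) => \sum_(0 <= k < n) (rho k w)%:E)%E) => n.
  by apply: emeasurable_sum => k; apply/measurable_EFinP.
by move=> B mB; have := m measurableT B mB; rewrite setTI.
Qed.

Lemma capacity_uncorrelated (phi : R * R -> R) (u t t' : R) : u <= t -> 0 < t -> t < t' ->
  measurable_fun setT phi -> (forall z, 0 <= phi z) -> (mark_integral J phi < +oo)%E ->
  (\int[Pr]_w ((`|capacity r u w|)%:E * compound J phi t t' w) =
   \int[Pr]_w (`|capacity r u w|)%:E * \int[Pr]_w compound J phi t t' w)%E.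
Proof.
move=> ut t0 tt' mphi phi0 phioo; have [rho [rhoH rhoE]] := adapted_capacity u.
have mrho : measurable_fun setT rho.
  by move=> _ B mB; rewrite setTI; apply: (@measurable_history u); exact: rhoH.
have mcap : measurable_fun setT (fun w => (`|capacity r u w|)%:E).
  apply/measurable_EFinP; apply: measurableT_comp => //; exact: (measurable_capacity rJ u).
have mC : measurable_fun setT (compound J phi t t') by exact: measurable_compound.
have C0 w : (0 <= compound J phi t t' w)%E by exact: compound_ge0.
have rho_norm : {ae Pr, forall w, (`|capacity r u w|)%:E = (`|rho w|)%:E}.
  by apply: filterS rhoE => w <-; rewrite normr_id.
have mr : measurable_fun setT (fun w => (`|rho w|)%:E).
  by apply/measurable_EFinP; exact: measurableT_comp.
rewrite (ge0_ae_eq_integral (g := fun w => ((`|rho w|)%:E * compound J phi t t' w)%E))//.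
- rewrite [X in (_ = X * _)%E](ge0_ae_eq_integral (g := fun w => (`|rho w|)%:E))//.
  + apply: (uncorrelatedM (X := rho) (Y := compound J phi t t')
      (g := fun x => (`|x|)%:E)) => //.
    * rewrite (compound_mean L0 mJ)// lte_mul_pinfty// lee_fin mulr_ge0 ?ltW//.
      by rewrite subr_gt0.
    * move=> B mB; apply: (history_uncorrelated L0 mJ) => //.
      by apply: (history_subset ut); exact: rhoH.
    * by apply/measurable_EFinP; exact: normr_measurable.
  + by apply: filterS rho_norm => w -> _.
- exact: emeasurable_funM.
- exact: emeasurable_funM.
- by move=> w _; rewrite mule_ge0.
- by move=> w _; rewrite mule_ge0.
- by apply: filterS rho_norm => w -> _.
Qed.

(** Tonelli reduces products with the service over an interval to products with the capacity at
    single instants. *)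
Lemma integral_servedM s t (Z : Omega -> \bar R) : measurable_fun setT Z ->
  (forall w, (0 <= Z w)%E) ->
  (\int[Pr]_w (served r s t w * Z w) =
   \int[mu]_u ((\1_`]s, t] u)%:E * \int[Pr]_w ((`|capacity r u w|)%:E * Z w)))%E.
Proof.
move=> mZ Z0.
pose F (z : R * Omega) := ((`|capacity r z.1 z.2| * \1_`]s, t] z.1)%:E * Z z.2)%E.
have mF : measurable_fun setT F.
  apply: emeasurable_funM; first exact: (measurable_served_term rJ s t).
  exact: (measurableT_comp mZ).
have F0 z : (0 <= F z)%E by rewrite mule_ge0.
have := @fubini_tonelli _ _ _ _ _ mu Pr F mF F0; rewrite /F/= => E.
transitivity (\int[Pr]_w \int[mu]_u ((`|capacity r u w| * \1_`]s, t] u)%:E * Z w))%E.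
  apply: eq_integral => w _; rewrite ge0_integralZr//.
  exact: measurable_fun_pair1 (measurable_served_term rJ s t).
rewrite -E; apply: eq_integral => u _.
rewrite -ge0_integralZl//; last first.
- by move=> w _; rewrite mule_ge0.
- apply: emeasurable_funM => //; apply/measurable_EFinP; apply: measurableT_comp => //.
  exact: (measurable_capacity rJ u).
by apply: eq_integral => w _; rewrite muleA -EFinM mulrC.
Qed.

Lemma integral_served s t : (\int[Pr]_w served r s t w =
  \int[mu]_u ((\1_`]s, t] u)%:E * \int[Pr]_w (`|capacity r u w|)%:E))%E.
Proof.
transitivity (\int[Pr]_w (served r s t w * 1%:E))%E.
  by apply: eq_integral => w _; rewrite mule1.
have mc : measurable_fun setT (cst 1%E : Omega -> \bar R) by exact: measurable_cst.
rewrite (integral_servedM s t mc (fun=> lee01)).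
by apply: eq_integral => u _; under eq_integral do rewrite mule1.
Qed.

(** At each instant [u <= t] the capacity is known from the past, so [capacity_uncorrelated] applies
    under the integral over [u]. *)
Lemma served_uncorrelated (phi : R * R -> R) (s t t' : R) : 0 < t -> t < t' ->
  measurable_fun setT phi -> (forall z, 0 <= phi z) -> (mark_integral J phi < +oo)%E ->
  (\int[Pr]_w (served r s t w * compound J phi t t' w) =
   \int[Pr]_w served r s t w * \int[Pr]_w compound J phi t t' w)%E.
Proof.
move=> t0 tt' mphi phi0 phioo.
have C0 w : (0 <= compound J phi t t' w)%E by exact: compound_ge0.
rewrite integral_servedM//; last exact: measurable_compound.
rewrite integral_served -ge0_integralZr; [|by []| | |].
- apply: eq_integral => u _; rewrite indicE -muleA.
  have [|_] := boolP (u \in _); last by rewrite !mul0e.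
  rewrite inE/= in_itv/= => /andP[_ ut]; congr (_ * _)%E.
  exact: capacity_uncorrelated.
- apply: emeasurable_funM; first by apply/measurable_EFinP; exact: measurable_indic.
  apply: (@measurable_fun_fubini_tonelli_F _ _ _ _ _ Pr
    (fun z : R * Omega => (`|capacity r z.1 z.2|)%:E)).
    by apply/measurable_EFinP; apply: measurableT_comp => //; exact: measurable_capacity2 rJ.
  by move=> z; rewrite lee_fin.
- by move=> u _; rewrite mule_ge0// ?lee_fin// integral_ge0// => w _; rewrite lee_fin.
- by apply: integral_ge0 => w _.
Qed.

End Nonanticipation.

Section Work.
Context d (Omega : measurableType d) (R : realType) (Pr : probability Omega R).
Context (J : jobs Pr) (Lambda : R) (S : set (R * R)) (f : R * R -> R).
Hypotheses (L0 : 0 < Lambda) (mJ : marked_poisson J Lambda f) (fS : is_density_on S f).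
Context (T : R).
Hypotheses (T0 : 0 < T)
  (fD : {ae lebesgue2 R, forall z, f z != 0 -> mark_domain T z}).
Variable r : @rate_process d Omega R.
Hypotheses (rJ : service J r) (rf : feasible J r).
Let mu := @lebesgue_measure R.

Definition size_on_domain : R * R -> R := on_domain T fst.

Lemma size_on_domain_bounds z : 0 <= size_on_domain z <= T.
Proof.
apply: on_domain_bounds; first exact: ltW.
by move=> {}z [z1 [z12 z2]]; rewrite (ltW z1) (le_trans z12).
Qed.

Lemma measurable_size_on_domain : measurable_fun setT size_on_domain.
Proof. by apply: measurable_on_domain; exact: measurable_fst. Qed.

Let sz0 z : 0 <= size_on_domain z.
Proof. by have /andP[] := size_on_domain_bounds z. Qed.

(* The total remaining demand at time t. *)
Definition work (t : R) (w : Omega) : R :=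
  fine (compound J size_on_domain 0 t w) - fine (served r 0 t w).

(** [rate_served] is summed over the finitely many jobs arrived by [t]: each contributes its
    remaining demand, at most its size and only within its window. *)
Lemma regular_work w t : regular_path J T r w ->
  [/\ compound J size_on_domain 0 t w \is a fin_num, served r 0 t w \is a fin_num,
      0 <= work t w & ((work t w)%:E <= shot_noise J size_on_domain t w)%E].
Proof.
move=> wr; have [w1 apos wD rb r_demand] := wr; have [K aK] := w1 t.
have mr k : measurable_fun setT (fun u => r k u w).
  exact: measurable_fun_pair1 (service_measurable rJ k).
pose I k := (\int[mu]_u (r k u w * \1_`]0%R, t] u)%:E)%E.
have IP k : I k \is a fin_num /\
    0 <= demand J k w * \1_`]0, t] (arrival J k w) - fine (I k)
      <= demand J k w * active J k t w.
  exact: (rate_served t (apos k) (mr k) (rb k) (r_demand k)).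
have EA := compound_finite 0 sz0 aK.
have ES : served r 0 t w = (\sum_(k < K) fine (I k))%:E.
  rewrite -sumEFin; under eq_bigr do rewrite fineK ?(IP _).1//.
  rewrite /I -ge0_integral_sum//.
  - apply: eq_integral => u _; rewrite sumEFin -mulr_suml indicE.
    have [|_] := boolP (u \in _); last by rewrite !mulr0.
    rewrite inE/= in_itv/= => /andP[_ ut]; rewrite ger0_norm ?(capacity_ge0 u wr)//.
    by rewrite (capacity_finite wr aK).
  - move=> k; apply/measurable_EFinP; apply: measurable_funM; [exact: mr|exact: measurable_indic].
  - by move=> k u _; rewrite lee_fin mulr_ge0//; have /andP[] := rb k u.
rewrite /work EA ES; split=> //=.
  rewrite -sumrB sumr_ge0// => k _; have [_ /andP[+ _]] := IP k.
  by rewrite /size_on_domain on_domainE.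
rewrite /shot_noise (@nneseries_split _ _ 0 K)/=; last first.
  by move=> k _; rewrite lee_fin mulr_ge0.
rewrite add0n sumEFin big_mkord -[leLHS]adde0 leeD//.
  rewrite lee_fin -sumrB; apply: ler_sum => k _; have [_ /andP[_ +]] := IP k.
  by rewrite /size_on_domain on_domainE.
by apply: nneseries_ge0 => k _; rewrite lee_fin mulr_ge0.
Qed.

Lemma measurable_work t : measurable_fun setT (work t).
Proof.
apply: measurable_funB; apply: measurableT_comp => //.
  by apply: measurable_compound => //; exact: measurable_size_on_domain.
exact: (measurable_served rJ 0 t).
Qed.

Lemma ae_work_ge0 t : {ae Pr, forall w, 0 <= work t w}.
Proof.
by apply: filterS (ae_regular_path L0 mJ fS fD rf) => w /(regular_work t)[].
Qed.

Definition inflow (t t' : R) w := fine (compound J size_on_domain t t' w).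
Definition outflow (t t' : R) w := fine (served r t t' w).

Lemma regular_work_step w (t t' : R) : 0 <= t -> t <= t' -> regular_path J T r w ->
  [/\ compound J size_on_domain t t' w \is a fin_num, served r t t' w \is a fin_num
    & work t' w = work t w + inflow t t' w - outflow t t' w].
Proof.
move=> t0 tt' wr; have [A1 S1 _ _] := regular_work t wr.
have [A2 S2 _ _] := regular_work t' wr; rewrite /work.
have EA := compound_cat J sz0 w t0 tt'; have ES := served_cat rJ w t0 tt'.
have A3 : compound J size_on_domain t t' w \is a fin_num.
  by move: A2; rewrite EA fin_numD => /andP[].
have S3 : served r t t' w \is a fin_num.
  by move: S2; rewrite ES fin_numD => /andP[].
split=> //; rewrite EA ES (fineD A1 A3) (fineD S1 S3) -/(inflow t t' w) -/(outflow t t' w).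
by rewrite opprD !addrA [X in X - _]addrAC.
Qed.

(** For [n >= 4], [n <= 4 (n - 3)], whence [4 ^ 4 = 256]; below 4 the constant term suffices. *)
Lemma expn4_le_ffact n : (n ^ 4 <= 256 * (1 + n ^_ 4))%N.
Proof.
case: n => [|[|[|[|n]]]] //; rewrite !ffactnS ffactn0 /= muln1.
nia.
Qed.

(** The capacity is at most the number of arrivals in []t - T, t]], which is Poisson of parameter
    [Lambda T] whatever [t]; this uniformity is what [stationary_moments] asks for. *)
Lemma capacity_fourth_moment (t : R) : T < t ->
  (\int[Pr]_w (capacity r t w ^+ 4)%:E <= (256 * (1 + (Lambda * T) ^+ 4))%:E)%E.
Proof.
move=> Tt; pose N w := fine (arrivals_in J (t - T) t w).
have mN : measurable_fun setT N.
  by apply: measurableT_comp => //; exact: measurable_arrivals_in.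
have N0 w : 0 <= N w by rewrite fine_ge0// arrivals_in_ge0.
have tT0 : 0 <= t - T by rewrite subr_ge0 ltW.
have tT : t - T < t by rewrite gtrBl.
have mN4 : measurable_fun setT (fun w => (N w ^+ 4)%:E).
  by apply/measurable_EFinP; exact: measurable_funX.
have LT : Lambda * (t - (t - T)) = Lambda * T by congr (_ * _); ring.
have LT0 : 0 < Lambda * T by rewrite mulr_gt0.
apply: (@le_trans _ _ (\int[Pr]_w (N w ^+ 4)%:E)%E).
  apply: ae_ge0_le_integral => //.
  - by move=> w _; rewrite lee_fin (exprM _ 2 2) sqr_ge0.
  - apply/measurable_EFinP; apply: measurable_funX; exact: measurable_capacity rJ t.
  - by move=> w _; rewrite lee_fin exprn_ge0.
  - apply: filterS (ae_regular_path L0 mJ fS fD rf) => w wr _; rewrite lee_fin.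
    rewrite lerXn2r ?nnegrE ?(capacity_ge0 t wr)// -lee_fin /N.
    rewrite (@fineK _ (arrivals_in J (t - T) t w)).
      exact: (capacity_le_arrivals wr (lexx t) (lexx t)).
    have [w1 _ _ _ _] := wr; have [K aK] := w1 t.
    by rewrite arrivals_in_compound (compound_finite _ _ aK).
rewrite (@integral_arrivals_in_fun _ _ _ _ _ _ L0 (marked_arrivals mJ) (t - T) t
  (fun n => (n ^ 4)%:R))//; last 2 first.
- by move=> w; rewrite lee_fin exprn_ge0.
- by move=> w n wn; rewrite /N wn/= natrX.
rewrite LT.
have pmf0 n : 0 <= poisson_pmf (Lambda * T) n by exact: poisson_pmf_ge0.
have mom j := poisson_factorial_moment LT0 j.
apply: (@le_trans _ _ (\sum_(0 <= n <oo) (256 * (n ^_ 0)%:R * poisson_pmf (Lambda * T) n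
   + 256 * (n ^_ 4)%:R * poisson_pmf (Lambda * T) n)%:E)%E).
  apply: lee_nneseries => [n _|n _]; first by rewrite lee_fin mulr_ge0.
  rewrite lee_fin -mulrDl ler_wpM2r// -mulrDr -natrD -natrM ler_nat ffactn0.
  exact: expn4_le_ffact.
under eq_eseriesr do rewrite EFinD.
rewrite nneseriesD; last 2 first.
- by move=> n _ _; rewrite lee_fin; apply: mulr_ge0 (mulr_ge0 (ler0n _ _) (ler0n _ _)) (pmf0 n).
- by move=> n _ _; rewrite lee_fin; apply: mulr_ge0 (mulr_ge0 (ler0n _ _) (ler0n _ _)) (pmf0 n).
under eq_eseriesr do rewrite -mulrA EFinM.
rewrite nneseriesZl; last by move=> n _; rewrite lee_fin mulr_ge0.
under [X in (_ + X)%E]eq_eseriesr do rewrite -mulrA EFinM.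
rewrite nneseriesZl; last by move=> n _; rewrite lee_fin mulr_ge0.
by rewrite !mom -!EFinM -EFinD -mulrDr expr0.
Qed.

End Work.

Section RintegralAe.
Context d (Omega : measurableType d) (R : realType) (Pr : probability Omega R).

Lemma ae_le_Rintegral (X Y : Omega -> R) :
  Pr.-integrable setT (EFin \o X) -> Pr.-integrable setT (EFin \o Y) ->
  {ae Pr, forall w, X w <= Y w} -> \int[Pr]_w X w <= \int[Pr]_w Y w.
Proof.
move=> iX iY XY; rewrite -subr_ge0 -RintegralB//.
have iB : Pr.-integrable setT (EFin \o (fun w => Y w - X w)) by exact: (integrableB measurableT iY iX).
have -> : \int[Pr]_w (Y w - X w) = \int[Pr]_w `|Y w - X w|.
  congr fine; apply: ae_eq_integral => //.
  - exact: measurable_int iB.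
  - apply/measurable_EFinP; apply: measurableT_comp => //.
    by apply/measurable_EFinP; exact: measurable_int iB.
  - by apply: filterS XY => w XY _ /=; rewrite ger0_norm// subr_ge0.
by apply: Rintegral_ge0 => w _; exact: normr_ge0.
Qed.

Lemma ae_eq_Rintegral (X Y : Omega -> R) :
  Pr.-integrable setT (EFin \o X) -> Pr.-integrable setT (EFin \o Y) ->
  {ae Pr, forall w, X w = Y w} -> \int[Pr]_w X w = \int[Pr]_w Y w.
Proof.
move=> iX iY XY; apply/le_anti/andP.
by split; apply: ae_le_Rintegral => //; apply: filterS XY => w ->.
Qed.

Lemma integral_indic_itv_cst (s t c : R) : s <= t -> 0 <= c ->
  (\int[@lebesgue_measure R]_u ((\1_`]s, t] u)%:E * c%:E) = (c * (t - s))%:E)%E.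
Proof.
move=> st c0; rewrite ge0_integralZr//; last first.
  by apply/measurable_EFinP; exact: measurable_indic.
have -> : (\int[@lebesgue_measure R]_u (\1_`]s, t] u)%:E)%E = lebesgue_measure `]s, t].
  by rewrite integral_indic// setIT.
rewrite lebesgue_measure_itv/= lte_fin.
move: st; rewrite le_eqVlt => /predU1P[->|st].
  by rewrite ltxx mul0e subrr mulr0.
by rewrite st -EFinB -EFinM mulrC.
Qed.

Lemma sum_sqr_le (x : nat -> R) n : (forall k, 0 <= x k) ->
  \sum_(k < n) x k ^+ 2 <= (\sum_(k < n) x k) ^+ 2.
Proof.
move=> x0; elim: n => [|n IH]; first by rewrite !big_ord0 expr0n.
rewrite !big_ord_recr/=.
have s0 : 0 <= \sum_(k < n) x k by exact: sumr_ge0.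
have := mulr_ge0 s0 (x0 n); move: IH.
move: (\sum_(k < n) x k ^+ 2) (\sum_(k < n) x k) (x n) => a b c.
by rewrite !expr2; nra.
Qed.

End RintegralAe.

(** * Moments of the work and of its increments *)

Section WorkMoments.
Context d (Omega : measurableType d) (R : realType) (Pr : probability Omega R).
Context (J : jobs Pr) (Lambda : R) (S : set (R * R)) (f : R * R -> R).
Hypotheses (L0 : 0 < Lambda) (mJ : marked_poisson J Lambda f) (fS : is_density_on S f).
Context (T : R).
Hypotheses (T0 : 0 < T)
  (fD : {ae lebesgue2 R, forall z, f z != 0 -> mark_domain T z}).
Variable r : @rate_process d Omega R.
Hypotheses (rc : centralized J r) (rf : feasible J r).
Let mu := @lebesgue_measure R.
Let rJ : service J r := centralized_service rc.
Let sz := size_on_domain T.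
Let szT : forall z, 0 <= sz z <= T := size_on_domain_bounds T0.
Let msz : measurable_fun setT sz := measurable_size_on_domain T.
Let sz0 z : 0 <= sz z.
Proof. by have /andP[] := szT z. Qed.
Let reg := ae_regular_path L0 mJ fS fD rf.

Definition work_bound : R :=
  Lambda * mark_mean f (fun sigma tau => tau * sigma ^+ 2) +
  (Lambda * mark_mean f (fun sigma tau => tau * sigma)) ^+ 2.

Let q1 := mark_mean f (fun sigma tau => sigma).
Let q2 := mark_mean f (fun sigma tau => sigma ^+ 2).

Let mark1 : mark_integral J sz = q1%:E.
Proof.
apply: (mark_meanE mJ fS fD (C := T)) => //; first exact: measurable_fst.
by move=> z zD; rewrite /sz /size_on_domain on_domainE.
Qed.

Let mark2 : mark_integral J (fun z => sz z ^+ 2) = q2%:E.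
Proof.
apply: (mark_meanE mJ fS fD (C := T ^+ 2)).
- exact: measurable_funX.
- move=> z; have /andP[z0 zT] := szT z.
  by rewrite sqr_ge0/= lerXn2r// nnegrE ltW.
- by apply: measurable_funX; exact: measurable_fst.
- by move=> z zD; rewrite /sz /size_on_domain on_domainE.
Qed.

Let sz_sojourn (g : R -> R) (C : R) z :
  (forall x, 0 <= x <= T -> 0 <= g x <= C) -> g 0 = 0 -> 0 <= g (sz z) * z.2 <= C * T.
Proof.
move=> gC g0; have /andP[gz0 gzC] := gC _ (szT z).
have [E|sn0] := eqVneq (sz z) 0.
  by rewrite E g0 mul0r lexx /= (mulr_ge0 (le_trans gz0 gzC) (ltW T0)).
have /andP[z0 zT] := on_domain_support sn0.
by rewrite mulr_ge0//= ler_pM.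
Qed.

Let markA : mark_integral J (fun z => sz z ^+ 2 * z.2) =
  (mark_mean f (fun sigma tau => tau * sigma ^+ 2))%:E.
Proof.
have m2 : measurable_fun setT (snd : R * R -> R) by exact: measurable_snd.
have m1 : measurable_fun setT (fst : R * R -> R) by exact: measurable_fst.
apply: (mark_meanE mJ fS fD (C := T ^+ 2 * T)).
- by apply: measurable_funM => //; exact: measurable_funX.
- move=> z; apply: (sz_sojourn (g := fun x => x ^+ 2)); last by rewrite expr0n.
  by move=> x /andP[x0 xT]; rewrite sqr_ge0/= lerXn2r// nnegrE ltW.
- by apply: measurable_funM => //; exact: measurable_funX.
- by move=> z zD; rewrite /sz /size_on_domain on_domainE// mulrC.
Qed.

Let markB : mark_integral J (fun z => sz z * z.2) =
  (mark_mean f (fun sigma tau => tau * sigma))%:E.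
Proof.
have m2 : measurable_fun setT (snd : R * R -> R) by exact: measurable_snd.
have m1 : measurable_fun setT (fst : R * R -> R) by exact: measurable_fst.
apply: (mark_meanE mJ fS fD (C := T * T)).
- exact: measurable_funM.
- by move=> z; exact: (sz_sojourn (g := id)).
- exact: measurable_funM.
- by move=> z zD; rewrite /sz /size_on_domain on_domainE// mulrC.
Qed.

Lemma work_sqr t : T < t ->
  Pr.-integrable setT (EFin \o (fun w => work J T r t w ^+ 2)) /\
  \int[Pr]_w work J T r t w ^+ 2 <= work_bound.
Proof.
move=> Tt; have mW := measurable_work T0 rJ t.
have mW2 : measurable_fun setT (fun w => work J T r t w ^+ 2).
  exact: measurable_funX.
have mS : measurable_fun setT (shot_noise J sz t) by exact: measurable_shot_noise.
have le : (\int[Pr]_w (work J T r t w ^+ 2)%:E <= work_bound%:E)%E.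
  have := shot_noise_sqr_le L0 mJ msz szT T0 (@on_domain_support _ T _) Tt markA markB.
  apply: le_trans; apply: ae_ge0_le_integral => //.
  - by move=> w _; rewrite lee_fin sqr_ge0.
  - exact/measurable_EFinP.
  - by move=> w _; rewrite mule_ge0// (shot_noise_ge0 _ szT).
  - exact: emeasurable_funM.
  - apply: filterS reg => w /(regular_work T0 rJ t)[_ _ W0 WS] _.
    by rewrite expr2 EFinM lee_pmul// lee_fin.
have iW2 := integrable_ge0 mW2 (fun w => sqr_ge0 _) le.
by split=> //; rewrite -lee_fin -EFin_Rintegral.
Qed.

(** Sizes are nonnegative, so the squared inflow is at least the sum of the squared sizes, a
    compound sum of mean [Lambda h q2]. *)
Lemma inflow_moments (t h : R) : T < t -> 0 < h ->
  [/\ Pr.-integrable setT (EFin \o (fun w => inflow J T t (t + h) w ^+ 2)),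
      \int[Pr]_w inflow J T t (t + h) w = Lambda * h * q1
    & Lambda * h * q2 <= \int[Pr]_w inflow J T t (t + h) w ^+ 2].
Proof.
move=> Tt h0; have t0 : 0 < t := lt_trans T0 Tt.
have th : t < t + h by rewrite ltrDl.
have hE : t + h - t = h by rewrite addrAC subrr add0r.
pose U := compound J sz t (t + h).
have mU : measurable_fun setT U by exact: measurable_compound.
have U0 w : (0 <= U w)%E by exact: compound_ge0.
have Uf : {ae Pr, forall w, U w \is a fin_num}.
  by apply: filterS reg => w /(regular_work_step T0 rJ (ltW t0) (ltW th))[].
have meanU : (\int[Pr]_w U w = (Lambda * h * q1)%:E)%E.
  by rewrite (compound_mean L0 mJ t0 th msz sz0) mark1 ?ltry// hE EFinM.
have leU : (\int[Pr]_w U w <= (Lambda * h * q1)%:E)%E by rewrite meanU.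
have [_ EU] := ae_fine_integrable mU U0 Uf leU.
have mZ : measurable_fun setT (inflow J T t (t + h)) by exact: measurableT_comp.
have mZ2 : measurable_fun setT (fun w => inflow J T t (t + h) w ^+ 2).
  exact: measurable_funX.
have le : (\int[Pr]_w (inflow J T t (t + h) w ^+ 2)%:E <=
    (Lambda * h * q2 + T ^+ 2 * (Lambda * h) ^+ 2)%:E)%E.
  have := compound_sqr_le L0 mJ t0 th msz szT; rewrite hE mark2 -EFinM -EFinD.
  apply: le_trans; apply: ae_ge0_le_integral => //.
  - by move=> w _; rewrite lee_fin sqr_ge0.
  - exact/measurable_EFinP.
  - by move=> w _; rewrite mule_ge0.
  - exact: emeasurable_funM.
  - by apply: filterS Uf => w Uw _; rewrite expr2 EFinM /inflow -/sz -/(U w) fineK.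
have iZ2 := integrable_ge0 mZ2 (fun w => sqr_ge0 _) le.
split=> //; first by apply: EFin_inj; rewrite -meanU EU.
rewrite -lee_fin -EFin_Rintegral// EFinM -{1}hE -mark2 -(compound_mean L0 mJ t0 th)//.
- apply: ae_ge0_le_integral => //.
  + by move=> w _; apply: compound_ge0 => z; exact: sqr_ge0.
  + by apply: measurable_compound => [z|]; [exact: sqr_ge0|exact: measurable_funX].
  + by move=> w _; rewrite lee_fin sqr_ge0.
  + exact/measurable_EFinP.
  + apply: filterS reg => w [w1 _ _ _ _] _; have [K aK] := w1 (t + h).
    rewrite /inflow -/sz !(compound_finite _ _ aK)//; last by move=> z; exact: sqr_ge0.
    pose x (k : nat) := sz (mark J k w) * \1_`]t, t + h] (arrival J k w).
    have x0 k : 0 <= x k by rewrite mulr_ge0.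
    rewrite lee_fin /=; apply: (le_trans _ (sum_sqr_le K x0)).
    apply: ler_sum => k _; rewrite [x k ^+ 2]exprMn ler_wpM2l ?sqr_ge0// indicE.
    by case: (_ \in _); rewrite ?expr1n ?expr0n.
- exact: measurable_funX.
- by move=> z; exact: sqr_ge0.
- by rewrite mark2 ltry.
Qed.

(** During the step the capacity is at most the number of arrivals in []t - T, t + h]], hence the
    factor [h ^ 2]; [T + 1] replaces [T + h] to free the constant from [h]. *)
Lemma outflow_sqr (t h : R) : T < t -> 0 < h -> h <= 1 ->
  Pr.-integrable setT (EFin \o (fun w => outflow r t (t + h) w ^+ 2)) /\
  \int[Pr]_w outflow r t (t + h) w ^+ 2 <=
    h ^+ 2 * (Lambda * (T + 1) + (Lambda * (T + 1)) ^+ 2).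
Proof.
move=> Tt h0 h1; have t0 : 0 < t := lt_trans T0 Tt.
have th : t < t + h by rewrite ltrDl.
have tT : t - T < t + h by rewrite (lt_trans _ th)// gtrBl.
have hE : t + h - t = h by rewrite addrAC subrr add0r.
have LE : t + h - (t - T) = T + h by ring.
pose N := arrivals_in J (t - T) (t + h).
have mN : measurable_fun setT N by exact: measurable_arrivals_in.
have N0 w : (0 <= N w)%E by exact: arrivals_in_ge0.
have mO : measurable_fun setT (outflow r t (t + h)).
  by apply: measurableT_comp => //; exact: (measurable_served rJ).
have mO2 : measurable_fun setT (fun w => outflow r t (t + h) w ^+ 2).
  exact: measurable_funX.
have le : (\int[Pr]_w (outflow r t (t + h) w ^+ 2)%:E <=
    (h ^+ 2 * (Lambda * (T + 1) + (Lambda * (T + 1)) ^+ 2))%:E)%E.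
  apply: (@le_trans _ _ (\int[Pr]_w ((h ^+ 2)%:E * (N w * N w)))%E).
    apply: ae_ge0_le_integral => //.
    - by move=> w _; rewrite lee_fin sqr_ge0.
    - exact/measurable_EFinP.
    - by move=> w _; rewrite mule_ge0 ?lee_fin ?sqr_ge0// mule_ge0.
    - by apply: emeasurable_funM => //; exact: emeasurable_funM.
    - apply: filterS reg => w wr _; rewrite expr2 EFinM (expr2 h) EFinM muleACA.
      have [_ Sf _] := regular_work_step T0 rJ (ltW t0) (ltW th) wr.
      have := served_le_arrivals rJ wr (ltW th); rewrite hE -/(N w) => Sle.
      by rewrite /outflow !fineK// lee_pmul// served_ge0.
  rewrite ge0_integralZl_EFin ?sqr_ge0//; last 2 first.
  - by move=> w _; rewrite mule_ge0.
  - exact: emeasurable_funM.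
  rewrite /N (arrivals_in_sqr L0 (marked_arrivals mJ))// ?subr_ge0 ?(ltW Tt)//.
  rewrite LE -EFinM lee_fin ler_wpM2l ?sqr_ge0//.
  have le1 : Lambda * (T + h) <= Lambda * (T + 1) by rewrite ler_wpM2l ?(ltW L0)// lerD2l.
  have ge0 : 0 <= Lambda * (T + h) by rewrite mulr_ge0 ?addr_ge0 ?ltW.
  by rewrite lerD// lerXn2r// nnegrE// (le_trans ge0).
have iO2 := integrable_ge0 mO2 (fun w => sqr_ge0 _) le.
by split=> //; rewrite -lee_fin -EFin_Rintegral.
Qed.

Let bound := work_bound.

Lemma size_mark_integral_lty : (mark_integral J sz < +oo)%E.
Proof. by rewrite ltey_eq (mark_integral_fin J msz szT). Qed.

(** The work is the past inflow minus the past service, two nonnegative variables each uncorrelated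
    with the later inflow. *)
Lemma work_inflow_uncorrelated (t h : R) : 0 < t -> 0 < h ->
  \int[Pr]_w (work J T r t w * inflow J T t (t + h) w) =
  \int[Pr]_w work J T r t w * \int[Pr]_w inflow J T t (t + h) w.
Proof.
move=> t0 h0; have th : t < t + h by rewrite ltrDl.
have soo := size_mark_integral_lty.
pose A := compound J sz 0 t; pose D := served r 0 t; pose Z := compound J sz t (t + h).
have mA : measurable_fun setT A by exact: measurable_compound.
have mZ : measurable_fun setT Z by exact: measurable_compound.
have mD : measurable_fun setT D by exact: (measurable_served rJ).
have A0 w : (0 <= A w)%E by exact: compound_ge0.
have Z0 w : (0 <= Z w)%E by exact: compound_ge0.
have D0 w : (0 <= D w)%E by exact: served_ge0.
have Af : {ae Pr, forall w, A w \is a fin_num}.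
  by apply: filterS reg => w /(regular_work T0 rJ t)[].
have Df : {ae Pr, forall w, D w \is a fin_num}.
  by apply: filterS reg => w /(regular_work T0 rJ t)[].
have Zf : {ae Pr, forall w, Z w \is a fin_num}.
  by apply: filterS reg => w /(regular_work_step T0 rJ (ltW t0) (ltW th))[].
have intA : (\int[Pr]_w A w <= (T * (Lambda * (t - 0)))%:E)%E.
  rewrite EFinM -(arrivals_in_mean L0 (marked_arrivals mJ) (lexx 0) t0).
  rewrite -ge0_integralZl_EFin ?(ltW T0)//; last 2 first.
  - by move=> w _; exact: arrivals_in_ge0.
  - exact: measurable_arrivals_in.
  apply: ae_ge0_le_integral => //.
  - by move=> w _; rewrite mule_ge0 ?arrivals_in_ge0// lee_fin ltW.
  - by apply: emeasurable_funM => //; exact: measurable_arrivals_in.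
  - apply: filterS reg => w [w1 _ _ _ _] _; have [K aK] := w1 t.
    rewrite arrivals_in_compound /A !(compound_finite _ _ aK)// lee_fin mulr_sumr.
    apply: ler_sum => k _; rewrite mul1r ler_wpM2r//.
    by have /andP[] := szT (mark J k w).
(* Service is dominated by inflow because the work is nonnegative. *)
have intD : (\int[Pr]_w D w <= (T * (Lambda * (t - 0)))%:E)%E.
  apply: le_trans intA; apply: ae_ge0_le_integral => //.
  apply: filterS reg => w /(regular_work T0 rJ t)[Aw Dw W0 _] _.
  by move: W0; rewrite /work subr_ge0 -lee_fin !fineK.
have intZ : (\int[Pr]_w Z w <= (\int[Pr]_w fine (Z w))%:E)%E.
  have ZE := compound_mean L0 mJ t0 th msz sz0 soo.
  have zf := mark_integral_fin J msz szT.
  have Zle : (\int[Pr]_w Z w <= (fine (\int[Pr]_w Z w))%:E)%E.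
    by rewrite fineK// ZE fin_numM.
  by have [_ <-] := ae_fine_integrable mZ Z0 Zf Zle.
have AZ := compound_uncorrelated L0 mJ 0 t0 th (lexx t) msz sz0 msz sz0 soo.
have DZ := served_uncorrelated L0 mJ rc 0 t0 th msz sz0 soo.
have [iAZ EAZ] := fine_uncorrelated mA mZ A0 Z0 Af Zf intA intZ AZ.
have [iDZ EDZ] := fine_uncorrelated mD mZ D0 Z0 Df Zf intD intZ DZ.
have [iA _] := ae_fine_integrable mA A0 Af intA.
have [iD _] := ae_fine_integrable mD D0 Df intD.
have WE : (fun w => work J T r t w * inflow J T t (t + h) w) =
    (fun w => fine (A w) * fine (Z w) - fine (D w) * fine (Z w)).
  by apply/funext => w; rewrite -mulrBl.
rewrite WE RintegralB// EAZ EDZ -mulrBl; congr (_ * _).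
by rewrite -RintegralB.
Qed.

(** Tonelli reduces the outflow of the step to the capacity at each of its instants [u]. [Z] is to
    be the work at the start of the step, fixed while [u] moves. *)
Lemma outflow_le (t h c : R) (Z : Omega -> R) : 0 < t -> 0 < h -> 0 <= c ->
  measurable_fun setT Z -> {ae Pr, forall w, 0 <= Z w} ->
  Pr.-integrable setT (EFin \o (fun w => Z w * outflow r t (t + h) w)) ->
  (forall u, t < u -> Pr.-integrable setT (EFin \o (fun w => Z w * capacity r u w)) /\
     \int[Pr]_w (Z w * capacity r u w) <= c) ->
  \int[Pr]_w (Z w * outflow r t (t + h) w) <= c * h.
Proof.
move=> t0 h0 c0 mZ Z0 iZO Zc.
have th : t < t + h by rewrite ltrDl.
have hE : t + h - t = h by rewrite addrAC subrr add0r.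
have mO : measurable_fun setT (outflow r t (t + h)).
  by apply: measurableT_comp => //; exact: (measurable_served rJ).
have mZn : measurable_fun setT (fun w => (`|Z w|)%:E).
  by apply/measurable_EFinP; exact: measurableT_comp.
rewrite -lee_fin -EFin_Rintegral//.
apply: (@le_trans _ _ (\int[Pr]_w (served r t (t + h) w * (`|Z w|)%:E))%E).
  have iE : (\int[Pr]_w (Z w * outflow r t (t + h) w)%:E =
      \int[Pr]_w (served r t (t + h) w * (`|Z w|)%:E))%E.
    apply: ae_eq_integral => //.
    - by apply/measurable_EFinP; exact: measurable_funM.
    - by apply: emeasurable_funM => //; exact: (measurable_served rJ).
    - apply: filterS2 reg Z0 => w wr w0 _ /=.
      have [_ Sf _] := regular_work_step T0 rJ (ltW t0) (ltW th) wr.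
      by rewrite ger0_norm// /outflow EFinM fineK// muleC.
  by rewrite iE.
rewrite (integral_servedM rc) => [|//|w]; last by rewrite lee_fin.
rewrite -[X in (c * X)%:E]hE -(integral_indic_itv_cst (ltW th) c0).
have mcap u : measurable_fun setT (fun w => (`|capacity r u w|)%:E).
  by apply/measurable_EFinP; apply: measurableT_comp => //; exact: (measurable_capacity rJ u).
apply: ge0_le_integral => //.
- move=> u _; apply: mule_ge0; first by rewrite lee_fin.
  by apply: integral_ge0 => w _; apply: mule_ge0; rewrite lee_fin.
- apply: emeasurable_funM; first by apply/measurable_EFinP; exact: measurable_indic.
  apply: (@measurable_fun_fubini_tonelli_F _ _ _ _ _ Pr
    (fun z : R * Omega => (`|capacity r z.1 z.2|)%:E * (`|Z z.2|)%:E)%E).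
    apply: emeasurable_funM.
      by apply/measurable_EFinP; apply: measurableT_comp => //; exact: measurable_capacity2 rJ.
    by apply: (measurableT_comp mZn); exact: measurable_snd.
  by move=> z; apply: mule_ge0; rewrite lee_fin.
- apply: emeasurable_funM => //; first by apply/measurable_EFinP; exact: measurable_indic.
- move=> u _; rewrite indicE; have [|_] := boolP (u \in _); last by rewrite !mul0e.
  rewrite inE/= in_itv/= => /andP[tu _]; rewrite !mul1e.
  have [iZc Zcu] := Zc _ tu.
  have -> : (\int[Pr]_w ((`|capacity r u w|)%:E * (`|Z w|)%:E) =
      \int[Pr]_w (Z w * capacity r u w)%:E)%E.
    apply: ae_eq_integral => //.
    - exact: emeasurable_funM.
    - exact: measurable_int iZc.
    - apply: filterS2 reg Z0 => w wr w0 _ /=.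
      by rewrite !ger0_norm ?(capacity_ge0 u wr)// -EFinM mulrC.
  by rewrite EFin_Rintegral// lee_fin.
Qed.

Lemma outflow_mean_ge (t h c : R) : 0 < t -> 0 < h -> 0 <= c ->
  Pr.-integrable setT (EFin \o outflow r t (t + h)) ->
  (forall u, t < u -> Pr.-integrable setT (EFin \o capacity r u) /\
     c <= \int[Pr]_w capacity r u w) ->
  c * h <= \int[Pr]_w outflow r t (t + h) w.
Proof.
move=> t0 h0 c0 iO Pc; have th : t < t + h by rewrite ltrDl.
have hE : t + h - t = h by rewrite addrAC subrr add0r.
have OE : (\int[Pr]_w (outflow r t (t + h) w)%:E = \int[Pr]_w served r t (t + h) w)%E.
  apply: ae_eq_integral => //.
  - exact: measurable_int iO.
  - exact: (measurable_served rJ).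
  - apply: filterS reg => w wr _ /=; rewrite /outflow fineK//.
    by have [_ Sf _] := regular_work_step T0 rJ (ltW t0) (ltW th) wr.
rewrite -lee_fin -EFin_Rintegral// OE (integral_served rc).
rewrite -[X in (c * X)%:E]hE -(integral_indic_itv_cst (ltW th) c0).
have mi : measurable_fun setT (EFin \o \1_`]t, (t + h)] : R -> \bar R).
  by apply/measurable_EFinP; exact: measurable_indic.
apply: ge0_le_integral => //.
- by move=> u _; apply: mule_ge0; rewrite lee_fin.
- exact: emeasurable_funM.
- apply: emeasurable_funM => //.
  apply: (@measurable_fun_fubini_tonelli_F _ _ _ _ _ Pr
    (fun z : R * Omega => (`|capacity r z.1 z.2|)%:E)).
    by apply/measurable_EFinP; apply: measurableT_comp => //; exact: measurable_capacity2 rJ.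
  by move=> z; rewrite lee_fin.
- move=> u _; rewrite indicE; have [|_] := boolP (u \in _); last by rewrite !mul0e.
  rewrite inE/= in_itv/= => /andP[tu _]; rewrite !mul1e.
  have [iP cP] := Pc _ tu.
  have -> : (\int[Pr]_w (`|capacity r u w|)%:E = \int[Pr]_w (capacity r u w)%:E)%E.
    apply: ae_eq_integral => //.
    - apply/measurable_EFinP; apply: measurableT_comp => //.
      exact: (measurable_capacity rJ u).
    - exact: measurable_int iP.
    - by apply: filterS reg => w wr _ /=; rewrite ger0_norm ?(capacity_ge0 u wr).
  by rewrite EFin_Rintegral// lee_fin.
Qed.

Let iZ (a : R) (X : Omega -> R) : Pr.-integrable setT (EFin \o X) ->
  Pr.-integrable setT (EFin \o (fun w => a * X w)).
Proof. by move=> iX; exact: (integrableZl measurableT a iX). Qed.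

Let iD (X Y : Omega -> R) : Pr.-integrable setT (EFin \o X) ->
  Pr.-integrable setT (EFin \o Y) -> Pr.-integrable setT (EFin \o (fun w => X w + Y w)).
Proof. by move=> iX iY; exact: (integrableD measurableT iX iY). Qed.

Lemma work_step (t h : R) : T < t -> 0 < h -> h <= 1 ->
  [/\ Pr.-integrable setT (EFin \o work J T r t),
      Pr.-integrable setT (EFin \o inflow J T t (t + h)),
      Pr.-integrable setT (EFin \o outflow r t (t + h))
    & \int[Pr]_w work J T r (t + h) w =
      \int[Pr]_w work J T r t w + Lambda * h * q1 - \int[Pr]_w outflow r t (t + h) w].
Proof.
move=> Tt h0 h1; have t0 : 0 < t := lt_trans T0 Tt.
have th : t < t + h by rewrite ltrDl.
have Tth := lt_trans Tt th.
have mW s := measurable_work T0 rJ s.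
have iW s : T < s -> Pr.-integrable setT (EFin \o work J T r s).
  by move=> Ts; have [i _] := work_sqr Ts; exact: (integrable_sqr (mW s) i).
have mI : measurable_fun setT (inflow J T t (t + h)).
  by apply: measurableT_comp => //; exact: measurable_compound.
have mO : measurable_fun setT (outflow r t (t + h)).
  by apply: measurableT_comp => //; exact: (measurable_served rJ).
have [iI2 IE _] := inflow_moments Tt h0.
have [iO2 _] := outflow_sqr Tt h0 h1.
have iI := integrable_sqr mI iI2; have iO := integrable_sqr mO iO2.
have iX := iW _ Tt; split=> //.
have iXI := iD iX iI.
rewrite -IE -(RintegralD measurableT iX iI) -(RintegralB measurableT iXI iO).
apply: (ae_eq_Rintegral (iW _ Tth) (integrableB measurableT iXI iO)).
- apply: filterS reg => w wr.
  by have [_ _ ->] := regular_work_step T0 rJ (ltW t0) (ltW th) wr.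
Qed.

(** With [I] the inflow and [O] the outflow, [(X + I - O) ^ 2] is expanded. Uncorrelatedness gives
    [2 E[X I] = 2 Lambda h q1 E[X]]; [2 E[X O]] is at most [2 h m E[X]] plus the terms in [theta];
    [(I - O) ^ 2] is split with weight [eps], which puts [E[O ^ 2]], of order [h ^ 2], into the last
    error term. *)
Lemma work_sqr_step (t h theta eps m s : R) : T < t -> 0 < h -> h <= 1 ->
  0 < theta -> 0 < eps -> eps <= 1 -> m <= Lambda * q1 ->
  (forall u, t < u -> (\int[Pr]_w ((capacity r u w - m) ^+ 2)%:E <= s%:E)%E) ->
  \int[Pr]_w work J T r t w ^+ 2 +
    h * ((1 - eps) * (Lambda * q2) - theta * bound - s / theta -
         h * ((Lambda * (T + 1) + (Lambda * (T + 1)) ^+ 2) / eps))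
  <= \int[Pr]_w work J T r (t + h) w ^+ 2.
Proof.
move=> Tt h0 h1 theta0 eps0 eps1 mq1 dev; have t0 : 0 < t := lt_trans T0 Tt.
have th : t < t + h by rewrite ltrDl.
have Tth := lt_trans Tt th.
have [iX iI iO _] := work_step Tt h0 h1.
have [iX2 X2] := work_sqr Tt.
have [iY2 _] := work_sqr Tth.
have [iI2 IE I2] := inflow_moments Tt h0.
have [iO2 O2] := outflow_sqr Tt h0 h1.
have XI := work_inflow_uncorrelated t0 h0.
have mX := measurable_work T0 rJ t.
have mI : measurable_fun setT (inflow J T t (t + h)).
  by apply/measurable_EFinP; exact: measurable_int iI.
have mO : measurable_fun setT (outflow r t (t + h)).
  by apply/measurable_EFinP; exact: measurable_int iO.
have iXI := integrable_sqrM mX mI iX2 iI2.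
have iXO := integrable_sqrM mX mO iX2 iO2.
have X0 : {ae Pr, forall w, 0 <= work J T r t w} := ae_work_ge0 L0 mJ fS T0 fD rJ rf t.
(* [c] bounds [E[X P_u]], split as [m E[X] + E[X (P_u - m)]]. *)
pose c := m * \int[Pr]_w work J T r t w + (theta / 2 * bound + (2 * theta)^-1 * s).
have XP u : t < u ->
    Pr.-integrable setT (EFin \o (fun w => work J T r t w * capacity r u w)) /\
    \int[Pr]_w (work J T r t w * capacity r u w) <= c.
  move=> tu; have mP := measurable_capacity rJ u.
  have mPm : measurable_fun setT (fun w => capacity r u w - m) by exact: measurable_funB.
  have iP2 := integrable_ge0 (measurable_funX 2 mPm) (fun w => sqr_ge0 _) (dev _ tu).
  have iXP := integrable_sqrM mX mPm iX2 iP2.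
  have WE : (fun w => work J T r t w * capacity r u w) =
      (fun w => work J T r t w * (capacity r u w - m) + m * work J T r t w).
    by apply/funext => w; ring.
  have iXC : Pr.-integrable setT (EFin \o (fun w => work J T r t w * capacity r u w)).
    by rewrite WE; exact: iD iXP (iZ m iX).
  split=> //.
  apply: (@le_trans _ _ (\int[Pr]_w (m * work J T r t w +
    (theta / 2 * work J T r t w ^+ 2 + (2 * theta)^-1 * (capacity r u w - m) ^+ 2)))).
    apply: le_Rintegral => //.
      exact: iD (iZ m iX) (iD (iZ _ iX2) (iZ _ iP2)).
    move=> w _; move: (work J T r t w) (capacity r u w) => x p.
    (* AM-GM: [x (p - m) <= theta x^2 / 2 + (p - m)^2 / (2 theta)] *)
    rewrite -subr_ge0.
    have -> : m * x + (theta / 2 * x ^+ 2 + (2 * theta)^-1 * (p - m) ^+ 2) - x * p =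
        (2 * theta)^-1 * (theta * x - (p - m)) ^+ 2.
      by field; rewrite gt_eqF.
    by rewrite mulr_ge0 ?sqr_ge0// invr_ge0 mulr_ge0// ltW.
  rewrite RintegralD//; [|exact: iZ|exact: iD (iZ _ iX2) (iZ _ iP2)].
  rewrite RintegralD//; [|exact: iZ|exact: iZ].
  rewrite !RintegralZl// lerD2l lerD// ler_wpM2l//.
  - by rewrite divr_ge0// ltW.
  - by rewrite invr_ge0 mulr_ge0// ltW.
  - by rewrite -lee_fin -EFin_Rintegral//; exact: dev.
have c0 : 0 <= c.
  have [iXP /(le_trans _)] := XP _ th; apply.
  rewrite -[leLHS](Rintegral_probability_cst Pr 0); apply: ae_le_Rintegral => //.
    exact: integrable_probability_cst.
  apply: filterS2 reg X0 => w wr w0.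
  by rewrite mulr_ge0// (capacity_ge0 _ wr).
have XO := outflow_le t0 h0 c0 mX X0 iXO XP.
pose X := work J T r t; pose I := inflow J T t (t + h); pose O := outflow r t (t + h).
(* The integrands differ by [(eps I - O) ^ 2 / eps + O ^ 2]. *)
have le : \int[Pr]_w (X w ^+ 2 + (2 * (X w * I w) + (- 2 * (X w * O w) +
    ((1 - eps) * I w ^+ 2 + - eps^-1 * O w ^+ 2)))) <= \int[Pr]_w work J T r (t + h) w ^+ 2.
  apply: ae_le_Rintegral => //.
    exact: iD iX2 (iD (iZ 2 iXI) (iD (iZ (- 2) iXO) (iD (iZ _ iI2) (iZ _ iO2)))).
  apply: filterS reg => w wr.
  have [_ _ ->] := regular_work_step T0 rJ (ltW t0) (ltW th) wr.
  rewrite -/(X w) -/(I w) -/(O w) -subr_ge0; move: (X w) (I w) (O w) => x i o.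
  have -> : (x + i - o) ^+ 2 - (x ^+ 2 + (2 * (x * i) + (- 2 * (x * o) +
      ((1 - eps) * i ^+ 2 + - eps^-1 * o ^+ 2)))) = eps^-1 * (eps * i - o) ^+ 2 + o ^+ 2.
    by field; rewrite gt_eqF.
  by rewrite addr_ge0 ?sqr_ge0// mulr_ge0 ?sqr_ge0// invr_ge0 ltW.
apply: le_trans le.
rewrite RintegralD//; last exact: iD (iZ 2 iXI) (iD (iZ (- 2) iXO) (iD (iZ _ iI2) (iZ _ iO2))).
rewrite RintegralD//; [|exact: iZ|exact: iD (iZ (- 2) iXO) (iD (iZ _ iI2) (iZ _ iO2))].
rewrite RintegralD//; [|exact: iZ|exact: iD (iZ _ iI2) (iZ _ iO2)].
rewrite RintegralD//; [|exact: iZ|exact: iZ].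
rewrite !RintegralZl// XI IE lerD2l.
have EX0 : 0 <= \int[Pr]_w X w.
  rewrite -[leLHS](Rintegral_probability_cst Pr 0); apply: ae_le_Rintegral => //.
  exact: integrable_probability_cst.
(* The mean terms need not cancel, but as [E[X] >= 0] and [m <= Lambda q1] their difference is
   nonnegative. *)
have h1' : m * (h * \int[Pr]_w X w) <= Lambda * q1 * (h * \int[Pr]_w X w).
  by rewrite ler_wpM2r// mulr_ge0// ltW.
have h2' : (1 - eps) * (Lambda * h * q2) <= (1 - eps) * \int[Pr]_w I w ^+ 2.
  by rewrite ler_wpM2l// subr_ge0.
have h3' : eps^-1 * \int[Pr]_w O w ^+ 2 <=
    eps^-1 * (h ^+ 2 * (Lambda * (T + 1) + (Lambda * (T + 1)) ^+ 2)).
  by rewrite ler_wpM2l// invr_ge0 ltW.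
have h4' : 2 * (c * h) = 2 * (m * (h * \int[Pr]_w X w)) + h * (theta * bound + s / theta).
  by rewrite /c; field; rewrite gt_eqF.
rewrite -/X -/I -/O in XO *.
move: h1' h2' h3' h4' XO; rewrite -/q1 -/q2.
move: (\int[Pr]_w X w) (\int[Pr]_w I w ^+ 2) (\int[Pr]_w O w ^+ 2)
  (\int[Pr]_w (X w * O w)) (Lambda * (T + 1) + _) => EX EI EO EXO K1.
have -> : h * ((1 - eps) * (Lambda * q2) - theta * bound - s / theta - h * (K1 / eps)) =
  (1 - eps) * (Lambda * h * q2) - h * (theta * bound + s / theta) - eps^-1 * (h ^+ 2 * K1).
  by ring.
move: (eps^-1) (c * h) (h * (theta * bound + s / theta)) => e ch g.
lra.
Qed.

End WorkMoments.

(** * The lower bound on the variance *)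

Section Drift.
Context (R : realType).

Lemma bounded_no_drift (u : nat -> R) (c M : R) : 0 < c ->
  (forall n, u n + c <= u n.+1) -> ~ (forall n, u n <= M).
Proof.
move=> c0 uc uM.
have un n : u 0%N + n%:R * c <= u n.
  elim: n => [|n IH]; first by rewrite mul0r addr0.
  by apply: le_trans (uc n); rewrite -addn1 natrD mulrDl mul1r addrA lerD2r.
pose x := (`|M| + `|u 0%N|) / c.
have x0 : 0 <= x by rewrite divr_ge0 ?addr_ge0// ltW.
have := archi_boundP x0; set n := Num.bound x.
rewrite /x ltr_pdivrMr// => xn.
have := le_trans (un n) (uM n); have := ler_norm M; have := ler_norm (- u 0%N).
by rewrite normrN; lra.
Qed.

(** Lets an auxiliary parameter tend to 0; [h], [eta] and [eps] are removed in this way. *)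
Lemma ler_scaled (a b K : R) :
  (forall x, 0 < x -> x <= 1 -> a <= b + x * K) -> a <= b.
Proof.
move=> h; rewrite leNgt; apply/negP => ba; pose e := a - b.
have e0 : 0 < e by rewrite subr_gt0.
have D0 : 0 < 2 * (`|K| + e) by rewrite mulr_gt0// ltr_wpDl.
have x0 : 0 < e / (2 * (`|K| + e)) by rewrite divr_gt0.
have x1 : e / (2 * (`|K| + e)) <= 1.
  by rewrite ler_pdivrMr// mul1r; have := normr_ge0 K; lra.
have xK : e / (2 * (`|K| + e)) * K <= e / 2.
  rewrite mulrAC ler_pdivrMr//.
  have : e * K <= e * (`|K| + e) by rewrite ler_wpM2l ?(ltW e0)// ler_wpDr ?ler_norm ?ltW.
  by move=> le1; rewrite (le_trans le1)// (_ : e / 2 * _ = e * (`|K| + e))//; field.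
by have := h _ x0 x1; move: xK; rewrite /e; lra.
Qed.

End Drift.

Section LowerBound.
Context d (Omega : measurableType d) (R : realType) (Pr : probability Omega R).
Context (J : jobs Pr) (Lambda : R) (S : set (R * R)) (f : R * R -> R).
Hypotheses (L0 : 0 < Lambda) (mJ : marked_poisson J Lambda f) (fS : is_density_on S f).
Context (T : R).
Hypotheses (T0 : 0 < T)
  (fD : {ae lebesgue2 R, forall z, f z != 0 -> mark_domain T z}).

(** A nonnegative variable of mean 0 vanishes almost surely, whereas [psi] is positive at almost
    every mark. *)
Lemma mark_mean_gt0 (psi : R -> R -> R) (C : R) :
  measurable_fun setT (fun z => psi z.1 z.2) ->
  (forall z, mark_domain T z -> 0 < psi z.1 z.2 <= C) -> 0 < mark_mean f psi.
Proof.
move=> mpsi psiC; pose phi := on_domain T (fun z => psi z.1 z.2).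
have mphi : measurable_fun setT phi by exact: measurable_on_domain.
have phi_bounds z : 0 <= phi z <= `|C|.
  apply: on_domain_bounds; first exact: normr_ge0.
  move=> {}z zD; have /andP[p0 pC] := psiC z zD.
  by rewrite (ltW p0) (le_trans pC (ler_norm _)).
have phi0 z : 0 <= phi z by have /andP[] := phi_bounds z.
have E := mark_meanE mJ fS fD mphi phi_bounds mpsi
  (fun z => @on_domainE _ T (fun z => psi z.1 z.2) z).
have mphiX : measurable_fun setT (fun w => (phi (mark J 0 w))%:E).
  by apply/measurable_EFinP; apply: measurableT_comp => //; exact: measurable_mark.
rewrite -lte_fin -E lt_def mark_integral_ge0// andbT; apply/eqP => M0.
have /(ae_eq_integral_abs _ measurableT mphiX) ae0 :
    (\int[Pr]_w `|(phi (mark J 0 w))%:E| = 0)%E.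
  transitivity (mark_integral J phi); last exact: M0.
  by apply: eq_integral => w _; rewrite gee0_abs// lee_fin.
have [N [mN N0 sN]] : {ae Pr, forall w, False}.
  apply: filterS2 ae0 (ae_mark_domain mJ fS fD) => w w0 wD.
  have /andP[p0 _] := psiC _ (wD 0%N); have := w0 I.
  by rewrite /phi on_domainE// => -[] e0; move: p0; rewrite e0 ltxx.
have : (Pr setT <= Pr N)%E by apply: le_measure; rewrite ?inE// => w _; exact: sN.
by rewrite N0 probability_setT lee_fin ler10.
Qed.

Variable r : @rate_process d Omega R.
Hypotheses (rc : centralized J r) (rf : feasible J r).
Let rJ : service J r := centralized_service rc.
Let q1 := mark_mean f (fun sigma tau => sigma).
Let q2 := mark_mean f (fun sigma tau => sigma ^+ 2).

(* If the mean capacity exceeded the mean inflow, the nonnegative mean work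
   would decrease linearly. *)
Lemma capacity_mean_le (m v : R) :
  (forall eta, 0 < eta -> exists t1, forall t, t1 < t ->
    (\int[Pr]_w ((capacity r t w - m) ^+ 2)%:E <= (v + eta)%:E)%E /\
    `|\int[Pr]_w capacity r t w - m| <= eta) ->
  m <= Lambda * q1.
Proof.
move=> Pm; rewrite leNgt; apply/negP => q1m.
(* Half the gap: [m - eta = Lambda q1 + eta], so the mean work falls by at least [eta] per unit of
   time. *)
pose eta := (m - Lambda * q1) / 2.
have eta0 : 0 < eta by rewrite divr_gt0// subr_gt0.
have [t1 t1P] := Pm _ eta0.
pose t0 := Num.max T t1 + 1.
have tn n : Num.max T t1 < t0 + n%:R by rewrite /t0 -addrA ltrDl ltr_wpDr.
have Tn n : T < t0 + n%:R by rewrite (le_lt_trans _ (tn n))// le_max lexx.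
have t1n n : t1 < t0 + n%:R by rewrite (le_lt_trans _ (tn n))// le_max lexx orbT.
have q1_ge0 : 0 <= Lambda * q1.
  have [_ + _] := inflow_moments L0 mJ fS T0 fD rc rf (Tn 0%N) ltr01.
  rewrite mulr1 => <-; apply: Rintegral_ge0 => w _; rewrite fine_ge0// compound_ge0// => z.
  by have /andP[] := size_on_domain_bounds T0 z.
pose u n := - \int[Pr]_w work J T r (t0 + n%:R) w.
apply: (@bounded_no_drift _ u eta 0 eta0) => n; last first.
  rewrite /u oppr_le0 -[leLHS](Rintegral_probability_cst Pr 0).
  have [iW _ _ _] := work_step L0 mJ fS T0 fD rc rf (Tn n) ltr01 (lexx 1).
  apply: ae_le_Rintegral => //; first exact: integrable_probability_cst.
  exact: (ae_work_ge0 L0 mJ fS T0 fD rJ rf).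
have [_ _ iO WE] := work_step L0 mJ fS T0 fD rc rf (Tn n) ltr01 (lexx 1).
have mE : m - eta = Lambda * q1 + eta by rewrite /eta; field.
have c0 : 0 <= m - eta by rewrite mE addr_ge0// ltW.
have tn0 : 0 < t0 + n%:R := lt_trans T0 (Tn n).
have OE : (m - eta) * 1 <= \int[Pr]_w outflow r (t0 + n%:R) (t0 + n%:R + 1) w.
  apply: (outflow_mean_ge L0 mJ fS T0 fD rc rf tn0 ltr01 c0 iO) => s ns.
  have [dev mean] := t1P _ (lt_trans (t1n n) ns).
  have mP := measurable_capacity rJ s.
  have mPm : measurable_fun setT (fun w => capacity r s w - m) by exact: measurable_funB.
  have iP2 := integrable_ge0 (measurable_funX 2 mPm) (fun w => sqr_ge0 _) dev.
  have [iP _ _] := mean_square_deviation mP iP2.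
  by split=> //; move: mean; rewrite ler_norml lerBlDr => /andP[+ _]; rewrite lerBrDr addrC.
rewrite /u -[in leRHS]natr1 addrA WE; move: OE; rewrite mE !mulr1 => OE.
by rewrite !opprD opprK -[leRHS]addrA lerD2l [leRHS]addrC lerBrDr addrC.
Qed.

Lemma feasible_variance_ge v : stationary_variance Pr (capacity r) v ->
  0 < q2 -> 0 < work_bound Lambda f -> (Lambda * q2) ^+ 2 <= 4 * work_bound Lambda f * v.
Proof.
move=> Pv q2_gt0; set bound := work_bound Lambda f => bound0.
have mP t : measurable_fun setT (capacity r t) by exact: (measurable_capacity rJ t).
have [m Pm] := stationary_moments mP Pv (capacity_fourth_moment L0 mJ fS T0 fD rJ rf).
have mq1 := capacity_mean_le Pm.
pose K := Lambda * (T + 1) + (Lambda * (T + 1)) ^+ 2.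
have no_drift theta eps eta h : 0 < theta -> 0 < eps -> eps <= 1 -> 0 < eta ->
    0 < h -> h <= 1 ->
    (1 - eps) * (Lambda * q2) - theta * bound - (v + eta) / theta - h * (K / eps) <= 0.
  move=> theta0 eps0 eps1 eta0 h0 h1; rewrite leNgt; apply/negP.
  set c := (X in 0 < X) => c0; have [t1 t1P] := Pm _ eta0.
  pose t0 := Num.max T t1 + 1.
  have tn n : Num.max T t1 < t0 + n%:R * h.
    by rewrite /t0 -addrA ltrDl ltr_wpDr// mulr_ge0// ltW.
  have Tn n : T < t0 + n%:R * h by rewrite (le_lt_trans _ (tn n))// le_max lexx.
  have t1n n : t1 < t0 + n%:R * h by rewrite (le_lt_trans _ (tn n))// le_max lexx orbT.
  pose u n := \int[Pr]_w work J T r (t0 + n%:R * h) w ^+ 2.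
  have hc0 : 0 < h * c by rewrite mulr_gt0.
  apply: (@bounded_no_drift _ u (h * c) bound hc0) => n; last first.
    by have [] := work_sqr L0 mJ fS T0 fD rc rf (Tn n).
  rewrite /u -[in leRHS]natr1 mulrDl mul1r addrA.
  apply: (work_sqr_step L0 mJ fS T0 fD rc rf (m := m)) => // s ns.
  by have [] := t1P _ (lt_trans (t1n n) ns).
pose q := Lambda * q2.
have q0 : 0 < q by rewrite mulr_gt0.
(* The limit in [h] is taken at fixed [eps], because its error is [h K / eps]; then [eta] and
   finally [eps] go to 0. *)
have key theta : 0 < theta -> q <= theta * bound + v / theta.
  move=> theta0; apply: (@ler_scaled _ _ _ q) => eps eps0 eps1.
  suff : (1 - eps) * q <= theta * bound + v / theta by rewrite mulrBl mul1r; lra.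
  apply: (@ler_scaled _ _ _ theta^-1) => eta eta0 _.
  apply: (@ler_scaled _ _ _ (K / eps)) => h h0 h1.
  have := no_drift theta eps eta h theta0 eps0 eps1 eta0 h0 h1.
  by rewrite -/q (mulrDl v eta); lra.
(* This [theta] makes [theta * bound] half of [q]. The minimiser [sqrt (v / bound)] of the
   right-hand side leads to the same inequality but degenerates at [v = 0]. *)
have theta0 : 0 < q / (2 * bound) by rewrite divr_gt0// mulr_gt0.
have := key _ theta0.
have -> : q / (2 * bound) * bound = q / 2 by field; rewrite gt_eqF.
have -> : v / (q / (2 * bound)) = 2 * bound * v / q by field; rewrite !gt_eqF.
move=> kq; have : q / 2 <= 2 * bound * v / q by lra.
rewrite ler_pdivlMr// => kq2; rewrite -/q expr2; lra.
Qed.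

End LowerBound.

Theorem corollary2 (R : realType) (d : measure_display)
    (Omega : measurableType d) (Pr : probability Omega R)
    (Lambda : R) (S : set (R * R)) (f : R * R -> R) (J : jobs Pr)
    (r : rate_process) (VarP : R) :
  0 < Lambda ->
  is_density_on S f ->
  marked_poisson J Lambda f ->
  exact_scheduling J r ->
  stationary_variance Pr (capacity r) VarP ->
  (VarP%:E <=
   (4 * mark_mean f (fun sigma tau => sigma ^+ 2 / tau) *
    (mark_mean f (fun sigma tau => tau * sigma ^+ 2) +
     Lambda * mark_mean f (fun sigma tau => tau * sigma) ^+ 2) /
    mark_mean f (fun sigma tau => sigma ^+ 2) ^+ 2)%:E * optimal_variance J)%E.
Proof.
move=> L0 fS mJ er PV; have [T [T0 fD]] := support_mark_domain fS.
have m1 : measurable_fun setT (fst : R * R -> R) by exact: measurable_fst.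
have m2 : measurable_fun setT (snd : R * R -> R) by exact: measurable_snd.
have domT z : mark_domain T z -> [/\ 0 < z.1, 0 < z.2, z.1 <= T & z.2 <= T].
  move=> [z1 [z12 z2]]; split=> //; [exact: lt_le_trans z1 z12|exact: le_trans z12 z2].
have V_le := exact_variance_le L0 mJ fS T0 fD er PV.
set a := mark_mean f _ in V_le *.
set b := mark_mean f (fun sigma tau => tau * sigma ^+ 2).
set c := mark_mean f (fun sigma tau => tau * sigma).
set q := mark_mean f (fun sigma tau => sigma ^+ 2).
have a0 : 0 < a.
  apply: (mark_mean_gt0 mJ fS fD (C := T)) => [|z zD].
    apply: measurable_funM; first exact: measurable_funX.
    exact: (measurableT_comp (@measurable_inv R) m2).
  have [z1 [z12 _]] := zD; have [_ z2 z1T _] := domT z zD.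
  by rewrite divr_gt0 ?exprn_gt0//= ler_pdivrMr// expr2 ler_pM// ltW.
have b0 : 0 < b.
  apply: (mark_mean_gt0 mJ fS fD (C := T * T ^+ 2)) => [|z /domT[z1 z2 z1T z2T]].
    by apply: measurable_funM => //; exact: measurable_funX.
  rewrite mulr_gt0 ?exprn_gt0//= ler_pM ?sqr_ge0 ?(ltW z2)//.
  by rewrite lerXn2r// nnegrE ltW.
have q0 : 0 < q.
  apply: (mark_mean_gt0 mJ fS fD (C := T ^+ 2)) => [|z /domT[z1 z2 z1T z2T]].
    exact: (measurable_funX 2 m1).
  by rewrite exprn_gt0//= lerXn2r// nnegrE ltW.
have bc0 : 0 < b + Lambda * c ^+ 2.
  by rewrite ltr_pwDl// mulr_ge0 ?sqr_ge0// ltW.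
(* A factor [Lambda] comes out of the bound. It cancels one of the two in [(Lambda q) ^ 2]; the
   other is the one in [exact_variance_le]. *)
have boundE : work_bound Lambda f = Lambda * (b + Lambda * c ^+ 2).
  by rewrite /work_bound -/b -/c; ring.
have C0 : 0 < 4 * a * (b + Lambda * c ^+ 2) / q ^+ 2.
  by rewrite divr_gt0 ?exprn_gt0// !mulr_gt0.
(* Dividing by the positive constant turns the claim into a lower bound on an infimum, to be checked
   policy by policy; if no policy has a stationary variance, the infimum is [+oo] and the bound
   holds. *)
rewrite -lee_pdivrMl//; apply: le_ereal_inf_tmp => _ [v [r' [rc rf Pv]] <-].
rewrite lee_pdivrMl// -EFinM lee_fin (le_trans V_le)//.
have bound0 : 0 < work_bound Lambda f by rewrite boundE mulr_gt0.
have := feasible_variance_ge L0 mJ fS T0 fD rc rf Pv q0 bound0.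
rewrite boundE -/q => le.
have le' : Lambda * q ^+ 2 <= 4 * (b + Lambda * c ^+ 2) * v.
  rewrite -(ler_pM2l L0) (_ : Lambda * (Lambda * q ^+ 2) = (Lambda * q) ^+ 2).
    by apply: (le_trans le); rewrite !mulrA [4 * Lambda]mulrC.
  by ring.
have -> : 4 * a * (b + Lambda * c ^+ 2) / q ^+ 2 * v =
    a * (4 * (b + Lambda * c ^+ 2) * v / q ^+ 2) by field; rewrite gt_eqF.
by rewrite mulrC ler_pM2l// ler_pdivlMr ?exprn_gt0.
Qed.
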